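(* Let $E$ and $F$ be directed graphs with no sinks, both satisfying Conditions (K), (W) and ($\infty$). Let $\Gamma,\Lambda$ be subgroups with $\mathsf{D}(\llbracket\mathcal{G}_E\rrbracket)\le\Gamma\le\llbracket\mathcal{G}_E\rrbracket$ and $\mathsf{D}(\llbracket\mathcal{G}_F\rrbracket)\le\Lambda\le\llbracket\mathcal{G}_F\rrbracket$. If $\Gamma\cong\Lambda$ as abstract groups, then $\mathcal{G}_E\cong\mathcal{G}_F$ as topological groupoids. In particular the following are equivalent: (1) $\mathcal{G}_E\cong\mathcal{G}_F$ as topological groupoids; (2) $\llbracket\mathcal{G}_E\rrbracket\cong\llbracket\mathcal{G}_F\rrbracket$ as abstract groups; (3) $\mathsf{D}(\llbracket\mathcal{G}_E\rrbracket)\cong\mathsf{D}(\llbracket\mathcal{G}_F\rrbracket)$ as abstract groups.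
   Context: A graph $E=(E^0,E^1,r,s)$; finite paths $\mu=e_1\cdots e_n$ with $r(e_i)=s(e_{i+1})$, vertices being paths of length $0$; $E^*$ is the set of finite paths, $vE^*w$ the paths from $v$ to $w$, $vE^1$ the edges with source $v$. A sink is $v$ with $vE^1=\emptyset$; an infinite emitter has $vE^1$ infinite; singular vertices are sinks and infinite emitters. Write $v\ge w$ if $vE^*w\ne\emptyset$. A cycle is a path of positive length with $r(\mu)=s(\mu)$; a return path is a cycle $e_1\cdots e_n$ with $r(e_i)\neq r(e_n)$ for $i<n$. Condition (K): for each vertex $v$ there is either no return path based at $v$ or at least two distinct return paths based at $v$. An infinite path $x=x_1x_2\cdots$ is wandering if each vertex occurs as $s(x_i)$ for only finitely many $i$. Condition (W): for every wandering infinite path $x$, $|s(x)E^*r(x_n)|\ge2$ for some $n$. Condition ($\infty$): for every infinite emitter $v$ the set $\{e\in vE^1: r(e)\ge v\}$ is infinite. Boundary path space $\partial E=E^\infty\cup\{\mu\in E^*: r(\mu)\text{ singular}\}$ with basis $Z(\mu)\setminus\bigcup_{e\in F}Z(\mu e)$ ($Z(\mu)=\{\mu x\in\partial E\}$, $F\subseteq r(\mu)E^1$ finite); shift $\sigma_E$ deletes the first edge. Graph groupoid $\mathcal{G}_E=\{(x,m-n,y): |x|\ge m,|y|\ge n,\sigma_E^m(x)=\sigma_E^n(y)\}$ with $(x,k,y)(y,l,z)=(x,k+l,z)$, $(x,k,y)^{-1}=(y,-k,x)$, unit space $\partial E$, and topology generated by $\{(x,m-n,y):x\in U,y\in V,\sigma_E^m(x)=\sigma_E^n(y)\}$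 for open $U,V$ on which $\sigma_E^m,\sigma_E^n$ are injective with equal images. For an effective ample groupoid $\mathcal{G}$, $\llbracket\mathcal{G}\rrbracket$ is the group of homeomorphisms $\pi_U=r|_U\circ(s|_U)^{-1}$ of $\mathcal{G}^{(0)}$ for full open bisections $U$ with compact support of $\pi_U$; $\mathsf{D}(\cdot)$ is the commutator subgroup. (Condition (K) implies every cycle has an exit, so $\mathcal{G}_E$ is effective.) *)

(* Defs.v *)
From Stdlib Require Import List ZArith Arith.
Import ListNotations.

Record graph := Graph {
  vert : Type;
  edge : Type;
  src : edge -> vert;
  rng : edge -> vert }.

Definition infinite_set {T : Type} (P : T -> Prop) : Prop :=
  forall l : list T, exists x, P x /\ ~ In x l.

Definition gen_open {T : Type} (B : (T -> Prop) -> Prop) (W : T -> Prop) : Prop :=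
  forall t, W t ->
    exists Bs : list (T -> Prop),
      (forall A, In A Bs -> B A /\ A t) /\
      (forall s, (forall A, In A Bs -> A s) -> W s).

Definition subgroup_of {T : Type} (H G : (T -> T) -> Prop) : Prop :=
  (forall f, H f -> G f) /\
  H (fun x => x) /\
  (forall f g, H f -> H g -> H (fun x => f (g x))) /\
  (forall f, H f -> exists g, H g /\ (forall x, g (f x) = x) /\ (forall x, f (g x) = x)).

(** Commutator subgroup D(H): finite products of commutators c = [a,b] of
    elements a, b of H (c is characterised by c o b o a = a o b). *)
Inductive comm_sub {T : Type} (H : (T -> T) -> Prop) : (T -> T) -> Prop :=
| cs_id : comm_sub H (fun x => x)
| cs_mul : forall (c f a b : T -> T),
    H a -> H b -> (forall x, c (b (a x)) = a (b x)) ->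
    comm_sub H f -> comm_sub H (fun x => c (f x)).

Definition group_iso {T1 T2 : Type} (H1 : (T1 -> T1) -> Prop) (H2 : (T2 -> T2) -> Prop) : Prop :=
  exists phi : (T1 -> T1) -> (T2 -> T2),
    (forall f, H1 f -> H2 (phi f)) /\
    (forall f g, H1 f -> H1 g -> phi f = phi g -> f = g) /\
    (forall h, H2 h -> exists f, H1 f /\ phi f = h) /\
    (forall f g, H1 f -> H1 g -> phi (fun x => f (g x)) = (fun y => phi f (phi g y))).

Section Graphs.
Variable E : graph.

Fixpoint chain (v : vert E) (l : list (edge E)) : Prop :=
  match l with
  | [] => True
  | e :: l' => src E e = v /\ chain (rng E e) l'
  end.

Fixpoint pend (v : vert E) (l : list (edge E)) : vert E :=
  match l with
  | [] => v
  | e :: l' => pend (rng E e) l'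
  end.

Definition path_from_to (v w : vert E) (l : list (edge E)) : Prop :=
  chain v l /\ pend v l = w.

Definition geq (v w : vert E) : Prop := exists l, path_from_to v w l.

Definition is_sink (v : vert E) : Prop := forall e, src E e <> v.
Definition inf_emitter (v : vert E) : Prop := infinite_set (fun e => src E e = v).
Definition singular (v : vert E) : Prop := is_sink v \/ inf_emitter v.

Definition no_sinks : Prop := forall v : vert E, exists e, src E e = v.

Definition return_path (v : vert E) (l : list (edge E)) : Prop :=
  l <> [] /\ chain v l /\ pend v l = v /\
  (forall i e, S i < length l -> nth_error l i = Some e -> rng E e <> v).

Definition condK : Prop :=
  forall v : vert E,
    (forall l, ~ return_path v l) \/
    (exists l1 l2, return_path v l1 /\ return_path v l2 /\ l1 <> l2).

Definition is_infpath (x : nat -> edge E) : Prop :=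
  forall i, rng E (x i) = src E (x (S i)).

Definition wandering (x : nat -> edge E) : Prop :=
  is_infpath x /\ forall v, exists N, forall i, N <= i -> src E (x i) <> v.

Definition condW : Prop :=
  forall x, wandering x ->
    exists n l1 l2, path_from_to (src E (x 0)) (rng E (x n)) l1 /\
                    path_from_to (src E (x 0)) (rng E (x n)) l2 /\ l1 <> l2.

Definition condInf : Prop :=
  forall v, inf_emitter v -> infinite_set (fun e => src E e = v /\ geq (rng E e) v).

Inductive bpath : Type :=
| BFin : vert E -> list (edge E) -> bpath
| BInf : (nat -> edge E) -> bpath.

Definition is_bpath (p : bpath) : Prop :=
  match p with
  | BFin v l => chain v l /\ singular (pend v l)
  | BInf x => is_infpath x
  end.

Definition BP : Type := {p : bpath | is_bpath p}.

Definition len_ge (p : bpath) (m : nat) : Prop :=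
  match p with
  | BFin _ l => m <= length l
  | BInf _ => True
  end.

(** sigma^m (meaningful when |p| >= m) *)
Definition shift (m : nat) (p : bpath) : bpath :=
  match p with
  | BFin v l => BFin (pend v (firstn m l)) (skipn m l)
  | BInf x => BInf (fun i => x (i + m))
  end.

Definition cyl (v : vert E) (l : list (edge E)) (p : bpath) : Prop :=
  match p with
  | BFin w l' => w = v /\ exists l'', l' = l ++ l''
  | BInf x => src E (x 0) = v /\ forall i e, nth_error l i = Some e -> x i = e
  end.

Definition bd_basic (A : BP -> Prop) : Prop :=
  exists v l (F : list (edge E)),
    chain v l /\ (forall e, In e F -> src E e = pend v l) /\
    forall p : BP, A p <->
      (cyl v l (proj1_sig p) /\ forall e, In e F -> ~ cyl v (l ++ [e]) (proj1_sig p)).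

Definition bd_open : (BP -> Prop) -> Prop := gen_open bd_basic.

Definition bd_closure (A : BP -> Prop) (x : BP) : Prop :=
  forall U, bd_open U -> U x -> exists y, U y /\ A y.

Definition bd_compact (K : BP -> Prop) : Prop :=
  forall C : (BP -> Prop) -> Prop,
    (forall U, C U -> bd_open U) ->
    (forall x, K x -> exists U, C U /\ U x) ->
    exists Us : list (BP -> Prop),
      (forall U, In U Us -> C U) /\ (forall x, K x -> exists U, In U Us /\ U x).

Definition in_groupoid (t : BP * Z * BP) : Prop :=
  match t with
  | (x, k, y) =>
      exists m n, len_ge (proj1_sig x) m /\ len_ge (proj1_sig y) n /\
        shift m (proj1_sig x) = shift n (proj1_sig y) /\
        k = (Z.of_nat m - Z.of_nat n)%Z
  end.

Definition GE : Type := {t : BP * Z * BP | in_groupoid t}.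

Definition g_r (g : GE) : BP := fst (fst (proj1_sig g)).
Definition g_k (g : GE) : Z := snd (fst (proj1_sig g)).
Definition g_s (g : GE) : BP := snd (proj1_sig g).

Definition g_mul_rel (g h k : GE) : Prop :=
  g_s g = g_r h /\ g_r k = g_r g /\ g_s k = g_s h /\ g_k k = (g_k g + g_k h)%Z.

Definition shift_inj_on (U : BP -> Prop) (m : nat) : Prop :=
  (forall x, U x -> len_ge (proj1_sig x) m) /\
  (forall x y, U x -> U y -> shift m (proj1_sig x) = shift m (proj1_sig y) -> x = y).

Definition g_basic (W : GE -> Prop) : Prop :=
  exists (U V : BP -> Prop) (m n : nat),
    bd_open U /\ bd_open V /\ shift_inj_on U m /\ shift_inj_on V n /\
    (forall q, (exists x, U x /\ shift m (proj1_sig x) = q) <->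
               (exists y, V y /\ shift n (proj1_sig y) = q)) /\
    forall g, W g <->
      (U (g_r g) /\ V (g_s g) /\ g_k g = (Z.of_nat m - Z.of_nat n)%Z /\
       shift m (proj1_sig (g_r g)) = shift n (proj1_sig (g_s g))).

Definition g_open : (GE -> Prop) -> Prop := gen_open g_basic.

Definition bisection (U : GE -> Prop) : Prop :=
  g_open U /\
  (forall g h, U g -> U h -> g_r g = g_r h -> g = h) /\
  (forall g h, U g -> U h -> g_s g = g_s h -> g = h).

Definition full_bisection (U : GE -> Prop) : Prop :=
  bisection U /\ (forall x, exists g, U g /\ g_r g = x) /\
  (forall x, exists g, U g /\ g_s g = x).

Definition full_group (f : BP -> BP) : Prop :=
  exists U, full_bisection U /\ (forall g, U g -> f (g_s g) = g_r g) /\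
            bd_compact (bd_closure (fun x => f x <> x)).

End Graphs.

Definition groupoid_iso (E F : graph) : Prop :=
  exists Phi : GE E -> GE F,
    (forall g1 g2, Phi g1 = Phi g2 -> g1 = g2) /\
    (forall h, exists g, Phi g = h) /\
    (forall W, g_open F W -> g_open E (fun g => W (Phi g))) /\
    (forall W, g_open E W -> g_open F (fun h => exists g, W g /\ Phi g = h)) /\
    (forall g h k, g_mul_rel E g h k <-> g_mul_rel F (Phi g) (Phi h) (Phi k)).

(* Main.v *)
(** The groups determine the action (Rubin): writing "f is algebraically disjoint from
    g" for the condition that every h not commuting with f admits f1, f2 in the
    centralizer of g with [[h, f1], f2] nontrivial and in that centralizer, disjoint
    supports imply algebraic disjointness, which implies that f and g^12 have disjoint
    supports.  Hence supp h is contained in supp f if and only if h commutes with g^12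
    for all such g, provided that small elements with g^12 <> 1 exist (a product of two
    nested three-cycles has order divisible by 9).  For graph groupoids the supports are compact
    open and form a basis, so a point is recovered as the intersection of the supports
    containing it, and a group isomorphism is implemented by a homeomorphism.

    Conditions (K), (W) and (infinity) put, inside every neighbourhood of every boundary
    path, three disjoint cylinders with a common tail; the three-cycle on them is a
    commutator.  These three-cycles supply the small elements, rule out isolated points,
    so that germs of homeomorphisms determine groupoid elements, and realize every
    groupoid element as a germ of a member of the commutator subgroup.  The conjugating
    homeomorphism therefore transports germs, that is, the groupoid. *)

Require Import Defs.
From Stdlib Require Import List ZArith Arith.
From Stdlib Require Import Lia Classical ClassicalEpsilon FunctionalExtensionality ProofIrrelevance.
Import Defs ListNotations.

(** * Reconstruction of a space from its homeomorphisms *)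

(** The exponent is 12 = lcm(1,2,3,4). If [h] is supported in [U], then [d = [[h,f1],f2]] moves
    points only in four translates of [U], by 1, [f1], [f2] and [f2 f1]. When [f1], [f2] and [d]
    commute with [g], the five points [p, g p, ..., g^4 p] on the orbit of a moved point fall into
    these four sets, so [U] meets [g^m U] for some 1 <= m <= 4. A second obstacle is the integer in
    a groupoid element [(x,k,y)]: the values of a homeomorphism show only [x] and [y]. If it acted
    near [y] with two different lags [k], an open set of tails would satisfy [a z = a' z] with words
    of different lengths. Such an equation has at most one solution, so [y] would be isolated. The
    three conditions divide the boundary. Condition (infinity) serves the finite boundary paths,
    which end at infinite emitters since there are no sinks; (K) serves infinite paths that visit
    some vertex infinitely often; (W) serves the wandering ones. *)

Definition comp {T : Type} (f g : T -> T) : T -> T := fun x => f (g x).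

Definition closure_moved {X : Type} (op : (X -> Prop) -> Prop) (f : X -> X) (x : X) : Prop :=
  forall U, op U -> U x -> exists y, U y /\ f y <> y.

Definition compact_set {X : Type} (op : (X -> Prop) -> Prop) (K : X -> Prop) : Prop :=
  forall C : (X -> Prop) -> Prop,
    (forall U, C U -> op U) ->
    (forall x, K x -> exists U, C U /\ U x) ->
    exists Us : list (X -> Prop),
      (forall U, In U Us -> C U) /\ (forall x, K x -> exists U, In U Us /\ U x).

(** The interface between topology and group: supports are open and compact, and every open set
    holds the support of an element of order dividing three that moves a prescribed point. The order
    is what allows two such elements to be nested in [pow12_moved]. *)
Record rubin_action {X : Type} (op : (X -> Prop) -> Prop) (G : (X -> X) -> Prop) : Prop := {
  ra_full : op (fun _ => True);
  ra_inter : forall U V, op U -> op V -> op (fun x => U x /\ V x);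
  ra_local : forall W : X -> Prop,
    (forall x, W x -> exists U, op U /\ U x /\ forall y, U y -> W y) -> op W;
  ra_haus : forall x y, x <> y ->
    exists U V, op U /\ op V /\ U x /\ V y /\ forall z, U z -> V z -> False;
  ra_id : G (fun x => x);
  ra_comp : forall f g, G f -> G g -> G (fun x => f (g x));
  ra_inv : forall f, G f -> exists g, G g /\ (forall x, g (f x) = x) /\ (forall x, f (g x) = x);
  ra_cont : forall f U, G f -> op U -> op (fun x => U (f x));
  ra_supp_open : forall f, G f -> op (closure_moved op f);
  ra_supp_compact : forall f, G f -> compact_set op (closure_moved op f);
  ra_move : forall U x, op U -> U x -> exists f, G f /\ f x <> x /\
    (forall y, closure_moved op f y -> U y) /\ (forall y, f (f (f y)) = y) }.

(** The equations say [c = [h,f1]] and [d = [c,f2]], so [d = [[h,f1],f2]]. They are written without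
    inverses so that the condition passes through any correspondence respecting composition. *)
Definition alg_disjoint {X : Type} (G : (X -> X) -> Prop) (f g : X -> X) : Prop :=
  forall h, G h -> comp f h <> comp h f ->
    exists f1 f2 c d, G f1 /\ G f2 /\ G c /\ G d /\
      comp f1 g = comp g f1 /\ comp f2 g = comp g f2 /\
      comp c (comp f1 h) = comp h f1 /\
      comp d (comp f2 c) = comp c f2 /\
      d <> (fun x => x) /\ comp d g = comp g d.

Definition pow {X : Type} (n : nat) (f : X -> X) : X -> X :=
  Nat.iter n (comp f) (fun x => x).

(** An injective map sends a point that it moves to a point that it moves, so where [f] moves [x],
    the map [g] fixes both [x] and [f x]. The left inverses stand for injectivity. *)
Lemma disjoint_commute {X : Type} (f g f' g' : X -> X) :
  (forall x, f' (f x) = x) -> (forall x, g' (g x) = x) ->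
  (forall x, f x = x \/ g x = x) -> comp f g = comp g f.
Proof.
  intros Hf Hg H. apply functional_extensionality; intro x; unfold comp.
  destruct (H x) as [e|e].
  - rewrite e. destruct (H (g x)) as [e'|e']; auto.
    assert (g x = x) by (rewrite <- (Hg (g x)), e'; auto). congruence.
  - rewrite e. destruct (H (f x)) as [e'|e']; auto.
    assert (f x = x) by (rewrite <- (Hf (f x)), e'; auto). congruence.
Qed.

(** Five indices in four classes. Two indices in 0..4 differ by 1, 2, 3 or 4, which are the divisors
    responsible for the exponent 12. *)
Lemma pigeonhole (A B C D : nat -> Prop) :
  (forall i, A i \/ B i \/ C i \/ D i) ->
  (forall i j, i < j <= 4 ->
     ~ (A i /\ A j) /\ ~ (B i /\ B j) /\ ~ (C i /\ C j) /\ ~ (D i /\ D j)) -> False.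
Proof.
  intros cov K.
  assert (KA : forall i j, i < j <= 4 -> A i -> A j -> False) by (intros i j ij; destruct (K i j ij); tauto).
  assert (KB : forall i j, i < j <= 4 -> B i -> B j -> False) by (intros i j ij; destruct (K i j ij); tauto).
  assert (KC : forall i j, i < j <= 4 -> C i -> C j -> False) by (intros i j ij; destruct (K i j ij); tauto).
  assert (KD : forall i j, i < j <= 4 -> D i -> D j -> False) by (intros i j ij; destruct (K i j ij); tauto).
  clear K.
  Ltac clash := try match goal with
    | K : forall i j, _ -> ?P i -> ?P j -> False, a : ?P ?i, b : ?P ?j |- _ =>
        exfalso; apply (K i j); [lia|assumption|assumption] end.
  destruct (cov 0) as [?|[?|[?|?]]]; destruct (cov 1) as [?|[?|[?|?]]]; clash;
  destruct (cov 2) as [?|[?|[?|?]]]; clash;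
  destruct (cov 3) as [?|[?|[?|?]]]; clash;
  destruct (cov 4) as [?|[?|[?|?]]]; clash.
Qed.

Section Action.
Context {X : Type} {op : (X -> Prop) -> Prop} {G : (X -> X) -> Prop}.
Hypothesis RA : rubin_action op G.

Lemma act_inj f x y : G f -> f x = f y -> x = y.
Proof.
  intros Gf e. destruct (ra_inv _ _ RA f Gf) as (g & _ & H & _).
  rewrite <- (H x), e; auto.
Qed.

Lemma act_pow n f : G f -> G (pow n f).
Proof.
  intro Gf; induction n; [apply (ra_id _ _ RA)|].
  apply (ra_comp _ _ RA f (pow n f)); auto.
Qed.

Lemma pow_fixed n (f : X -> X) x : f x = x -> pow n f x = x.
Proof. intro e; induction n; auto. simpl; unfold comp. fold (pow n f). rewrite IHn; auto. Qed.

Lemma nbhd_moved f U x : G f -> op U -> U x -> f x <> x ->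
  exists V, op V /\ V x /\ (forall y, V y -> U y) /\ (forall y, V y -> ~ V (f y)).
Proof.
  intros Gf oU Ux n.
  destruct (ra_haus _ _ RA x (f x)) as (A & B & oA & oB & Ax & Bx & D); auto.
  exists (fun y => U y /\ (A y /\ B (f y))). split; [|split; [|split]].
  - apply (ra_inter _ _ RA); auto. apply (ra_inter _ _ RA); auto.
    apply (ra_cont _ _ RA); auto.
  - auto.
  - tauto.
  - intros y Hy Hy'. apply (D (f y)); tauto.
Qed.

Lemma moved_open f : G f -> op (fun x => f x <> x).
Proof.
  intro Gf. apply (ra_local _ _ RA); intros x n.
  destruct (ra_haus _ _ RA x (f x)) as (A & B & oA & oB & Ax & Bx & D); auto.
  exists (fun y => A y /\ B (f y)). split; [|split].
  - apply (ra_inter _ _ RA); auto. apply (ra_cont _ _ RA); auto.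
  - auto.
  - intros y [Ay By] e. rewrite e in By. eauto.
Qed.

Lemma fixed_on_closure f g x : G g ->
  (forall y, f y <> y -> g y = y) -> closure_moved op f x -> g x = x.
Proof.
  intros Gg H Hx. apply NNPP; intro n.
  destruct (Hx _ (moved_open g Gg) n) as (y & Hy & Hy'). auto.
Qed.

Lemma moved_in_closure (f : X -> X) x : f x <> x -> closure_moved op f x.
Proof. intros n U oU Ux; eauto. Qed.

Lemma act_move U x : op U -> U x -> exists f, G f /\ f x <> x /\
  (forall y, closure_moved op f y -> U y) /\ (forall y, f y <> y -> U y) /\
  (forall y, f (f (f y)) = y).
Proof.
  intros oU Ux. destruct (ra_move _ _ RA U x oU Ux) as (f & Gf & fx & fU & f3).
  exists f. repeat split; auto using moved_in_closure.
Qed.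

Lemma fixed_interior_open (f : X -> X) : op (fun x => ~ closure_moved op f x).
Proof.
  apply (ra_local _ _ RA). intros x n. apply NNPP; intro n'. apply n. intros U oU Ux.
  apply NNPP; intro n2. apply n'. exists U. split; [auto|split; [auto|]].
  intros y Uy Hy. destruct (Hy U oU Uy) as (z & Uz & nz). eauto.
Qed.

(** An element of order three dies under the twelfth power, hence the nesting: [s] carries [W] off
    itself under [s] and [s^2], and [t] lives in [W]. Then [(s t)^3] acts on [W] as [t], so
    [(s t)^12] acts there as [t^4 = t]. *)
Lemma pow12_moved U x : op U -> U x ->
  exists g p, G g /\ (forall y, g y <> y -> U y) /\ pow 12 g p <> p.
Proof.
  intros oU Ux.
  destruct (act_move U x oU Ux) as (s & Gs & sx & _ & sU & s3).
  assert (ssx : comp s s x <> x).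
  { unfold comp; intro e. apply sx. rewrite <- e at 1. apply s3. }
  assert (Gss : G (comp s s)) by (apply (ra_comp _ _ RA s s); auto).
  destruct (nbhd_moved s U x) as (V & oV & Vx & VU & Vs); auto.
  destruct (nbhd_moved _ V x Gss) as (W & oW & Wx & WV & Ws); auto.
  destruct (act_move W x oW Wx) as (t & Gt & tx & _ & tW & t3).
  assert (tin : forall y, W y -> W (t y)).
  { intros y Wy. destruct (classic (t (t y) = t y)) as [e|n]; [|apply tW; auto].
    apply (act_inj t) in e; auto. rewrite e; auto. }
  assert (tout : forall y, ~ W y -> t y = y).
  { intros y n. apply NNPP; intro n'; apply n, tW; auto. }
  set (g := comp s t).
  assert (g3 : forall y, W y -> g (g (g y)) = t y).
  { intros y Wy. unfold g, comp.
    rewrite (tout (s (t y))), (tout (s (s (t y)))); [apply s3| |].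
    - intro w. apply (Ws (t y)); auto.
    - intro w. apply (Vs (t y)); auto. }
  exists g, x. split; [|split].
  - apply (ra_comp _ _ RA s t); auto.
  - intros y n. destruct (classic (t y = y)) as [e|n']; [|auto].
    apply sU. intro e'. apply n; unfold g, comp; rewrite e; auto.
  - replace (pow 12 g x) with (t x); auto.
    unfold pow, comp at 1; simpl. unfold comp.
    rewrite !(g3 x), (g3 (t x)), (g3 (t (t x))), t3, g3; auto.
Qed.

(** Some [x] is moved by both [f] and [h]. Take [f1] supported in a neighbourhood [V] of [x] that
    lies in the moved set of [f] and is disjoint from [h V], and [f2] supported in a smaller [W]
    disjoint from [f1 W]. On [V] the commutator [[h,f1]] equals the inverse of [f1]. The maps [f1],
    [f2] and [d] fix everything off [V], while [g] fixes [V], so they commute with [g]. *)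
Lemma disjoint_alg_disjoint f g : G f -> G g ->
  (forall x, f x = x \/ g x = x) -> alg_disjoint G f g.
Proof.
  intros Gf Gg D h Gh nc.
  assert (Hx : exists x, f x <> x /\ h x <> x).
  { apply NNPP; intro n. apply nc.
    destruct (ra_inv _ _ RA f Gf) as (f' & _ & Hf' & _).
    destruct (ra_inv _ _ RA h Gh) as (h' & _ & Hh' & _).
    apply (disjoint_commute f h f' h'); auto.
    intro x. apply NNPP; intro n'. apply n. exists x. tauto. }
  destruct Hx as (x & fx & hx).
  destruct (nbhd_moved h _ x Gh (moved_open f Gf) fx hx) as (V & oV & Vx & Vf & Vh).
  destruct (act_move V x oV Vx) as (f1 & G1 & f1x & _ & f1V & _).
  destruct (nbhd_moved f1 V x) as (W & oW & Wx & WV & W1); auto.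
  destruct (act_move W x oW Wx) as (f2 & G2 & f2x & _ & f2W & _).
  destruct (ra_inv _ _ RA h Gh) as (h' & Gh' & h'h & hh').
  destruct (ra_inv _ _ RA f1 G1) as (f1' & G1' & f1'f1 & f1f1').
  destruct (ra_inv _ _ RA f2 G2) as (f2' & G2' & f2'f2 & f2f2').
  destruct (ra_inv _ _ RA g Gg) as (g' & Gg' & g'g & gg').
  set (c := fun x => h (f1 (h' (f1' x)))).
  set (c' := fun x => f1 (h (f1' (h' x)))).
  set (d := fun x => c (f2 (c' (f2' x)))).
  assert (f1out : forall y, ~ V y -> f1 y = y) by (intros y n; apply NNPP; auto).
  assert (f1out' : forall y, ~ V y -> f1' y = y)
    by (intros y n; rewrite <- (f1out y n) at 1; auto).
  assert (f2out : forall y, ~ W y -> f2 y = y) by (intros y n; apply NNPP; auto).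
  assert (f2out' : forall y, ~ W y -> f2' y = y)
    by (intros y n; rewrite <- (f2out y n) at 1; auto).
  assert (f1in : forall y, V y -> V (f1 y)).
  { intros y Vy. apply NNPP; intro n. pose proof (f1out _ n) as e.
    apply (act_inj f1) in e; auto. rewrite e in n; auto. }
  assert (f1in' : forall y, V y -> V (f1' y)).
  { intros y Vy. apply NNPP; intro n. apply n. rewrite <- (f1f1' y), (f1out _ n) in Vy; auto. }
  assert (h'V : forall y, V y -> ~ V (h' y)).
  { intros y Vy n. apply (Vh (h' y)); auto. rewrite hh'; auto. }
  assert (cV : forall y, V y -> c y = f1' y).
  { intros y Vy. unfold c. rewrite f1out, hh'; auto. }
  assert (c'V : forall y, V y -> c' y = f1 y).
  { intros y Vy. unfold c'. rewrite f1out', hh'; auto. }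
  assert (cc' : forall y, c (c' y) = y).
  { intro y. unfold c, c'. rewrite f1'f1, h'h, f1f1', hh'; auto. }
  assert (c'c : forall y, c' (c y) = y).
  { intro y. unfold c, c'. rewrite h'h, f1'f1, hh', f1f1'; auto. }
  assert (Gc : G c).
  { apply (ra_comp _ _ RA h (fun x => f1 (h' (f1' x)))); auto.
    apply (ra_comp _ _ RA f1 (fun x => (h' (f1' x)))); auto. apply (ra_comp _ _ RA); auto. }
  assert (Gc' : G c').
  { apply (ra_comp _ _ RA f1 (fun x => h (f1' (h' x)))); auto.
    apply (ra_comp _ _ RA h (fun x => (f1' (h' x)))); auto. apply (ra_comp _ _ RA); auto. }
  assert (Gd : G d).
  { apply (ra_comp _ _ RA c (fun x => f2 (c' (f2' x)))); auto.
    apply (ra_comp _ _ RA f2 (fun x => (c' (f2' x)))); auto. apply (ra_comp _ _ RA); auto. }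
  assert (cm : forall k, G k -> (forall y, ~ V y -> k y = y) -> comp k g = comp g k).
  { intros k Gk Hk. destruct (ra_inv _ _ RA k Gk) as (k' & _ & kk & _).
    apply (disjoint_commute k g k' g'); auto.
    intro y. destruct (classic (V y)) as [Vy|n]; auto.
    right. destruct (D y); auto. exfalso; apply (Vf y); auto. }
  exists f1, f2, c, d. repeat split; auto.
  - apply cm; auto.
  - apply functional_extensionality; intro y; unfold comp, c.
    rewrite f1'f1, h'h; auto.
  - apply functional_extensionality; intro y; unfold comp, d.
    rewrite f2'f2, c'c; auto.
  (* [d] sends [f2 x] to [x]: undoing [f2] gives [x], then [c'] acts as [f1], [f2] fixes [f1 x], and
     [c] acts as [f1']. *)
  - intro e. apply f2x. pose proof (f_equal (fun k => k (f2 x)) e) as e'. simpl in e'.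
    rewrite <- e'. unfold d. rewrite f2'f2, (c'V x), f2out, cV; auto.
  - apply cm; auto. intros y n. unfold d.
    assert (nW : ~ W y) by auto.
    rewrite (f2out' y nW). rewrite f2out; auto.
    intro w. apply n. rewrite <- (cc' y). rewrite cV; auto.
Qed.

Lemma commute_pow n (d g : X -> X) : comp d g = comp g d -> comp d (pow n g) = comp (pow n g) d.
Proof.
  intro e. induction n; auto.
  apply functional_extensionality; intro y. simpl. unfold comp. fold (pow n g).
  pose proof (f_equal (fun k => k (pow n g y)) e) as e1; unfold comp in e1; simpl in e1.
  pose proof (f_equal (fun k => k y) IHn) as e2; unfold comp in e2; simpl in e2.
  rewrite e1, e2; auto.
Qed.

(** Suppose [f] and [g^12] both move [x]. Then [g, ..., g^4] move [x], and a small [U] is disjoint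
    from its images under [f] and these powers. An [h] living in [U] and moving [x] does not commute
    with [f]. The resulting [d] commutes with [g], so it moves every iterate of one of its moved
    points; two of these lie in one translate of [U] by a map commuting with [g], and [U] meets some
    [g^m U]. *)
Lemma alg_disjoint_disjoint f g : G f -> G g -> alg_disjoint G f g ->
  forall x, f x = x \/ pow 12 g x = x.
Proof.
  intros Gf Gg AD x. apply NNPP; intro n. apply not_or_and in n. destruct n as [fx gx].
  (* The equation says that [m] divides 12, so a point fixed by [g^m] would be fixed by [g^12]. *)
  assert (gm : forall m, 12 = m * (12 / m) -> pow m g x <> x).
  { intros m em e. apply gx. rewrite em. clear em. induction (12 / m) as [|q IH].
    - rewrite Nat.mul_0_r; reflexivity.
    - rewrite Nat.mul_succ_r, Nat.add_comm.
      assert (pa : forall i j y, pow (i + j) g y = pow i g (pow j g y)).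
      { induction i; auto. intros j y. simpl. unfold comp. f_equal. apply IHi. }
      rewrite pa, IH; auto. }
  pose proof (gm 1 eq_refl) as g1. pose proof (gm 2 eq_refl) as g2.
  pose proof (gm 3 eq_refl) as g3. pose proof (gm 4 eq_refl) as g4.
  destruct (nbhd_moved f _ x Gf (moved_open f Gf) fx fx) as (U0 & oU0 & U0x & _ & D0).
  destruct (nbhd_moved _ _ x (act_pow 1 g Gg) oU0 U0x g1) as (U1 & oU1 & U1x & I1 & D1).
  destruct (nbhd_moved _ _ x (act_pow 2 g Gg) oU1 U1x g2) as (U2 & oU2 & U2x & I2 & D2).
  destruct (nbhd_moved _ _ x (act_pow 3 g Gg) oU2 U2x g3) as (U3 & oU3 & U3x & I3 & D3).
  destruct (nbhd_moved _ _ x (act_pow 4 g Gg) oU3 U3x g4) as (U & oU & Ux & I4 & D4).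
  assert (DU : forall m, 1 <= m <= 4 -> forall y, U y -> ~ U (pow m g y)).
  { intros m Hm y Uy Uy'. assert (m = 1 \/ m = 2 \/ m = 3 \/ m = 4) as [->|[->|[->| ->]]] by lia.
    - apply (D1 y); auto. - apply (D2 y); auto. - apply (D3 y); auto. - apply (D4 y); auto. }
  clear D1 D2 D3 D4.
  destruct (act_move U x oU Ux) as (h & Gh & hx & _ & hU & _).
  assert (hout : forall y, ~ U y -> h y = y) by (intros y n; apply NNPP; auto).
  destruct (AD h Gh) as (f1 & f2 & c & d & G1 & G2 & Gc & Gd & c1 & c2 & ec & ed & nd & cd).
  { intro e. pose proof (f_equal (fun k => k x) e) as e'. unfold comp in e'.
    rewrite (hout (f x)) in e'.
    - apply (act_inj f) in e'; auto.
    - intro u. apply (D0 x); auto 10. }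
  (* [c] is [h] times the conjugate of its inverse by [f1], so it moves points of [U] and [f1 U]
     only. The same reading of [d] gives [md]. *)
  assert (mc : forall y, c y <> y -> U y \/ exists u, U u /\ y = f1 u).
  { intros y n. apply NNPP; intro n'. apply not_or_and in n'. destruct n' as [nU n1].
    apply n.
    destruct (ra_inv _ _ RA f1 G1) as (f1' & _ & _ & f1f1').
    pose proof (f_equal (fun k => k (f1' y)) ec) as e; unfold comp in e.
    assert (~ U (f1' y)) by (intro u; apply n1; exists (f1' y); auto).
    rewrite (hout (f1' y)), f1f1', (hout y) in e; auto. }
  assert (md : forall y, d y <> y ->
    c y <> y \/ exists u, c u <> u /\ y = f2 u).
  { intros y n. apply NNPP; intro n'. apply not_or_and in n'. destruct n' as [nU n1].
    apply n. apply NNPP in nU.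
    destruct (ra_inv _ _ RA f2 G2) as (f1' & _ & _ & f1f1').
    pose proof (f_equal (fun k => k (f1' y)) ed) as e; unfold comp in e.
    assert (e1 : c (f1' y) = f1' y).
    { apply NNPP; intro u; apply n1; exists (f1' y); auto. }
    rewrite e1, f1f1', nU in e; auto. }
  assert (Hp : exists p, d p <> p).
  { apply NNPP; intro n. apply nd. apply functional_extensionality; intro y.
    apply NNPP; intro n'; apply n; eauto. }
  destruct Hp as (p & dp).
  set (T1 := fun q => U q). set (T2 := fun q => exists u, U u /\ q = f1 u).
  set (T3 := fun q => exists u, U u /\ q = f2 u).
  set (T4 := fun q => exists u, U u /\ q = f2 (f1 u)).
  assert (cov : forall i, T1 (pow i g p) \/ T2 (pow i g p) \/ T3 (pow i g p) \/ T4 (pow i g p)).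
  { intro i.
    assert (dd : d (pow i g p) <> pow i g p).
    { pose proof (f_equal (fun k => k p) (commute_pow i d g cd)) as e; unfold comp in e.
      rewrite e. intro e'. apply act_inj in e'; auto using act_pow. }
    destruct (md _ dd) as [n|(u & n & e)].
    - destruct (mc _ n); [left|right; left]; auto.
    - destruct (mc _ n) as [Uu|(u' & Uu & e')].
      + right; right; left. exists u; auto.
      + right; right; right. exists u'. subst; auto. }
  assert (key : forall t m, G t -> comp t g = comp g t -> 1 <= m <= 4 ->
     forall q, (exists u, U u /\ q = t u) -> (exists u, U u /\ pow m g q = t u) -> False).
  { intros t m Gt ct Hm q (u & Uu & eu) (w & Uw & ew). subst q.
    pose proof (f_equal (fun k => k u) (commute_pow m t g ct)) as e; unfold comp in e.
    rewrite <- e in ew. apply act_inj in ew; auto. subst w. exact (DU m Hm u Uu Uw). }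
  assert (c0 : comp (fun x => x) g = comp g (fun x => x)) by reflexivity.
  assert (c12 : comp (fun x => f2 (f1 x)) g = comp g (fun x => f2 (f1 x))).
  { apply functional_extensionality; intro y; unfold comp.
    pose proof (f_equal (fun k => k y) c1) as e1; unfold comp in e1. rewrite e1.
    pose proof (f_equal (fun k => k (f1 y)) c2) as e2; unfold comp in e2. auto. }
  assert (pa : forall i j y, pow (i + j) g y = pow i g (pow j g y)).
  { induction i; auto. intros j y. simpl. unfold comp. f_equal. apply IHi. }
  assert (K : forall i j, i < j <= 4 ->
    ~ (T1 (pow i g p) /\ T1 (pow j g p)) /\ ~ (T2 (pow i g p) /\ T2 (pow j g p)) /\
    ~ (T3 (pow i g p) /\ T3 (pow j g p)) /\ ~ (T4 (pow i g p) /\ T4 (pow j g p))).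
  { intros i j Hij. replace j with ((j - i) + i) by lia. rewrite pa.
    assert (Hm : 1 <= j - i <= 4) by lia.
    split; [|split; [|split]]; intros [A B].
    - apply (key _ (j - i) (ra_id _ _ RA) c0 Hm (pow i g p)); eauto.
    - exact (key _ (j - i) G1 c1 Hm _ A B).
    - exact (key _ (j - i) G2 c2 Hm _ A B).
    - exact (key _ (j - i) (ra_comp _ _ RA _ _ G2 G1) c12 Hm _ A B). }
  apply (pigeonhole (fun i => T1 (pow i g p)) (fun i => T2 (pow i g p))
    (fun i => T3 (pow i g p)) (fun i => T4 (pow i g p)) cov K).
Qed.

(** For the converse, a point of the support of [h] outside that of [f] gives a set [V] fixed by [f]
    and displaced by [h]. An element [g] living in [V] is algebraically disjoint from [f]; its
    twelfth power moves some [p] in [V] but fixes [h p], so it cannot commute with [h]. *)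
Lemma supp_incl_iff f h : G f -> G h ->
  ((forall x, closure_moved op h x -> closure_moved op f x) <->
   (forall g, G g -> alg_disjoint G f g -> comp h (pow 12 g) = comp (pow 12 g) h)).
Proof.
  intros Gf Gh. split.
  - intros H g Gg AD. pose proof (alg_disjoint_disjoint f g Gf Gg AD) as D.
    pose proof (act_pow 12 g Gg) as Gp. set (g12 := pow 12 g) in *. clearbody g12.
    destruct (ra_inv _ _ RA _ Gh) as (h' & _ & hh & _).
    destruct (ra_inv _ _ RA _ Gp) as (g' & _ & gg & _).
    apply (disjoint_commute h g12 h' g'); auto.
    intro x. destruct (classic (h x = x)) as [e|n]; auto. right.
    apply (fixed_on_closure f); auto.
    + intros y n'. destruct (D y); tauto.
    + apply H. intros U oU Ux. eauto.
  - intros H y Hy. apply NNPP; intro n.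
    assert (Hn : exists U, op U /\ U y /\ forall z, U z -> f z = z).
    { apply NNPP; intro n'. apply n. intros U oU Uy. apply NNPP; intro n2.
      apply n'. exists U; split; [auto|split; [auto|]]. intros z Uz. apply NNPP; intro nz. apply n2; eauto. }
    destruct Hn as (U & oU & Uy & HU).
    destruct (Hy U oU Uy) as (x & Ux & hx).
    destruct (nbhd_moved h U x) as (V & oV & Vx & VU & Vh); auto.
    destruct (pow12_moved V x oV Vx) as (g & p & Gg & gV & gp).
    assert (AD : alg_disjoint G f g).
    { apply disjoint_alg_disjoint; auto. intro z. destruct (classic (g z = z)); auto. }
    pose proof (f_equal (fun k => k p) (H g Gg AD)) as e; unfold comp in e.
    assert (Vp : V p). { apply gV; intro e'. apply gp, pow_fixed; auto. }
    rewrite (pow_fixed 12 g (h p)) in e.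
    + apply act_inj in e; auto.
    + apply NNPP; intro n'. apply (Vh p); auto.
Qed.

Lemma closure_moved_conj f g g' x : G f -> G g -> G g' ->
  (forall x, g' (g x) = x) -> (forall x, g (g' x) = x) ->
  closure_moved op (fun y => g' (f (g y))) x <-> closure_moved op f (g x).
Proof.
  intros Gf Gg Gg' g'g gg'. split; intros H U oU Ux.
  - destruct (H (fun y => U (g y))) as (y & Uy & n); auto.
    + apply (ra_cont _ _ RA); auto.
    + exists (g y); split; auto. intro e. apply n. rewrite e; auto.
  - destruct (H (fun y => U (g' y))) as (y & Uy & n); auto.
    + apply (ra_cont _ _ RA); auto.
    + rewrite g'g; auto.
    + exists (g' y); split; auto. rewrite gg'. intro e. apply n. rewrite <- (gg' (f y)), e; auto.
Qed.

End Action.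

(** * Group isomorphisms as relations, and the transport of supports and points *)

Record group_corr {X Y : Type} (G : (X -> X) -> Prop) (H : (Y -> Y) -> Prop)
  (R : (X -> X) -> (Y -> Y) -> Prop) : Prop := {
  gc_l : forall f g, R f g -> G f;
  gc_r : forall f g, R f g -> H g;
  gc_tot : forall f, G f -> exists g, R f g;
  gc_sur : forall g, H g -> exists f, R f g;
  gc_fun : forall f g g', R f g -> R f g' -> g = g';
  gc_inj : forall f f' g, R f g -> R f' g -> f = f';
  gc_comp : forall f g f' g', R f g -> R f' g' -> R (comp f f') (comp g g') }.

(** This symmetry is the reason for using relations: every transport statement below is also applied
    with the two sides exchanged. *)
Lemma group_corr_sym {X Y : Type} (G : (X -> X) -> Prop) (H : (Y -> Y) -> Prop) R :
  group_corr G H R -> group_corr H G (fun g f => R f g).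
Proof.
  intros []. constructor; eauto.
Qed.

Section Corr.
Context {X Y : Type} {op : (X -> Prop) -> Prop} {op' : (Y -> Prop) -> Prop}
  {G : (X -> X) -> Prop} {H : (Y -> Y) -> Prop} {R : (X -> X) -> (Y -> Y) -> Prop}.
Hypothesis RX : rubin_action op G.
Hypothesis RY : rubin_action op' H.
Hypothesis GC : group_corr G H R.

(** The partner of the identity is idempotent for composition, and an injective idempotent map is
    the identity. *)
Lemma corr_id : R (fun x => x) (fun y => y).
Proof.
  destruct (gc_tot _ _ _ GC _ (ra_id _ _ RX)) as (e & He).
  pose proof (gc_comp _ _ _ GC _ _ _ _ He He) as He2.
  change (comp (fun x : X => x) (fun x : X => x)) with (fun x : X => x) in He2.
  pose proof (gc_fun _ _ _ GC _ _ _ He He2) as e2.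
  replace (fun y : Y => y) with e; auto.
  apply functional_extensionality; intro y.
  apply (act_inj RY e); [eapply gc_r; eauto|].
  symmetry. exact (f_equal (fun k => k y) e2).
Qed.

Lemma corr_comp_eq f1 g1 f2 g2 f3 g3 f4 g4 :
  R f1 g1 -> R f2 g2 -> R f3 g3 -> R f4 g4 ->
  comp f1 f2 = comp f3 f4 -> comp g1 g2 = comp g3 g4.
Proof.
  intros. eapply gc_fun; [exact GC| |]; [|eapply gc_comp; eauto].
  rewrite <- H4. eapply gc_comp; eauto.
Qed.

Lemma corr_pow n f g : R f g -> R (pow n f) (pow n g).
Proof.
  intro r; induction n; [apply corr_id|]. apply (gc_comp _ _ _ GC); auto.
Qed.

End Corr.

Section Corr2.
Context {X Y : Type} {op : (X -> Prop) -> Prop} {op' : (Y -> Prop) -> Prop}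
  {G : (X -> X) -> Prop} {H : (Y -> Y) -> Prop} {R : (X -> X) -> (Y -> Y) -> Prop}.
Hypothesis RX : rubin_action op G.
Hypothesis RY : rubin_action op' H.
Hypothesis GC : group_corr G H R.

Lemma corr_alg_disjoint f g f' g' : R f f' -> R g g' ->
  alg_disjoint G f g -> alg_disjoint H f' g'.
Proof.
  pose proof (group_corr_sym _ _ _ GC) as GC'.
  intros rf rg AD h' Hh nc.
  destruct (gc_sur _ _ _ GC h' Hh) as (h & rh).
  destruct (AD h) as (f1 & f2 & c & d & G1 & G2 & Gc & Gd & c1 & c2 & ec & ed & nd & cd).
  - eapply gc_l; eauto.
  - intro e. apply nc. eapply (corr_comp_eq GC); eauto.
  - destruct (gc_tot _ _ _ GC _ G1) as (f1' & r1).
    destruct (gc_tot _ _ _ GC _ G2) as (f2' & r2).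
    destruct (gc_tot _ _ _ GC _ Gc) as (c' & rc).
    destruct (gc_tot _ _ _ GC _ Gd) as (d' & rd).
    exists f1', f2', c', d'.
    repeat split; try (eapply gc_r; eauto; fail).
    + eapply (corr_comp_eq GC); eauto.
    + eapply (corr_comp_eq GC); eauto.
    + eapply (corr_comp_eq GC); [| | | |exact ec]; eauto. eapply gc_comp; eauto.
    + eapply (corr_comp_eq GC); [| | | |exact ed]; eauto. eapply gc_comp; eauto.
    + intro e. apply nd. subst d'. eapply (gc_inj _ _ _ GC); eauto. apply (corr_id RX RY GC).
    + eapply (corr_comp_eq GC); eauto.
Qed.
End Corr2.

Section Corr3.
Context {X Y : Type} {op : (X -> Prop) -> Prop} {op' : (Y -> Prop) -> Prop}
  {G : (X -> X) -> Prop} {H : (Y -> Y) -> Prop} {R : (X -> X) -> (Y -> Y) -> Prop}.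
Hypothesis RX : rubin_action op G.
Hypothesis RY : rubin_action op' H.
Hypothesis GC : group_corr G H R.

Lemma corr_supp_incl f h f' h' : R f f' -> R h h' ->
  (forall x, closure_moved op h x -> closure_moved op f x) ->
  (forall y, closure_moved op' h' y -> closure_moved op' f' y).
Proof.
  intros rf rh I.
  apply (supp_incl_iff RY); [eapply gc_r; eauto|eapply gc_r; eauto|].
  intros g' Hg' AD.
  destruct (gc_sur _ _ _ GC g' Hg') as (g & rg).
  pose proof (corr_alg_disjoint RY RX (group_corr_sym _ _ _ GC) _ _ _ _ rf rg AD) as AD'.
  assert (e : comp h (pow 12 g) = comp (pow 12 g) h).
  { apply (supp_incl_iff RX f h); eauto; eapply gc_l; eauto. }
  eapply (corr_comp_eq GC); [| | | |exact e]; eauto; apply (corr_pow RX RY GC); auto.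
Qed.

End Corr3.

Section Corr4.
Context {X Y : Type} {op : (X -> Prop) -> Prop} {op' : (Y -> Prop) -> Prop}
  {G : (X -> X) -> Prop} {H : (Y -> Y) -> Prop} {R : (X -> X) -> (Y -> Y) -> Prop}.
Hypothesis RX : rubin_action op G.
Hypothesis RY : rubin_action op' H.
Hypothesis GC : group_corr G H R.

(** Supports are open, so a common point would admit a nontrivial [k'] supported in both. Its
    partner [k] is then supported in two disjoint sets, hence is the identity. *)
Lemma corr_supp_disjoint f g f' g' : R f f' -> R g g' ->
  (forall x, closure_moved op f x -> closure_moved op g x -> False) ->
  (forall y, closure_moved op' f' y -> closure_moved op' g' y -> False).
Proof.
  intros rf rg D y yf yg.
  assert (Hf' : H f') by (eapply gc_r; eauto).
  assert (Hg' : H g') by (eapply gc_r; eauto).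
  destruct (act_move RY (fun y => closure_moved op' f' y /\ closure_moved op' g' y) y)
    as (k' & Hk' & ky & _ & kU & _); auto.
  { apply (ra_inter _ _ RY); apply (ra_supp_open _ _ RY); auto. }
  destruct (gc_sur _ _ _ GC k' Hk') as (k & rk).
  assert (I : forall h h', R h h' -> (forall z, k' z <> z -> closure_moved op' h' z) ->
    forall x, closure_moved op k x -> closure_moved op h x).
  { intros h h' rh Hh. apply (corr_supp_incl RY RX (group_corr_sym _ _ _ GC) _ _ _ _ rh rk).
    intros z Hz U oU Uz. destruct (Hz U oU Uz) as (z1 & U1 & n1). apply (Hh z1 n1 U); auto. }
  assert (I1 := I f f' rf ltac:(firstorder)). assert (I2 := I g g' rg ltac:(firstorder)).
  assert (k' = (fun y => y)).
  { assert (k = (fun x => x)).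
    { apply functional_extensionality; intro z. apply NNPP; intro n.
      assert (closure_moved op k z) by (intros U oU Uz; eauto). eapply D; eauto. }
    subst k. eapply (gc_fun _ _ _ GC); eauto. apply (corr_id RX RY GC). }
  subst k'. auto.
Qed.


(** [O] is the intersection of the finitely many supports around [x]. The sets in [Us] are
    complements because they come from an open cover in the compactness argument of
    [point_corr_total]. *)
Lemma corr_nested_supports x (Us : list (Y -> Prop)) :
  (forall U, In U Us -> exists f g, R f g /\ closure_moved op f x /\
     U = (fun y => ~ closure_moved op' g y)) ->
  exists O, op O /\ O x /\
    forall k k', R k k' -> (forall z, closure_moved op k z -> O z) ->
      forall y, closure_moved op' k' y -> forall U, In U Us -> ~ U y.
Proof.
  induction Us as [|U Us IH]; intro HU.
  - exists (fun _ => True). split; [apply (ra_full _ _ RX)|]. split; auto.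
  - destruct IH as (O & oO & Ox & HO); [intros; apply HU; simpl; auto|].
    destruct (HU U (or_introl eq_refl)) as (f & g & r & fx & eU).
    exists (fun z => O z /\ closure_moved op f z). split; [|split].
    + apply (ra_inter _ _ RX); auto. apply (ra_supp_open _ _ RX). eapply gc_l; eauto.
    + auto.
    + intros k k' rk Hk y Hy U' [e|i].
      * subst U' U. intro n; apply n.
        apply (corr_supp_incl RX RY GC f k g k'); auto. intros z Hz; apply Hk; auto.
      * apply (HO k k' rk); auto. intros z Hz; apply Hk; auto.
Qed.

Definition point_corr (x : X) (y : Y) : Prop :=
  forall f g, R f g -> (closure_moved op f x <-> closure_moved op' g y).

(** If no [y] lay in all the supports corresponding to supports around [x], their complements would
    cover the compact support of [g0], and finitely many would do. A nontrivial [k] supported close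
    enough to [x] has a partner moving a point in the support of [g0] that none of these complements
    contains. *)
Lemma point_corr_total x : exists y, point_corr x y.
Proof.
  destruct (act_move RX (fun _ => True) x (ra_full _ _ RX) I) as (f0 & G0 & f0x & _).
  assert (s0 : closure_moved op f0 x) by (intros U oU Ux; eauto).
  destruct (gc_tot _ _ _ GC f0 G0) as (g0 & r0).
  assert (Hy : exists y, forall f g, R f g -> closure_moved op f x -> closure_moved op' g y).
  { apply NNPP; intro n.
    destruct (ra_supp_compact _ _ RY g0 (gc_r _ _ _ GC _ _ r0)
      (fun U => exists f g, R f g /\ closure_moved op f x /\
        U = (fun y => ~ closure_moved op' g y))) as (Us & HUs & cov).
    - intros U (f & g & _ & _ & ->). apply (fixed_interior_open RY).
    - intros y _. apply NNPP; intro n'. apply n. exists y. intros f g r fx.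
      apply NNPP; intro n2. apply n'. exists (fun y => ~ closure_moved op' g y).
      split; auto. exists f, g; auto.
    - destruct (corr_nested_supports x Us HUs) as (O & oO & Ox & HO).
      destruct (act_move RX (fun z => O z /\ closure_moved op f0 z) x)
        as (k & Gk & kx & kO & _); auto.
      { apply (ra_inter _ _ RX); auto. apply (ra_supp_open _ _ RX); auto. }
      destruct (gc_tot _ _ _ GC k Gk) as (k' & rk).
      assert (Hk : exists y, k' y <> y).
      { apply NNPP; intro n'. apply kx.
        assert (e : k' = (fun y => y)).
        { apply functional_extensionality; intro y; apply NNPP; intro; apply n'; eauto. }
        subst k'. rewrite (gc_inj _ _ _ GC _ _ _ rk (corr_id RX RY GC)); auto. }
      destruct Hk as (y & ky).
      assert (sy : closure_moved op' k' y) by (intros U oU Uy; eauto).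
      destruct (cov y) as (U & iU & Uy).
      + apply (corr_supp_incl RX RY GC f0 k g0 k'); auto. intros z Hz; apply kO; auto.
      + apply (HO k k' rk) with (y := y) (U := U); auto. intros z Hz; apply kO; auto. }
  destruct Hy as (y & Hy). exists y. intros f g r. split; [eauto|].
  (* If [x] were outside the support of [f], some [h] moving [x] would have support disjoint from
     that of [f], yet [y] would lie in the supports of both partners. *)
  intro gy. apply NNPP; intro n.
  destruct (act_move RX (fun z => ~ closure_moved op f z) x)
    as (h & Gh & hx & hU & _); auto.
  { apply (fixed_interior_open RX). }
  destruct (gc_tot _ _ _ GC h Gh) as (h' & rh).
  assert (closure_moved op h x) by (intros U oU Ux; eauto).
  apply (corr_supp_disjoint f h g h') with (y := y); auto.
  - intros z fz hz. apply (hU z); auto.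
  - eapply Hy; eauto.
Qed.

Lemma point_corr_unique x y y' : point_corr x y -> point_corr x y' -> y = y'.
Proof.
  intros P P'. apply NNPP; intro n.
  destruct (ra_haus _ _ RY y y' n) as (V & V' & oV & oV' & Vy & Vy' & D).
  destruct (act_move RY V y oV Vy) as (g & Hg & gy & gV & _).
  destruct (gc_sur _ _ _ GC g Hg) as (f & r).
  assert (sy : closure_moved op' g y) by (intros U oU Uy; eauto).
  assert (sy' : closure_moved op' g y') by (apply (P' f g r), (P f g r); auto).
  eauto.
Qed.

Lemma corr_inv f g f' g' : R f g -> R f' g' -> (forall x, f' (f x) = x) ->
  forall y, g' (g y) = y.
Proof.
  intros r r' H0 y.
  pose proof (gc_comp _ _ _ GC _ _ _ _ r' r) as rc.
  replace (comp f' f) with (fun x : X => x) in rc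
    by (apply functional_extensionality; intro; unfold comp; auto).
  pose proof (gc_fun _ _ _ GC _ _ _ rc (corr_id RX RY GC)) as e.
  exact (f_equal (fun k => k y) e).
Qed.

Lemma point_corr_equivariant c c' x y : R c c' -> point_corr x y -> point_corr (c x) (c' y).
Proof.
  intros r P f g rf.
  assert (Gc : G c) by (eapply gc_l; eauto). assert (Hc : H c') by (eapply gc_r; eauto).
  destruct (ra_inv _ _ RX c Gc) as (d & Gd & dc & cd).
  destruct (gc_tot _ _ _ GC d Gd) as (d' & rd).
  assert (d'c' := corr_inv _ _ _ _ r rd dc).
  assert (c'd' := corr_inv _ _ _ _ rd r cd).
  assert (rfc : R (fun z => d (f (c z))) (fun z => d' (g (c' z)))).
  { apply (gc_comp _ _ _ GC d d' (fun z => f (c z)) (fun z => g (c' z))); auto.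
    apply (gc_comp _ _ _ GC f g c c'); auto. }
  assert (Gf : G f) by (eapply gc_l; eauto). assert (Hg : H g) by (eapply gc_r; eauto).
  assert (Hd : H d') by (eapply gc_r; eauto).
  rewrite <- (closure_moved_conj RX f c d x), <- (closure_moved_conj RY g c' d' y); auto.
Qed.

End Corr4.

(** Uniqueness of corresponding points makes the two choices mutually inverse. Continuity holds
    because the preimage of a support is the corresponding support and the supports form a basis. *)
Theorem spatial_realization {X Y : Type} {op : (X -> Prop) -> Prop} {op' : (Y -> Prop) -> Prop}
  {G : (X -> X) -> Prop} {H : (Y -> Y) -> Prop} {R : (X -> X) -> (Y -> Y) -> Prop} :
  rubin_action op G -> rubin_action op' H -> group_corr G H R ->
  exists (phi : X -> Y) (psi : Y -> X),
    (forall x, psi (phi x) = x) /\ (forall y, phi (psi y) = y) /\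
    (forall V, op' V -> op (fun x => V (phi x))) /\
    (forall U, op U -> op' (fun y => U (psi y))) /\
    (forall f g, R f g -> forall x, phi (f x) = g (phi x)).
Proof.
  intros RX RY GC. pose proof (group_corr_sym _ _ _ GC) as GC'.
  assert (sw : forall x y, point_corr (op := op) (op' := op') (R := R) x y <->
    point_corr (op := op') (op' := op) (R := fun g f => R f g) y x).
  { intros x y; split; intros P f g r; symmetry; apply P; auto. }
  destruct (choice _ (point_corr_total RX RY GC)) as (phi & Hphi).
  destruct (choice _ (point_corr_total RY RX GC')) as (psi & Hpsi).
  assert (psiphi : forall x, psi (phi x) = x).
  { intro x. eapply (point_corr_unique RX GC'); [apply Hpsi|apply sw; auto]. }
  assert (phipsi : forall y, phi (psi y) = y).
  { intro y. eapply (point_corr_unique RY GC); [apply Hphi|apply sw; auto]. }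
  exists phi, psi. split; [auto|split; [auto|split; [|split]]].
  - intros V oV. apply (ra_local _ _ RX). intros x Vx.
    destruct (act_move RY V (phi x) oV Vx) as (g & Hg & gx & gV & _).
    destruct (gc_sur _ _ _ GC g Hg) as (f & r).
    exists (closure_moved op f). split; [|split].
    + apply (ra_supp_open _ _ RX). eapply gc_l; eauto.
    + apply (Hphi x f g r). intros U oU Ux; eauto.
    + intros z fz. apply gV. apply (Hphi z f g r); auto.
  - intros V oV. apply (ra_local _ _ RY). intros x Vx.
    destruct (act_move RX V (psi x) oV Vx) as (g & Hg & gx & gV & _).
    destruct (gc_tot _ _ _ GC g Hg) as (f & r).
    exists (closure_moved op' f). split; [|split].
    + apply (ra_supp_open _ _ RY). eapply gc_r; eauto.
    + apply (Hpsi x f g r). intros U oU Ux; eauto.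
    + intros z fz. apply gV. apply (Hpsi z f g r); auto.
  - intros f g r x. eapply (point_corr_unique RY GC); [apply Hphi|].
    eapply (point_corr_equivariant RX RY GC); eauto.
Qed.

Arguments src {g} _.
Arguments rng {g} _.
Arguments BFin {E} _ _.
Arguments BInf {E} _.
Arguments chain {E} _ _.
Arguments pend {E} _ _.
Arguments path_from_to {E} _ _ _.
Arguments geq {E} _ _.
Arguments singular {E} _.
Arguments return_path {E} _ _.
Arguments is_infpath {E} _.
Arguments is_bpath {E} _.
Arguments wandering {E} _.
Arguments len_ge {E} _ _.
Arguments shift {E} _ _.
Arguments bd_basic {E}.
Arguments cyl {E} _ _ _.
Arguments bd_basic {E} _.
Arguments bd_open {E}.
Arguments in_groupoid {E} _.
Arguments g_r {E} _.
Arguments g_k {E} _.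
Arguments g_s {E} _.

(** * Finite paths and their concatenation with boundary paths *)

Section Paths.
Context {E : graph}.

Lemma pft_nil (v w : vert E) : path_from_to v w [] <-> v = w.
Proof. unfold path_from_to; simpl; tauto. Qed.

Lemma pft_cons (v w : vert E) e l :
  path_from_to v w (e :: l) <-> src e = v /\ path_from_to (rng e) w l.
Proof. unfold path_from_to; simpl; tauto. Qed.

Lemma pft_app (v w : vert E) l l' :
  path_from_to v w (l ++ l') <-> exists u, path_from_to v u l /\ path_from_to u w l'.
Proof.
  revert v; induction l as [|e l IH]; intro v; simpl.
  - split.
    + intro H; exists v; rewrite pft_nil; auto.
    + intros (u & H & H'). rewrite pft_nil in H; subst; auto.
  - rewrite pft_cons, IH. split.
    + intros (H & u & H1 & H2). exists u. rewrite pft_cons; auto.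
    + intros (u & H1 & H2). rewrite pft_cons in H1. destruct H1; split; eauto.
Qed.

Lemma pft_trans (v u w : vert E) l l' :
  path_from_to v u l -> path_from_to u w l' -> path_from_to v w (l ++ l').
Proof. intros. apply pft_app; eauto. Qed.

Lemma pft_end (v w w' : vert E) l : path_from_to v w l -> path_from_to v w' l -> w = w'.
Proof. unfold path_from_to; intros [_ <-] [_ <-]; auto. Qed.

Lemma pft_suffix (v u w : vert E) l l' :
  path_from_to v u l -> path_from_to v w (l ++ l') -> path_from_to u w l'.
Proof.
  intros H H'. apply pft_app in H'. destruct H' as (u' & H1 & H2).
  rewrite (pft_end _ _ _ _ H H1); auto.
Qed.

Lemma pft_self (v : vert E) l : chain v l -> path_from_to v (pend v l) l.
Proof. split; auto. Qed.

(** * Boundary paths *)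

Definition bp_start (p : bpath E) : vert E :=
  match p with BFin v _ => v | BInf x => src (x 0) end.

Definition source (z : BP E) : vert E := bp_start (proj1_sig z).

Definition first_edge (z : BP E) : option (edge E) :=
  match proj1_sig z with
  | BFin _ [] => None
  | BFin _ (e :: _) => Some e
  | BInf x => Some (x 0)
  end.

Definition raw_cons (e : edge E) (p : bpath E) : bpath E :=
  match p with
  | BFin _ l => BFin (src e) (e :: l)
  | BInf x => BInf (fun i => match i with 0 => e | S j => x j end)
  end.

Lemma raw_cons_bpath e p : rng e = bp_start p -> is_bpath p -> is_bpath (raw_cons e p).
Proof.
  destruct p as [v l|x]; simpl; intros H Hp.
  - subst; tauto.
  - intros [|i]; auto.
Qed.

(* Junk value [z] when [e] and [z] are not composable. *)
Definition cns (e : edge E) (z : BP E) : BP E :=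
  match excluded_middle_informative (rng e = source z) with
  | left H => exist _ _ (raw_cons_bpath e _ H (proj2_sig z))
  | right _ => z
  end.

Fixpoint cat (l : list (edge E)) (z : BP E) : BP E :=
  match l with [] => z | e :: l' => cns e (cat l' z) end.

Lemma BP_ext (z z' : BP E) : proj1_sig z = proj1_sig z' -> z = z'.
Proof. destruct z, z'; simpl; intro; subst; f_equal; apply proof_irrelevance. Qed.

Lemma cns_raw e z : rng e = source z -> proj1_sig (cns e z) = raw_cons e (proj1_sig z).
Proof.
  intro H. unfold cns. destruct (excluded_middle_informative _); [reflexivity|tauto].
Qed.

Lemma cns_source e z : rng e = source z -> source (cns e z) = src e.
Proof. intro H. unfold source. rewrite cns_raw; auto. destruct (proj1_sig z); auto. Qed.

Lemma cns_first_edge e z : rng e = source z -> first_edge (cns e z) = Some e.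
Proof. intro H. unfold first_edge. rewrite cns_raw; auto. destruct (proj1_sig z); auto. Qed.

Lemma cns_inj e z e' z' : rng e = source z -> rng e' = source z' -> cns e z = cns e' z' ->
  e = e' /\ z = z'.
Proof.
  intros H H' e0. pose proof (f_equal (@proj1_sig _ _) e0) as e1.
  rewrite !cns_raw in e1; auto.
  destruct z as [[v l|x] Hz], z' as [[v' l'|x'] Hz']; simpl in *; try discriminate.
  - injection e1; intros; subst. split; auto. apply BP_ext; simpl.
    unfold source in *; simpl in *. congruence.
  - injection e1; intros e2. split.
    + exact (f_equal (fun f => f 0) e2).
    + apply BP_ext; simpl. f_equal. apply functional_extensionality; intro i.
      exact (f_equal (fun f => f (S i)) e2).
Qed.

(** With [first_edge_none] this is a case analysis that treats finite and infinite boundary paths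
    alike: either an edge can be peeled off, or the path is empty at a singular vertex. *)
Lemma first_edge_some e z : first_edge z = Some e -> exists z', rng e = source z' /\ z = cns e z'.
Proof.
  destruct z as [[v l|x] Hz]; unfold first_edge; simpl.
  - destruct l as [|e' l]; [discriminate|]. intro H; injection H; intros ->.
    simpl in Hz. destruct Hz as [[<- Hc] Hs].
    exists (exist _ (BFin (rng e) l) (conj Hc Hs)). split; [reflexivity|].
    apply BP_ext. rewrite cns_raw; reflexivity.
  - intro H; injection H; intros <-.
    assert (Hx : is_infpath (fun i => x (S i))) by (intro i; apply (Hz (S i))).
    exists (exist _ (BInf (fun i => x (S i))) Hx).
    assert (rng (x 0) = source (exist is_bpath (BInf (fun i => x (S i))) Hx)) by (apply (Hz 0)).
    split; auto. apply BP_ext. rewrite cns_raw; auto. simpl. f_equal.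
    apply functional_extensionality; intros [|i]; auto.
Qed.

Lemma first_edge_src e z : first_edge z = Some e -> src e = source z.
Proof. intro H. destruct (first_edge_some _ _ H) as (z' & H' & ->). rewrite cns_source; auto. Qed.

Lemma first_edge_none z : first_edge z = None -> proj1_sig z = BFin (source z) [] /\ singular (source z).
Proof.
  destruct z as [[v [|e l]|x] Hz]; unfold first_edge; simpl; try discriminate.
  simpl in Hz. destruct Hz; auto.
Qed.

Lemma cat_app l l' z : cat (l ++ l') z = cat l (cat l' z).
Proof. induction l; simpl; congruence. Qed.

Lemma cat_source v l z : path_from_to v (source z) l -> source (cat l z) = v.
Proof.
  revert v; induction l as [|e l IH]; intro v; simpl.
  - rewrite pft_nil; auto.
  - rewrite pft_cons. intros [<- H]. apply cns_source. symmetry; auto.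
Qed.

Lemma cat_first_edge v e l z : path_from_to v (source z) (e :: l) -> first_edge (cat (e :: l) z) = Some e.
Proof.
  rewrite pft_cons; intros [_ H]. simpl. apply cns_first_edge. symmetry; apply cat_source; auto.
Qed.

(** Two decompositions of one boundary path differ by a word. Every later alignment of basic sets,
    charts or groupoid elements rests on this. *)
Lemma cat_prefix v v' l l' z z' : path_from_to v (source z) l -> path_from_to v' (source z') l' ->
  length l <= length l' -> cat l z = cat l' z' ->
  exists t, l' = l ++ t /\ path_from_to (source z) (source z') t /\ z = cat t z'.
Proof.
  revert v v' l'; induction l as [|e l IH]; intros v v' l' H H' L eq.
  - exists l'. simpl in *. subst z. split; auto. split; auto.
    rewrite (cat_source _ _ _ H'); auto.
  - destruct l' as [|e' l']; [simpl in L; lia|].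
    rewrite pft_cons in H, H'. destruct H as [_ H], H' as [_ H']. simpl in eq.
    apply cns_inj in eq; try (symmetry; apply cat_source; auto).
    destruct eq as [<- eq].
    destruct (IH _ _ l' H H') as (t & -> & Ht & e0); auto; [simpl in L; lia|].
    exists t; auto.
Qed.

Lemma cat_inj v v' l l' z z' : path_from_to v (source z) l -> path_from_to v' (source z') l' ->
  length l = length l' -> cat l z = cat l' z' -> l = l' /\ z = z'.
Proof.
  intros H H' L eq. destruct (cat_prefix _ _ _ _ _ _ H H' ltac:(lia) eq) as (t & e & _ & e').
  assert (t = []) by (destruct t; auto; subst l'; rewrite length_app in L; simpl in L; lia).
  subst t. rewrite app_nil_r in e. auto.
Qed.

Lemma shift_cns n e (z : BP E) : rng e = source z ->
  shift (S n) (proj1_sig (cns e z)) = shift n (proj1_sig z).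
Proof.
  intro H. rewrite cns_raw; auto. unfold source in H. destruct (proj1_sig z) as [v l|x]; simpl in *.
  - rewrite H; auto.
  - f_equal. apply functional_extensionality; intro i. rewrite <- plus_n_Sm; auto.
Qed.

Lemma shift_0 (z : BP E) : shift 0 (proj1_sig z) = proj1_sig z.
Proof.
  destruct (proj1_sig z) as [v l|x]; simpl; auto. f_equal.
  apply functional_extensionality; intro i. rewrite Nat.add_0_r; auto.
Qed.

Lemma len_cns n e (z : BP E) : rng e = source z ->
  len_ge (proj1_sig (cns e z)) (S n) <-> len_ge (proj1_sig z) n.
Proof.
  intro H. rewrite cns_raw; auto. destruct (proj1_sig z) as [v l|x]; simpl; [|tauto]. lia.
Qed.

Lemma len_0 z : len_ge (proj1_sig (z : BP E)) 0.
Proof. destruct (proj1_sig z); simpl; auto. lia. Qed.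

Lemma shift_cat v l z n : path_from_to v (source z) l ->
  shift (length l + n) (proj1_sig (cat l z)) = shift n (proj1_sig z).
Proof.
  revert v; induction l as [|e l IH]; intro v; auto.
  rewrite pft_cons. intros [_ H]. simpl. rewrite shift_cns; eauto.
  symmetry; apply cat_source; auto.
Qed.

Lemma len_cat v l z n : path_from_to v (source z) l ->
  len_ge (proj1_sig (cat l z)) (length l + n) <-> len_ge (proj1_sig z) n.
Proof.
  revert v; induction l as [|e l IH]; intro v; [simpl; tauto|].
  rewrite pft_cons. intros [_ H]. simpl. rewrite len_cns; eauto.
  symmetry; apply cat_source; auto.
Qed.

Lemma shift_cat_full v l z : path_from_to v (source z) l ->
  shift (length l) (proj1_sig (cat l z)) = proj1_sig z.
Proof. intro H. rewrite <- (Nat.add_0_r (length l)), (shift_cat _ _ _ _ H). apply shift_0. Qed.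

Lemma len_cat_full v l z : path_from_to v (source z) l -> len_ge (proj1_sig (cat l z)) (length l).
Proof. intro H. rewrite <- (Nat.add_0_r (length l)), (len_cat _ _ _ _ H). apply len_0. Qed.

Lemma len_split n (z : BP E) : len_ge (proj1_sig z) n ->
  exists l z', length l = n /\ path_from_to (source z) (source z') l /\ z = cat l z'.
Proof.
  revert z; induction n as [|n IH]; intros z H.
  - exists [], z. rewrite pft_nil; auto.
  - destruct (first_edge z) as [e|] eqn:He.
    + destruct (first_edge_some _ _ He) as (z1 & H1 & ->). rewrite len_cns in H; auto.
      destruct (IH _ H) as (l & z' & <- & Hl & ->).
      exists (e :: l), z'. rewrite pft_cons, cns_source, H1; auto.
    + apply first_edge_none in He. destruct He as [He _]. rewrite He in H. simpl in H. lia.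
Qed.

Lemma cyl_nil v (z : BP E) : cyl v [] (proj1_sig z) <-> source z = v.
Proof.
  unfold source. destruct (proj1_sig z) as [w l|x]; simpl; split.
  - tauto.
  - intros; subst; split; eauto.
  - tauto.
  - intros; split; auto. intros [|i] e; discriminate.
Qed.

Lemma cyl_cons v e l z :
  cyl v (e :: l) (proj1_sig z) <->
  src e = v /\ exists z', rng e = source z' /\ z = cns e z' /\ cyl (rng e) l (proj1_sig z').
Proof.
  split.
  - intro H.
    assert (He : first_edge z = Some e).
    { unfold first_edge. destruct (proj1_sig z) as [w l'|x]; simpl in H.
      - destruct H as (_ & l'' & ->); auto.
      - destruct H as [_ H]. f_equal. apply (H 0); auto. }
    assert (Hv : src e = v).
    { rewrite (first_edge_src _ _ He). unfold source. destruct (proj1_sig z); simpl in *; tauto. }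
    split; auto. destruct (first_edge_some _ _ He) as (z' & Hz & ->). exists z'. split; auto. split; auto.
    rewrite cns_raw in H; auto. unfold source in Hz. destruct (proj1_sig z') as [w l'|x]; simpl in *.
    + split; auto. destruct H as (_ & l'' & H). injection H; intros; subst. eauto.
    + split; auto. destruct H as [_ H]. intros i e'. apply (H (S i)).
  - intros (<- & z' & Hz & -> & H). rewrite cns_raw; auto.
    destruct (proj1_sig z') as [w l'|x]; simpl in *.
    + split; auto. destruct H as (_ & l'' & ->). eauto.
    + split; auto. destruct H as [_ H]. intros [|i] e'; simpl; [|apply H].
      intro H0; injection H0; auto.
Qed.

Lemma cyl_cat v l z :
  cyl v l (proj1_sig z) <-> exists z', path_from_to v (source z') l /\ z = cat l z'.
Proof.
  revert v z; induction l as [|e l IH]; intros v z.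
  - rewrite cyl_nil. split.
    + intro H; exists z; rewrite pft_nil; auto.
    + intros (z' & H & ->). rewrite pft_nil in H; auto.
  - rewrite cyl_cons. split.
    + intros (Hs & z' & Hz & -> & H). rewrite IH in H. destruct H as (z'' & H & ->).
      exists z''. rewrite pft_cons; auto.
    + intros (z' & H & ->). rewrite pft_cons in H. destruct H as [Hs H]. split; auto.
      exists (cat l z'). split; [symmetry; apply cat_source; auto|split; auto].
      apply IH; eauto.
Qed.

(** * The topology of the boundary path space *)

Definition avoids (F : list (edge E)) (z : BP E) : Prop := forall e, In e F -> first_edge z <> Some e.

(* [Z(l)] minus the cylinders [Z(l e)] for [e] in [F]. *)
Definition bas (v : vert E) (l F : list (edge E)) (p : BP E) : Prop :=
  exists z, path_from_to v (source z) l /\ avoids F z /\ p = cat l z.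

Lemma cyl_snoc v l e z : path_from_to v (source z) l ->
  (cyl v (l ++ [e]) (proj1_sig (cat l z)) <-> first_edge z = Some e).
Proof.
  intro H. rewrite cyl_cat. split.
  - intros (z' & H' & eq). rewrite cat_app in eq.
    apply pft_app in H'. destruct H' as (u & H1 & H2).
    assert (eu := H2). rewrite pft_cons, pft_nil in eu. destruct eu as [<- eu].
    assert (Hu : source (cat [e] z') = src e) by (apply cat_source; auto).
    rewrite <- Hu in H1. destruct (cat_inj _ _ _ _ _ _ H H1 eq_refl eq) as [_ ->].
    apply cns_first_edge; auto.
  - intro He. destruct (first_edge_some _ _ He) as (z' & Hz & ->). exists z'. split.
    + eapply pft_trans; eauto. rewrite cns_source; auto. rewrite pft_cons, pft_nil; auto.
    + rewrite cat_app; auto.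
Qed.

Lemma basic_bas A : bd_basic A -> exists v l F, chain v l /\ forall p, A p <-> bas v l F p.
Proof.
  intros (v & l & F & Hc & HF & H). exists v, l, F. split; auto. intro p. rewrite H, cyl_cat.
  split.
  - intros [(z & Hz & ->) Ha]. exists z. split; auto. split; auto.
    intros e He n. apply (Ha e He). apply cyl_snoc; auto.
  - intros (z & Hz & Ha & ->). split; eauto. intros e He n. apply (Ha e He).
    apply cyl_snoc in n; auto.
Qed.

(** [bas] accepts any list [F], while a basic set asks that its excluded edges start where [l] ends.
    Other edges exclude nothing, so the filter removes them. *)
Lemma bas_basic v l F : chain v l -> bd_basic (bas v l F).
Proof.
  intro Hc. exists v, l.
  exists (filter (fun e => if excluded_middle_informative (src e = pend v l) then true else false) F).
  split; [auto|split].
  - intros e He. apply filter_In in He. destruct He as [_ He].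
    destruct (excluded_middle_informative (src e = pend v l)); [auto|discriminate].
  - intro p. rewrite cyl_cat. split.
    + intros (z & Hz & Ha & ->). split; eauto. intros e He n. apply filter_In in He.
      apply (Ha e); [tauto|]. apply cyl_snoc in n; auto.
    + intros [(z & Hz & ->) Ha]. exists z. split; auto. split; auto.
      intros e He n. apply (Ha e).
      * apply filter_In. split; auto. destruct (excluded_middle_informative _) as [|n']; auto.
        exfalso; apply n'. rewrite (first_edge_src _ _ n). symmetry. apply Hz.
      * apply cyl_snoc; auto.
Qed.

Lemma open_local (W : BP E -> Prop) :
  (forall x, W x -> exists U, bd_open U /\ U x /\ forall y, U y -> W y) -> bd_open W.
Proof.
  intros H x Wx. destruct (H x Wx) as (U & oU & Ux & I).
  destruct (oU x Ux) as (Bs & HB & HI). exists Bs; auto.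
Qed.

Lemma open_inter (U V : BP E -> Prop) :
  bd_open U -> bd_open V -> bd_open (fun x => U x /\ V x).
Proof.
  intros oU oV x [Ux Vx]. destruct (oU x Ux) as (Bs & HB & HI).
  destruct (oV x Vx) as (Bs' & HB' & HI'). exists (Bs ++ Bs'). split.
  - intros A HA. apply in_app_or in HA. destruct HA; auto.
  - intros s Hs. split; [apply HI|apply HI']; intros; apply Hs, in_or_app; auto.
Qed.

Lemma open_full : bd_open (fun _ : BP E => True).
Proof. intros x _. exists []. split; simpl; [tauto|auto]. Qed.

Lemma open_bas v l F : chain v l -> bd_open (bas v l F).
Proof.
  intros H x Hx. exists [bas v l F]. split.
  - intros A [<-|[]]. split; auto. apply bas_basic; auto.
  - intros s Hs. apply Hs; simpl; auto.
Qed.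

(** If the prefixes are equal, the lists of excluded edges are joined. If [l'] is strictly longer,
    it already contains the edge following [l], so the exclusions [F] hold at every point of the
    smaller set once they hold at [p]. *)
Lemma bas_refine v l F v' l' F' p : chain v l -> chain v' l' -> bas v l F p -> bas v' l' F' p ->
  length l <= length l' ->
  exists G, bas v' l' G p /\ forall q, bas v' l' G q -> bas v l F q /\ bas v' l' F' q.
Proof.
  intros Hc Hc' (z & Hz & Ha & ->) (z' & Hz' & Ha' & eq) L.
  assert (v' = v) by (rewrite <- (cat_source _ _ _ Hz), eq; symmetry; apply cat_source; auto). subst v'.
  destruct (cat_prefix _ _ _ _ _ _ Hz Hz' L eq) as (t & -> & Ht & ->).
  destruct t as [|e t].
  - simpl in *. exists (F ++ F'). rewrite app_nil_r in *. split.
    + exists z'. split; auto. split; auto. intros e He. apply in_app_or in He. destruct He; auto.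
    + intros q (z & Hq & Haq & ->). split; exists z; split; auto; split; auto;
        intros e He; apply Haq, in_or_app; auto.
  - exists F'. split.
    + exists z'. auto.
    + intros q Hq. split; auto. destruct Hq as (z & Hq & Haq & ->).
      assert (Hq2 : path_from_to (source (cat (e :: t) z')) (source z) (e :: t)).
      { eapply pft_suffix; eauto. }
      exists (cat (e :: t) z). split; [|split].
      * rewrite (cat_source _ _ _ Hq2); auto.
      * intros e' He'. rewrite (cat_first_edge _ _ _ _ Hq2). rewrite <- (cat_first_edge _ _ _ _ Ht). auto.
      * apply cat_app.
Qed.

Lemma bas_inter v l F v' l' F' p : chain v l -> chain v' l' -> bas v l F p -> bas v' l' F' p ->
  exists v'' l'' G, chain v'' l'' /\ bas v'' l'' G p /\
     forall q, bas v'' l'' G q -> bas v l F q /\ bas v' l' F' q.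
Proof.
  intros Hc Hc' H H'. destruct (Nat.le_ge_cases (length l) (length l')) as [L|L].
  - destruct (bas_refine _ _ _ _ _ _ _ Hc Hc' H H' L) as (G & HG & I). eauto 7.
  - destruct (bas_refine _ _ _ _ _ _ _ Hc' Hc H' H L) as (G & HG & I).
    exists v, l, G. split; auto. split; auto. intros q Hq; destruct (I q Hq); auto.
Qed.

Lemma open_nbhd (W : BP E -> Prop) p : bd_open W -> W p ->
  exists v l F, chain v l /\ bas v l F p /\ forall q, bas v l F q -> W q.
Proof.
  intros oW Wp. destruct (oW p Wp) as (Bs & HB & HI).
  assert (H : exists v l F, chain v l /\ bas v l F p /\
      forall q, bas v l F q -> forall A, In A Bs -> A q).
  { clear HI. induction Bs as [|A Bs IH].
    - exists (source p), [], []. split; simpl; auto. split; [|intros ? ? ? []].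
      exists p. rewrite pft_nil. split; auto. split; auto. intros e [].
    - destruct IH as (v & l & F & Hc & Hp & I); [intros; apply HB; simpl; auto|].
      destruct (HB A (or_introl eq_refl)) as [bA Ap].
      destruct (basic_bas _ bA) as (v' & l' & F' & Hc' & HA).
      apply HA in Ap.
      destruct (bas_inter _ _ _ _ _ _ _ Hc Hc' Hp Ap) as (v2 & l2 & F2 & Hc2 & Hp2 & I2).
      exists v2, l2, F2. split; auto. split; auto. intros q Hq A' [<-|HA'].
      + apply HA. apply I2; auto.
      + apply (I q); auto. apply I2; auto. }
  destruct H as (v & l & F & Hc & Hp & I). exists v, l, F. split; auto. split; auto.
  intros q Hq. apply HI. exact (I q Hq).
Qed.

(** A basic neighbourhood of [cat l z] whose prefix extends [l] pulls back to a basic set at [w]. If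
    its prefix is strictly shorter, the next edge belongs to [l], and every tail starting at [w]
    qualifies. *)
Lemma open_pull v w l (W : BP E -> Prop) : path_from_to v w l -> bd_open W ->
  bd_open (fun z => source z = w /\ W (cat l z)).
Proof.
  intros Hl oW. apply open_local. intros z [Hz Wz].
  destruct (open_nbhd W _ oW Wz) as (v' & l' & F & Hc & (z' & Hz' & Ha & eq) & I).
  assert (Hlz : path_from_to v (source z) l) by (rewrite Hz; auto).
  assert (v' = v) by (rewrite <- (cat_source _ _ _ Hlz), eq; symmetry; apply cat_source; auto). subst v'.
  destruct (Nat.le_gt_cases (length l) (length l')) as [L|L].
  - destruct (cat_prefix _ _ _ _ _ _ Hlz Hz' L eq) as (t & -> & Ht & ->).
    exists (bas w t F). rewrite Hz in Ht. split; [|split].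
    + apply open_bas. apply Ht.
    + exists z'; auto.
    + intros y (y' & Hy & Hay & ->). split; [apply cat_source; auto|].
      apply I. exists y'. split; [apply (pft_trans _ w); auto|]. split; auto. rewrite cat_app; auto.
  - destruct (cat_prefix _ _ _ _ _ _ Hz' Hlz ltac:(lia) (eq_sym eq)) as (t & -> & Ht & ->).
    destruct t as [|e t]; [rewrite app_nil_r in L; lia|].
    exists (bas w [] []). split; [|split].
    + apply open_bas; simpl; auto.
    + exists z. rewrite pft_nil. split; auto. split; auto. intros ? [].
    + intros y (y' & Hy & _ & ->). rewrite pft_nil in Hy. simpl cat at 1.
      split; auto. rewrite cat_app. apply I.
      assert (Hty : path_from_to (source (cat (e :: t) z)) (source y') (e :: t)) by (rewrite <- Hy, <- Hz; auto).
      exists (cat (e :: t) y'). split; [|split; auto].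
      * rewrite (cat_source _ _ _ Hty); auto.
      * intros e' He'. rewrite (cat_first_edge _ _ _ _ Hty). rewrite <- (cat_first_edge _ _ _ _ Ht). auto.
Qed.

Lemma open_push v w l (W : BP E -> Prop) : path_from_to v w l -> bd_open W ->
  bd_open (fun p => exists z, source z = w /\ W z /\ p = cat l z).
Proof.
  intros Hl oW. apply open_local. intros p (z & Hz & Wz & ->).
  destruct (open_nbhd W _ oW Wz) as (w' & t & F & Hc & (z' & Hz' & Ha & ->) & I).
  assert (w' = w) by (rewrite <- (cat_source _ _ _ Hz'); auto). subst w'.
  exists (bas v (l ++ t) F).
  assert (Hlt : path_from_to v (source z') (l ++ t)) by (eapply pft_trans; eauto).
  split; [|split].
  - apply open_bas. apply Hlt.
  - exists z'. split; auto. split; auto. rewrite cat_app; auto.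
  - intros q (y & Hy & Hay & ->).
    assert (Hty : path_from_to w (source y) t) by (eapply pft_suffix; eauto).
    exists (cat t y). split; [apply cat_source; auto|]. rewrite cat_app. split; auto.
    apply I. exists y; auto.
Qed.

Lemma open_source (P : vert E -> Prop) : bd_open (fun p => P (source p)).
Proof.
  apply open_local. intros x Px. exists (bas (source x) [] []). split; [|split].
  - apply open_bas; simpl; auto.
  - exists x. rewrite pft_nil. split; auto. split; auto. intros ? [].
  - intros y (z & Hz & _ & ->). rewrite pft_nil in Hz. simpl. congruence.
Qed.

(** Induction from the last edge: the complement of Z(le) is the complement of Z(l) together with
    the basic set Z(l) minus Z(le). *)
Lemma cyl_compl_open v l : chain v l -> bd_open (fun p => ~ bas v l [] p).
Proof.
  induction l as [|e l IH] using rev_ind; intro Hc.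
  - apply open_local. intros x nx. exists (fun y => source y <> v). split; [|split].
    + apply (open_source (fun u => u <> v)).
    + intro e. apply nx. exists x. rewrite pft_nil. split; auto. split; auto. intros ? [].
    + intros y ny (z & Hz & _ & ->). rewrite pft_nil in Hz. apply ny; auto.
  - assert (Hp : path_from_to v (pend v (l ++ [e])) (l ++ [e])) by (split; auto).
    apply pft_app in Hp. destruct Hp as (u & Hl & He).
    rewrite pft_cons in He. destruct He as [He _].
    apply open_local. intros x nx. destruct (classic (bas v l [] x)) as [Hx|n].
    + destruct Hx as (z & Hz & _ & ->).
      assert (Hd : first_edge z <> Some e).
      { intro n. destruct (first_edge_some _ _ n) as (z' & Hz' & ->). apply nx. exists z'.
        split; [|split; [intros ? []|]].
        - eapply pft_trans; eauto. rewrite cns_source; auto. rewrite pft_cons, pft_nil; auto.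
        - rewrite cat_app; auto. }
      exists (bas v l [e]). split; [|split].
      * apply open_bas. apply Hl.
      * exists z. split; auto. split; auto. intros e' [<-|[]]; auto.
      * intros y (z1 & Hz1 & Ha1 & ->) (z2 & Hz2 & _ & eq).
        apply (Ha1 e); simpl; auto. apply (cyl_snoc v l); auto. apply cyl_cat; eauto.
    + exists (fun p => ~ bas v l [] p). split; [|split]; auto.
      * apply IH. apply Hl.
      * intros y ny (z & Hz & _ & ->). apply ny. apply pft_app in Hz.
        destruct Hz as (u' & H1 & H2). rewrite <- (cat_source _ _ _ H2) in H1.
        exists (cat [e] z). split; auto. split; [intros ? []|]. apply cat_app.
Qed.

(** A point of Z(l) outside the basic set continues with an excluded edge [e], and then all of Z(le)
    is outside. So all basic sets are clopen. *)
Lemma bas_compl_open v l F : chain v l -> bd_open (fun p => ~ bas v l F p).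
Proof.
  intro Hc. apply open_local. intros x nx. destruct (classic (bas v l [] x)) as [Hx|n].
  - destruct Hx as (z & Hz & _ & ->).
    assert (He : exists e, In e F /\ first_edge z = Some e).
    { apply NNPP; intro n. apply nx. exists z. split; auto. split; auto.
      intros e He n'. apply n; eauto. }
    destruct He as (e & HF & He).
    assert (Hle : path_from_to v (rng e) (l ++ [e])).
    { eapply pft_trans; eauto. rewrite pft_cons, pft_nil. split; auto. apply first_edge_src; auto. }
    destruct (first_edge_some _ _ He) as (z' & Hz' & ->).
    exists (bas v (l ++ [e]) []). split; [|split].
    + apply open_bas, Hle.
    + exists z'. rewrite <- Hz'. split; auto. split; [intros ? []|]. rewrite cat_app; auto.
    + intros y (y1 & H1 & _ & ->) (y2 & H2 & Ha & eq). apply (Ha e HF).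
      apply (cyl_snoc v l); auto. apply cyl_cat. exists y1. auto.
  - exists (fun p => ~ bas v l [] p). split; [|split]; auto.
    + apply cyl_compl_open; auto.
    + intros y ny (z & Hz & _ & ->). apply ny. exists z. split; auto. split; auto. intros ? [].
Qed.

End Paths.

(** * Segments of infinite paths and separation of points *)

Section Segments.
Context {E : graph}.

Definition seg (x : nat -> edge E) (i n : nat) : list (edge E) := map x (seq i n).

Lemma seg_length x i n : length (seg x i n) = n.
Proof. unfold seg. rewrite length_map, length_seq; auto. Qed.

Lemma seg_app x i n m : seg x i (n + m) = seg x i n ++ seg x (i + n) m.
Proof. unfold seg. rewrite seq_app, map_app; auto. Qed.

Lemma seg_tail x i j n : seg (fun k => x (k + j)) i n = seg x (i + j) n.
Proof.
  revert i; induction n; intro i; auto.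
  unfold seg in *; simpl. rewrite IHn; auto.
Qed.

Lemma seg_nth x i n k : k < n -> nth_error (seg x i n) k = Some (x (i + k)).
Proof.
  intro H. unfold seg. rewrite nth_error_map, nth_error_seq.
  destruct (Nat.ltb_spec k n); [reflexivity|lia].
Qed.

Lemma seg_pft x i n : is_infpath x -> path_from_to (src (x i)) (src (x (i + n))) (seg x i n).
Proof.
  intro H. revert i; induction n; intro i.
  - rewrite Nat.add_0_r. apply pft_nil; auto.
  - apply pft_cons. split; auto. rewrite H. rewrite <- plus_n_Sm. apply (IHn (S i)).
Qed.

Lemma tail_infpath (x : nat -> edge E) n : is_infpath x -> is_infpath (fun i => x (i + n)).
Proof. intros H i. apply (H (i + n)). Qed.

Definition infinite_point (x : nat -> edge E) (H : is_infpath x) : BP E := exist is_bpath (BInf x) H.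

Lemma infinite_point_split x H n :
  path_from_to (src (x 0)) (source (infinite_point _ (tail_infpath x n H))) (seg x 0 n) /\
  infinite_point x H = cat (seg x 0 n) (infinite_point _ (tail_infpath x n H)).
Proof.
  assert (P : forall n, path_from_to (src (x 0)) (source (infinite_point _ (tail_infpath x n H))) (seg x 0 n))
    by (intro m; apply (seg_pft x 0 m H)).
  split; auto. induction n.
  - apply BP_ext; simpl. f_equal. apply functional_extensionality; intro i. f_equal; lia.
  - rewrite IHn. replace (S n) with (n + 1) by lia. rewrite seg_app, cat_app. f_equal.
    assert (Hd : first_edge (infinite_point _ (tail_infpath x n H)) = Some (x n)) by reflexivity.
    destruct (first_edge_some _ _ Hd) as (z' & Hz' & e). rewrite e. simpl. f_equal.
    apply BP_ext. pose proof (f_equal (fun z => shift 1 (proj1_sig z)) e) as e1. simpl in e1.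
    rewrite shift_cns in e1; auto. rewrite shift_0 in e1. rewrite <- e1. simpl. f_equal.
    apply functional_extensionality; intro i. f_equal; lia.
Qed.

Lemma bas_nil_cyl v l (x : BP E) : bas v l [] x <-> cyl v l (proj1_sig x).
Proof.
  rewrite cyl_cat. split.
  - intros (z & Hz & _ & e); eauto.
  - intros (z & Hz & e); exists z; split; auto. split; auto. intros ? [].
Qed.

Lemma cyl_chain v l (x : BP E) : cyl v l (proj1_sig x) -> chain v l.
Proof. rewrite cyl_cat. intros (z & [H _] & _); auto. Qed.

Lemma cyl_separate (x y : BP E) :
  (forall v l, cyl v l (proj1_sig x) <-> cyl v l (proj1_sig y)) -> x = y.
Proof.
  intro H. apply BP_ext. destruct x as [x Hx], y as [y Hy]; simpl in *.
  (* A prefix of the infinite path one edge longer than [l] gives a cylinder that the finite path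
     cannot meet. *)
  assert (mixed : forall (v : vert E) l z, (forall v' l', cyl v' l' (BFin v l) <-> cyl v' l' (BInf z)) -> False).
  { intros v l z HH. destruct (proj2 (HH (src (z 0)) (seg z 0 (S (length l))))) as (_ & t & e).
    - split; auto. intros i e He. assert (i < S (length l)).
      { rewrite <- (seg_length z 0 (S (length l))). apply nth_error_Some. congruence. }
      rewrite seg_nth in He; auto. simpl in He. congruence.
    - apply (f_equal (@length _)) in e. rewrite length_app, seg_length in e. lia. }
  destruct x as [v l|x], y as [v' l'|y].
  - destruct (proj1 (H v l)) as (-> & t & e); [split; auto; exists []; rewrite app_nil_r; auto|].
    destruct (proj2 (H v l')) as (_ & t' & e'); [split; auto; exists []; rewrite app_nil_r; auto|].
    f_equal. apply (f_equal (@length _)) in e as L. apply (f_equal (@length _)) in e' as L'.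
    rewrite length_app in L, L'. destruct t; [|simpl in L; lia]. rewrite app_nil_r in e; auto.
  - exfalso; eauto.
  - exfalso. apply (mixed v' l' x). intros; symmetry; auto.
  - f_equal. apply functional_extensionality; intro i.
    destruct (proj1 (H (src (x 0)) (seg x 0 (S i)))) as (_ & Hy').
    + split; auto. intros j e He. assert (j < S i).
      { rewrite <- (seg_length x 0 (S i)). apply nth_error_Some. congruence. }
      rewrite seg_nth in He; auto. simpl in He. congruence.
    + symmetry. apply (Hy' i). rewrite seg_nth; auto.
Qed.

Lemma BP_hausdorff (x y : BP E) : x <> y ->
  exists U V, bd_open U /\ bd_open V /\ U x /\ V y /\ forall z, U z -> V z -> False.
Proof.
  intro n. assert (H : exists v l, ~ (cyl v l (proj1_sig x) <-> cyl v l (proj1_sig y))).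
  { apply NNPP; intro n'. apply n, cyl_separate. intros v l. apply NNPP; eauto. }
  destruct H as (v & l & H). rewrite <- !bas_nil_cyl in H.
  assert (Hc : chain v l).
  { apply NNPP; intro nc. apply H. rewrite !bas_nil_cyl. split; intro c; exfalso; eauto using cyl_chain. }
  destruct (classic (bas v l [] x)) as [Hx|Hx].
  - exists (bas v l []), (fun p => ~ bas v l [] p).
    repeat split; auto using open_bas, cyl_compl_open. tauto.
  - exists (fun p => ~ bas v l [] p), (bas v l []).
    repeat split; auto using open_bas, cyl_compl_open. apply NNPP; tauto.
Qed.

(** * Compactness *)

(* The cover condition for the tails of a bad path: at an infinite emitter, the
   point ending there absorbs all but finitely many outgoing edges. *)
Lemma cover_tails (C : (BP E -> Prop) -> Prop) v w l :
  (forall U, C U -> bd_open U) ->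
  path_from_to v w l ->
  (forall p, source p = v -> exists U, C U /\ U p) ->
  exists (F : list (edge E)) Us, (forall U, In U Us -> C U) /\
    forall z, source z = w -> (exists e, In e F /\ first_edge z = Some e) \/ exists U, In U Us /\ U (cat l z).
Proof.
  intros oC Hl cov. destruct (classic (singular w)) as [s|ns].
  - assert (Hs : is_bpath (BFin w [])) by (split; simpl; auto).
    pose (n0 := exist is_bpath (BFin w []) Hs : BP E).
    assert (H0 : first_edge n0 = None) by reflexivity.
    destruct (cov (cat l n0)) as (U & CU & Un); [apply cat_source; auto|].
    destruct (open_nbhd _ n0 (open_pull v w l U Hl (oC U CU))) as (w' & t & F & Hc & (z & Hz & Ha & e) & I).
    { split; auto. }
    destruct t as [|e0 t].
    + exists F, [U]. split; [intros ? [<-|[]]; auto|].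
      intros z1 Hz1. destruct (classic (exists e, In e F /\ first_edge z1 = Some e)) as [|n]; auto.
      right. exists U. split; [simpl; auto|]. apply I. exists z1. split; [|split; auto].
      * rewrite pft_nil in *. rewrite Hz1, Hz. simpl in e. rewrite <- e. reflexivity.
      * intros e1 H1 H2; apply n; eauto.
    + exfalso. rewrite e, (cat_first_edge _ _ _ _ Hz) in H0. discriminate.
  - assert (exists F, forall e, src e = w -> In e F).
    { apply NNPP; intro n. apply ns. right. intro F. apply NNPP; intro n'. apply n.
      exists F. intros e He. apply NNPP; intro ni. apply n'; eauto. }
    destruct H as (F & HF). exists F, []. split; [intros ? []|].
    intros z Hz. left. destruct (first_edge z) as [e|] eqn:He.
    + exists e. split; auto. apply HF. rewrite (first_edge_src _ _ He); auto.
    + exfalso. apply ns. rewrite <- Hz. apply first_edge_none; auto.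
Qed.

Definition covered (C : (BP E -> Prop) -> Prop) (K : BP E -> Prop) : Prop :=
  exists Us, (forall U, In U Us -> C U) /\ forall x, K x -> exists U, In U Us /\ U x.

Lemma covered_union C (T : Type) (L : list T) (K : T -> BP E -> Prop) :
  (forall t, In t L -> covered C (K t)) -> covered C (fun x => exists t, In t L /\ K t x).
Proof.
  induction L as [|t L IH]; intro H.
  - exists []. split; [intros ? []|]. intros x (t & [] & _).
  - destruct IH as (Us & HU & cov); [intros; apply H; simpl; auto|].
    destruct (H t (or_introl eq_refl)) as (Vs & HV & cov').
    exists (Vs ++ Us). split.
    + intros U HU'. apply in_app_or in HU'. destruct HU'; auto.
    + intros x (t' & [<-|i] & Kx).
      * destruct (cov' x Kx) as (U & iU & Ux). exists U. split; auto. apply in_or_app; auto.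
      * destruct (cov x) as (U & iU & Ux); eauto. exists U. split; auto. apply in_or_app; auto.
Qed.

Lemma covered_or C (K K' : BP E -> Prop) : covered C K -> covered C K' ->
  covered C (fun x => K x \/ K' x).
Proof.
  intros (Us & HU & cov) (Vs & HV & cov'). exists (Us ++ Vs). split.
  - intros U i. apply in_app_or in i. destruct i; auto.
  - intros x [Kx|Kx].
    + destruct (cov x Kx) as (U & i & Ux). exists U; split; auto using in_or_app.
    + destruct (cov' x Kx) as (U & i & Ux). exists U; split; auto using in_or_app.
Qed.

Lemma covered_sub C (K K' : BP E -> Prop) : covered C K -> (forall x, K' x -> K x) -> covered C K'.
Proof. intros (Us & HU & cov) H. exists Us; auto. Qed.

Lemma bad_extends C v l :
  (forall U, C U -> bd_open U) ->
  (forall p, source p = v -> exists U, C U /\ U p) ->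
  chain v l -> ~ covered C (bas v l []) ->
  exists e, chain v (l ++ [e]) /\ ~ covered C (bas v (l ++ [e]) []).
Proof.
  intros oC cov Hc nb. apply NNPP; intro n. apply nb.
  destruct (cover_tails C v (pend v l) l oC (pft_self v l Hc) cov) as (F & Us & HUs & HF).
  apply covered_sub with (K := fun x => (exists U, In U Us /\ U x) \/
    exists e, In e F /\ (chain v (l ++ [e]) /\ bas v (l ++ [e]) [] x)).
  - apply covered_or.
    + exists Us; auto.
    + apply covered_union. intros e He. destruct (classic (chain v (l ++ [e]))) as [c|c].
      * apply covered_sub with (K := bas v (l ++ [e]) []); [|tauto].
        apply NNPP; intro n'; apply n; eauto.
      * exists []. split; [intros ? []|]. tauto.
  - intros x (z & Hz & _ & ->). assert (Hw := proj2 Hz).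
    destruct (HF z (eq_sym Hw)) as [(e & He & Hh)|(U & iU & Ux)]; [right|left; eauto].
    exists e. split; auto.
    assert (cyl v (l ++ [e]) (proj1_sig (cat l z))) by (apply cyl_snoc; auto).
    split; [eapply cyl_chain; eauto|]. apply bas_nil_cyl; auto.
Qed.

(** An argument in the manner of König: a prefix whose cylinder has no finite subcover extends by
    one edge to another such prefix. Iteration yields an infinite path [x], and the member of the
    cover containing [x] contains the cylinder of one of its prefixes. *)
Lemma vertex_cylinder_compact (v : vert E) : compact_set bd_open (fun p => source p = v).
Proof.
  intros C oC cov. apply NNPP; intro nb.
  set (bad := fun l => chain v l /\ ~ covered C (bas v l [])).
  assert (b0 : bad []).
  { split; [simpl; auto|]. intro H. apply nb. apply (covered_sub _ _ _ H).
    intros x Hx. exists x. rewrite pft_nil. split; auto. split; auto. intros ? []. }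
  destruct (choice (fun (s : {l | bad l}) e => bad (proj1_sig s ++ [e]))) as (nxt & Hn).
  { intros (l & Hc & Hb). apply bad_extends; auto. }
  pose (step := fun s : {l | bad l} => exist bad (proj1_sig s ++ [nxt s]) (Hn s)).
  pose (s := fun n => Nat.iter n step (exist bad [] b0)).
  pose (x := fun n => nxt (s n)).
  assert (sx : forall n, proj1_sig (s n) = seg x 0 n).
  { induction n; auto. replace (S n) with (n + 1) by lia. rewrite seg_app, <- IHn.
    replace (n + 1) with (S n) by lia. reflexivity. }
  assert (Hb : forall n, bad (seg x 0 n)) by (intro n; rewrite <- sx; apply proj2_sig).
  assert (Hx : is_infpath x).
  { intro i. destruct (Hb (i + 2)) as [Hc _]. apply pft_self in Hc. rewrite seg_app in Hc.
    apply pft_app in Hc. destruct Hc as (u & _ & Hc). simpl in Hc.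
    unfold seg in Hc; simpl in Hc. rewrite !pft_cons in Hc. symmetry; tauto. }
  assert (Hv : src (x 0) = v).
  { destruct (Hb 1) as [Hc _]. simpl in Hc. tauto. }
  destruct (cov (infinite_point x Hx) Hv) as (U & CU & Ux).
  destruct (open_nbhd U _ (oC U CU) Ux) as (v' & l & F & Hc & (z & Hz & Ha & e) & I).
  destruct (infinite_point_split x Hx (length l)) as [Hp eq].
  rewrite e in eq.
  destruct (cat_inj _ _ _ _ _ _ Hz Hp (eq_sym (seg_length x 0 (length l))) eq) as [el ez].
  assert (ev : v' = v).
  { rewrite <- (cat_source _ _ _ Hz), <- e. exact Hv. }
  subst v'.
  (* The extra edge is needed because the neighbourhood only contains Z(l) minus excluded edges; the
     next edge of [x] is not excluded, so the cylinder one edge longer fits. *)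
  destruct (Hb (length l + 1)) as [_ nc]. apply nc. exists [U]. split; [intros ? [<-|[]]; auto|].
  intros p Hp'. exists U. split; [simpl; auto|]. apply I.
  rewrite seg_app, <- el in Hp'. simpl in Hp'. destruct Hp' as (y & Hy & _ & ->).
  apply pft_app in Hy. destruct Hy as (u & H1 & H2). rewrite <- (cat_source _ _ _ H2) in H1.
  exists (cat [x (length l)] y). split; auto. split; [|apply cat_app].
  intros e0 He0. rewrite (cat_first_edge _ _ _ _ H2). specialize (Ha e0 He0). rewrite ez in Ha. exact Ha.
Qed.

(** The complement of [K] is added to the cover, which then covers finitely many compact vertex
    cylinders, and is discarded again from the finite subcover. *)
Lemma closed_compact (vs : list (vert E)) (K : BP E -> Prop) :
  bd_open (fun x => ~ K x) -> (forall x, K x -> In (source x) vs) -> compact_set bd_open K.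
Proof.
  intros oK Kvs C oC cov.
  pose (C' := fun U => C U \/ U = (fun x => ~ K x)).
  assert (H : covered C' (fun x => exists v, In v vs /\ source x = v)).
  { apply covered_union. intros v _. apply vertex_cylinder_compact.
    - intros U [CU| ->]; auto.
    - intros x Hx. destruct (classic (K x)) as [Kx|n].
      + destruct (cov x Kx) as (U & CU & Ux). exists U; split; auto. left; auto.
      + exists (fun x => ~ K x). split; auto. right; auto. }
  destruct H as (Us & HUs & cov').
  assert (cK : covered C (fun x => K x /\ exists U, In U Us /\ U x)).
  { clear cov'. induction Us as [|U Us IH].
    - exists []. split; [intros ? []|]. intros x [_ (U & [] & _)].
    - destruct (HUs U (or_introl eq_refl)) as [CU| ->].
      + apply covered_sub with (K := fun x => U x \/ (K x /\ exists U, In U Us /\ U x)).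
        * apply covered_or; [exists [U]|apply IH; intros; apply HUs; simpl; auto].
          split; [intros ? [<-|[]]; auto|]. intros x Ux. exists U; simpl; auto.
        * intros x [Kx (V & [<-|i] & Vx)]; eauto 6.
      + apply covered_sub with (K := fun x => K x /\ exists U, In U Us /\ U x).
        * apply IH; intros; apply HUs; simpl; auto.
        * intros x [Kx (V & [<-|i] & Vx)]; [tauto|eauto]. }
  destruct cK as (Vs & HVs & cov2). exists Vs. split; auto.
  intros x Kx. apply cov2. split; auto. apply cov'. eauto.
Qed.

End Segments.

(** * Branching of infinite paths *)

Definition comparable {T : Type} (l l' : list T) : Prop :=
  exists t, l' = l ++ t \/ l = l' ++ t.

Lemma comparable_sym {T : Type} (l l' : list T) : comparable l l' -> comparable l' l.
Proof. intros (t & [H|H]); exists t; auto. Qed.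

Lemma comparable_prefix {T : Type} (p l l' : list T) :
  comparable (p ++ l) (p ++ l') -> comparable l l'.
Proof.
  intros (t & [H|H]); rewrite <- app_assoc in H; apply app_inv_head in H; exists t; auto.
Qed.

Lemma comparable_heads {T : Type} (l l' a b : list T) :
  comparable (l ++ a) (l' ++ b) -> comparable l l'.
Proof.
  intros (t & [H|H]); rewrite <- app_assoc in H; apply app_eq_app in H;
    destruct H as (u & [[H _]|[H _]]); exists u; auto.
Qed.

Lemma least_nat (P : nat -> Prop) : (exists n, P n) -> exists n, P n /\ forall m, m < n -> ~ P m.
Proof.
  intros (n & Hn). revert Hn. induction n as [n IH] using lt_wf_ind. intro Hn.
  destruct (classic (exists m, m < n /\ P m)) as [(m & L & Hm)|no]; [eauto|].
  exists n. split; auto. intros m L Hm. apply no; eauto.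
Qed.

Section Branching.
Context {E : graph}.

Lemma cat_comparable v v' l l' (z z' : BP E) :
  path_from_to v (source z) l -> path_from_to v' (source z') l' -> cat l z = cat l' z' ->
  comparable l l'.
Proof.
  intros H H' e. destruct (Nat.le_ge_cases (length l) (length l')) as [L|L].
  - destruct (cat_prefix _ _ _ _ _ _ H H' L e) as (t & -> & _). exists t; auto.
  - destruct (cat_prefix _ _ _ _ _ _ H' H L (eq_sym e)) as (t & -> & _). exists t; auto.
Qed.

(** A return path comes back to its base only with its last edge, so no proper prefix of it can be
    one. *)
Lemma return_path_prefix_free (v : vert E) l l' :
  return_path v l -> return_path v l' -> comparable l l' -> l = l'.
Proof.
  assert (W : forall l t, return_path v l -> return_path v (l ++ t) -> t = []).
  { clear. intros l t (n & Hc & Hp & _) (_ & _ & _ & Hr).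
    destruct (exists_last n) as (l0 & e & ->). destruct t as [|e' t]; auto. exfalso.
    apply (Hr (length l0) e).
    - rewrite !length_app. simpl. lia.
    - rewrite <- app_assoc, nth_error_app2, Nat.sub_diag; auto.
    - pose proof (pft_self v _ Hc) as H. rewrite Hp in H. apply pft_app in H.
      destruct H as (u & _ & H). rewrite pft_cons, pft_nil in H. tauto. }
  intros H H' (t & [->| ->]).
  - rewrite (W _ _ H H'), app_nil_r; auto.
  - rewrite (W _ _ H' H), app_nil_r; auto.
Qed.

Lemma seg_return_path (x : nat -> edge E) i n : is_infpath x ->
  src (x (i + S n)) = src (x i) -> (forall m, i < m < i + S n -> src (x m) <> src (x i)) ->
  return_path (src (x i)) (seg x i (S n)).
Proof.
  intros Hx e least. pose proof (seg_pft x i (S n) Hx) as Hp. rewrite e in Hp.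
  split; [discriminate|]. split; [apply Hp|]. split; [apply Hp|].
  intros j e0 L Hj. rewrite seg_length in L. rewrite seg_nth in Hj by lia.
  injection Hj; intros <-. rewrite Hx. apply least. lia.
Qed.

Hypothesis HK : condK E.
Hypothesis HW : condW E.

(* A vertex visited infinitely often supports a return path off [x]; along a wandering
   path, Condition (W) gives either a genuine detour or a cycle, and inserting that
   cycle at the last visit to its base leaves [x] for good. *)
Lemma infinite_path_detour (x : nat -> edge E) : is_infpath x ->
  exists k nu, path_from_to (src (x 0)) (src (x k)) nu /\ ~ comparable nu (seg x 0 k).
Proof.
  intro Hx. destruct (classic (wandering x)) as [w|nw].
  - destruct (HW x w) as (n & l1 & l2 & H1 & H2 & nl).
    rewrite Hx in H1, H2.
    assert (H : exists nu, path_from_to (src (x 0)) (src (x (S n))) nu /\ nu <> seg x 0 (S n)).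
    { destruct (classic (l1 = seg x 0 (S n))) as [e|ne]; [|eauto].
      exists l2. split; auto. congruence. }
    clear l1 l2 H1 H2 nl. destruct H as (nu & Hnu & ne).
    destruct (classic (comparable nu (seg x 0 (S n)))) as [c|nc]; [|eauto].
    pose proof (seg_pft x 0 (S n) Hx) as Hs. simpl plus in Hs.
    assert (Ht : exists t, t <> [] /\ path_from_to (src (x (S n))) (src (x (S n))) t).
    { destruct c as (t & [e|e]); exists t.
      - split; [intros ->; rewrite app_nil_r in e; congruence|].
        apply (pft_suffix (src (x 0)) _ _ nu); auto. rewrite <- e; auto.
      - split; [intros ->; rewrite app_nil_r in e; congruence|].
        apply (pft_suffix (src (x 0)) _ _ (seg x 0 (S n))); auto. rewrite <- e; auto. }
    clear c. destruct Ht as (t & nt & Ht).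
    destruct w as [_ w]. destruct (w (src (x (S n)))) as (N & HN).
    destruct (least_nat (fun M => forall i, M <= i -> src (x i) <> src (x (S n)))) as (M & HM & least); eauto.
    destruct M as [|j]; [exfalso; apply (HM (S n)); auto; lia|].
    assert (Hj : src (x j) = src (x (S n))).
    { apply NNPP; intro nj. apply (least j); [lia|]. intros i Hi.
      destruct (Nat.eq_dec i j) as [->|]; auto. apply HM; lia. }
    (* [j] is the last visit to the base of [t]. Comparability would force [t] to equal the segment
       of [x] of the same length after [j], which would bring [x] back to the base at time
       [j + length t > j]. *)
    exists (j + length t), (seg x 0 j ++ t ++ seg x j (length t)). split.
    + apply (pft_trans _ (src (x j))); [apply (seg_pft x 0 j Hx)|].
      apply (pft_trans _ (src (x j))); [rewrite Hj; auto|]. apply seg_pft; auto.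
    + intro c. rewrite seg_app in c. apply comparable_prefix in c.
      rewrite <- (app_nil_r (seg x (0 + j) (length t))) in c. apply comparable_heads in c.
      assert (e : t = seg x (0 + j) (length t)).
      { destruct c as (u & [e|e]); assert (u = []).
        - apply (f_equal (@length _)) in e. rewrite length_app, seg_length in e. destruct u; simpl in *; auto; lia.
        - subst; rewrite app_nil_r in e; auto.
        - apply (f_equal (@length _)) in e. rewrite length_app, seg_length in e. destruct u; simpl in *; auto; lia.
        - subst; rewrite app_nil_r in e; auto. }
      apply (HM (j + length t)).
      * destruct t; [congruence|simpl; lia].
      * pose proof (seg_pft x j (length t) Hx) as Hq. simpl in e. rewrite <- e, Hj in Hq.
        eapply pft_end; eauto.
  - assert (H : exists v, forall N, exists i, N <= i /\ src (x i) = v).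
    { apply NNPP; intro n. apply nw. split; auto. intro v. apply NNPP; intro n'.
      apply n. exists v. intro N. apply NNPP; intro n2. apply n'. exists N. intros i L e.
      apply n2; eauto. }
    destruct H as (v & H). destruct (H 0) as (i & _ & Hi).
    destruct (least_nat (fun m => i < m /\ src (x m) = v)) as (k & (L & Hk) & least).
    { destruct (H (S i)) as (m & Lm & Hm). exists m. split; auto. }
    assert (R : return_path v (seg x i (k - i))).
    { replace (k - i) with (S (k - i - 1)) by lia. rewrite <- Hi. apply seg_return_path; auto.
      - replace (i + S (k - i - 1)) with k by lia. congruence.
      - intros m Lm e. apply (least m); [lia|]. split; [lia|congruence]. }
    assert (D : exists d, return_path v d /\ d <> seg x i (k - i)).
    { destruct (HK v) as [n|(l1 & l2 & R1 & R2 & n)]; [exfalso; eapply n; eauto|].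
      destruct (classic (l1 = seg x i (k - i))); [|eauto]. exists l2; split; auto; congruence. }
    destruct D as (d & Rd & nd).
    exists k, (seg x 0 i ++ d). split.
    + apply (pft_trans _ v); [rewrite <- Hi; apply (seg_pft x 0 i Hx)|].
      rewrite Hk. split; apply Rd.
    + intro c. replace k with (i + (k - i)) in c by lia. rewrite seg_app in c.
      apply comparable_prefix in c. apply nd. eapply return_path_prefix_free; eauto.
Qed.

(** Two successive detours over adjacent stretches of [x]: the three paths are the straight one,
    detour then straight, and straight then detour. *)
Lemma infinite_path_three (x : nat -> edge E) N : is_infpath x ->
  exists M t1 t2, N <= M /\
    path_from_to (src (x N)) (src (x M)) t1 /\ path_from_to (src (x N)) (src (x M)) t2 /\
    ~ comparable (seg x N (M - N)) t1 /\ ~ comparable (seg x N (M - N)) t2 /\ ~ comparable t1 t2.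
Proof.
  intro Hx.
  destruct (infinite_path_detour _ (tail_infpath x N Hx)) as (k & nu & H & c).
  destruct (infinite_path_detour _ (tail_infpath x (N + k) Hx)) as (k' & nu' & H' & c').
  rewrite seg_tail in c, c'. simpl in *.
  replace (k + N) with (N + k) in H by lia.
  exists (N + k + k'), (nu ++ seg x (N + k) k'), (seg x N k ++ nu').
  replace (N + k + k' - N) with (k + k') by lia. rewrite seg_app.
  replace (k' + (N + k)) with (N + k + k') in H' by lia.
  split; [lia|]. split; [|split; [|split; [|split]]].
  - eapply pft_trans; eauto. apply seg_pft; auto.
  - eapply pft_trans; [apply seg_pft; auto|auto].
  - intro q. apply comparable_heads in q. apply c, comparable_sym; auto.
  - intro q. apply comparable_prefix in q. apply c', comparable_sym; auto.
  - intro q. apply comparable_heads in q. auto.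
Qed.

Hypothesis HI : condInf E.
Hypothesis HS : no_sinks E.

(** The exclusions [F] matter when one word is a prefix of the other, as happens at an infinite
    emitter: the plain cylinders are then nested, but the restricted ones are disjoint. *)
Definition strand_disjoint (w : vert E) (F s s' : list (edge E)) : Prop :=
  forall z z', source z = w -> avoids F z -> source z' = w -> avoids F z' -> cat s z <> cat s' z'.

Record three_strands (W : BP E -> Prop) (v w : vert E) (F s0 s1 s2 : list (edge E)) : Prop := {
  ts_path0 : path_from_to v w s0;
  ts_path1 : path_from_to v w s1;
  ts_path2 : path_from_to v w s2;
  ts_in0 : forall z, source z = w -> avoids F z -> W (cat s0 z);
  ts_in1 : forall z, source z = w -> avoids F z -> W (cat s1 z);
  ts_in2 : forall z, source z = w -> avoids F z -> W (cat s2 z);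
  ts_disj01 : strand_disjoint w F s0 s1;
  ts_disj02 : strand_disjoint w F s0 s2;
  ts_disj12 : strand_disjoint w F s1 s2 }.

Lemma incomparable_disjoint v v' w F s s' :
  path_from_to v w s -> path_from_to v' w s' -> ~ comparable s s' -> strand_disjoint w F s s'.
Proof.
  intros H H' n z z' Hz _ Hz' _ e. apply n. subst w. rewrite <- Hz' in H'.
  eapply cat_comparable; eauto.
Qed.

Lemma finite_cat v w l (z : BP E) : proj1_sig z = BFin w [] -> path_from_to v w l ->
  proj1_sig (cat l z) = BFin v l.
Proof.
  intro Hz. assert (Hw : source z = w) by (unfold source; rewrite Hz; auto).
  revert v; induction l as [|e l IH]; intros v Hl.
  - apply pft_nil in Hl. subst v. auto.
  - apply pft_cons in Hl. destruct Hl as [<- Hl]. simpl.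
    rewrite cns_raw, (IH _ Hl); auto. symmetry. apply cat_source. rewrite Hw; auto.
Qed.

(** A finite path [l] ends at an infinite emitter [w], and two edges returning to [w] give the
    strands [l], [l e1 c1], [l e2 c2]. An infinite path gets its strands from [infinite_path_three],
    started beyond the prefix that defines a neighbourhood inside [W]. *)
Lemma three_strands_exist (W : BP E -> Prop) (x : BP E) : bd_open W -> W x ->
  exists w F s0 s1 s2 z, three_strands W (source x) w F s0 s1 s2 /\
    source z = w /\ avoids F z /\ x = cat s0 z.
Proof.
  intros oW Wx. destruct x as [[v l|y] Hx].
  - assert (Hcs := Hx). destruct Hcs as [Hc Hs]. set (x := exist is_bpath (BFin v l) Hx : BP E).
    set (w := pend v l) in *.
    assert (Hw : is_bpath (BFin w [])) by (split; simpl; auto).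
    pose (n0 := exist is_bpath (BFin w []) Hw : BP E).
    assert (H0 : first_edge n0 = None) by reflexivity.
    assert (Hl : path_from_to v w l) by (split; auto).
    assert (ex : exist is_bpath (BFin v l) Hx = cat l n0).
    { apply BP_ext. symmetry. apply (finite_cat v w); auto. }
    assert (HF : exists F, forall z, source z = w -> avoids F z -> W (cat l z)).
    { destruct (open_nbhd _ n0 (open_pull v w l W Hl oW)) as (w' & t & F & Ht & (z & Hz & Ha & e) & I).
      { split; auto. rewrite <- ex; auto. }
      destruct t as [|e0 t].
      - exists F. intros z1 Hz1 Ha1. apply I. exists z1. split; auto.
        rewrite pft_nil in *. rewrite Hz1, Hz. simpl in e. rewrite <- e. reflexivity.
      - exfalso. rewrite e, (cat_first_edge _ _ _ _ Hz) in H0. discriminate. }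
    destruct HF as (F & HF).
    assert (Hinf : inf_emitter E w).
    { destruct Hs as [s|s]; auto. exfalso. destruct (HS w) as (e & He). apply (s e He). }
    destruct (HI w Hinf F) as (e1 & (Hs1 & c1 & Hc1) & n1).
    (* Avoiding [e1] as well makes the two returning edges distinct, so that the second and third
       strands are incomparable. *)
    destruct (HI w Hinf (e1 :: F)) as (e2 & (Hs2 & c2 & Hc2) & n2).
    assert (P1 : path_from_to w w (e1 :: c1)) by (apply pft_cons; auto).
    assert (P2 : path_from_to w w (e2 :: c2)) by (apply pft_cons; auto).
    (* Excluding [e1] and [e2] from the tails separates the strand [l] from its two extensions; the
       point itself stays, since its tail is empty. *)
    exists w, (e1 :: e2 :: F), l, (l ++ e1 :: c1), (l ++ e2 :: c2), n0.
    split; [|split; [reflexivity|split; [|auto]]]; [|intros e _; rewrite H0; discriminate].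
    assert (A : forall e c z, path_from_to w w (e :: c) -> ~ In e F -> source z = w ->
        W (cat (l ++ e :: c) z)).
    { intros e c z P n Hz. rewrite cat_app. assert (P' := P). rewrite <- Hz in P' at 2. apply HF.
      - apply cat_source; auto.
      - intros e' He'. rewrite (cat_first_edge _ _ _ _ P'). intro q; injection q; intros; subst; auto. }
    assert (D : forall e c z z', path_from_to w w (e :: c) -> In e (e1 :: e2 :: F) ->
        source z = w -> avoids (e1 :: e2 :: F) z -> source z' = w ->
        cat l z <> cat (l ++ e :: c) z').
    { intros e c z z' P i Hz Ha Hz' q. rewrite cat_app in q.
      assert (P' := P). rewrite <- Hz' in P' at 2.
      assert (Hl1 : path_from_to v (source z) l) by (rewrite Hz; auto).
      assert (Hl2 : path_from_to v (source (cat (e :: c) z')) l) by (rewrite (cat_source _ _ _ P'); auto).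
      destruct (cat_inj _ _ _ _ _ _ Hl1 Hl2 eq_refl q) as [_ ->].
      apply (Ha e i). apply (cat_first_edge _ _ _ _ P'). }
    constructor.
    + auto.
    + apply (pft_trans _ w); auto.
    + apply (pft_trans _ w); auto.
    + intros z Hz Ha. apply HF; auto. intros e He. apply Ha; simpl; auto.
    + intros z Hz _. apply A; auto.
    + intros z Hz _. apply A; auto. simpl in n2; tauto.
    + intros z z' Hz Ha Hz' _. apply D; simpl; auto.
    + intros z z' Hz Ha Hz' _. apply D; simpl; auto.
    + apply (incomparable_disjoint v v); [apply (pft_trans _ w)|apply (pft_trans _ w)|]; auto.
      intro c. apply comparable_prefix in c. destruct c as (t & [q|q]); injection q; intros;
        subst; simpl in n2; tauto.
  - simpl in Hx. destruct (open_nbhd W _ oW Wx) as (v & l & F & Hc & (z & Hz & Ha & e) & I).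
    set (x := exist is_bpath (BInf y) Hx : BP E) in *.
    destruct (infinite_point_split y Hx (length l)) as [Hp eq]. change (infinite_point y Hx) with x in eq.
    rewrite e in eq.
    destruct (cat_inj _ _ _ _ _ _ Hz Hp (eq_sym (seg_length y 0 (length l))) eq) as [el ez].
    assert (ev : v = src (y 0)).
    { rewrite <- (cat_source _ _ _ Hz), <- e. reflexivity. }
    set (n := length l) in *.
    (* Branching starts after edge [n], not before it: that edge is outside [F], so all three
       strands remain in [W]. *)
    destruct (infinite_path_three y (S n) Hx) as (M & t1 & t2 & L & H1 & H2 & d01 & d02 & d12).
    set (w := src (y M)) in *.
    pose proof (seg_pft y 0 (S n) Hx) as Hn. simpl plus in Hn.
    assert (H3 : path_from_to (src (y (S n))) w (seg y (S n) (M - S n))).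
    { pose proof (seg_pft y (S n) (M - S n) Hx) as H3.
      replace (S n + (M - S n)) with M in H3 by lia. auto. }
    assert (A : forall t u, path_from_to (src (y (S n))) w t -> source u = w ->
        W (cat (seg y 0 (S n) ++ t) u)).
    { intros t u Ht Hu. apply I. replace (S n) with (n + 1) at 1 by lia.
      rewrite seg_app, <- el. simpl app.
      assert (P : path_from_to (src (y n)) (source u) (y n :: t)).
      { apply pft_cons. split; auto. rewrite Hx, Hu; auto. }
      exists (cat (y n :: t) u). split; [|split].
      - rewrite (cat_source _ _ _ P). rewrite el, ev. apply (seg_pft y 0 n Hx).
      - intros e0 He0. rewrite (cat_first_edge _ _ _ _ P). specialize (Ha e0 He0).
        rewrite ez in Ha. exact Ha.
      - rewrite <- cat_app, <- app_assoc. reflexivity. }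
    destruct (infinite_point_split y Hx M) as [HpM eqM]. change (infinite_point y Hx) with x in eqM.
    exists w, [], (seg y 0 (S n) ++ seg y (S n) (M - S n)), (seg y 0 (S n) ++ t1), (seg y 0 (S n) ++ t2),
      (infinite_point _ (tail_infpath y M Hx)).
    change (source x) with (src (y 0)).
    split; [|split; [reflexivity|split; [intros ? []|]]].
    + constructor.
      * eapply pft_trans; eauto.
      * eapply pft_trans; eauto.
      * eapply pft_trans; eauto.
      * intros; apply A; auto.
      * intros; apply A; auto.
      * intros; apply A; auto.
      * eapply incomparable_disjoint; try (eapply pft_trans; eauto; fail).
        intro c; apply comparable_prefix in c; auto.
      * eapply incomparable_disjoint; try (eapply pft_trans; eauto; fail).
        intro c; apply comparable_prefix in c; auto.
      * eapply incomparable_disjoint; try (eapply pft_trans; eauto; fail).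
        intro c; apply comparable_prefix in c; auto.
    + change (seg y (S n) (M - S n)) with (seg y (0 + S n) (M - S n)).
      rewrite <- seg_app. replace (S n + (M - S n)) with M by lia. auto.
Qed.

End Branching.

(** * Local homeomorphisms *)

Section Local.
Context {E : graph}.

(** Both points begin with every power of [s], so they have the same prefixes. *)
Lemma cat_cycle_unique (w : vert E) s (z z' : BP E) : s <> [] -> path_from_to w w s ->
  source z = w -> source z' = w -> z = cat s z -> z' = cat s z' -> z = z'.
Proof.
  intros ns Hs Hz Hz' e e'.
  assert (R : forall n, path_from_to w w (concat (repeat s n)) /\
     forall y, y = cat s y -> y = cat (concat (repeat s n)) y).
  { induction n; simpl; [split; [apply pft_nil; auto|auto]|]. destruct IHn as [P IH]. split.
    - eapply pft_trans; eauto.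
    - intros y Hy. rewrite cat_app, <- IH; auto. }
  assert (L : forall n, n <= length (concat (repeat s n))).
  { induction n; simpl; auto. rewrite length_app. destruct s; [congruence|simpl in *; lia]. }
  assert (half : forall y y' : BP E, source y = w -> source y' = w -> y = cat s y -> y' = cat s y' ->
    forall v l, cyl v l (proj1_sig y) -> cyl v l (proj1_sig y')).
  { intros y y' Hy Hy' ey ey' v l Hc. apply cyl_cat in Hc. destruct Hc as (y0 & P0 & e0).
    destruct (R (length l)) as [P I].
    assert (P1 : path_from_to w (source y) (concat (repeat s (length l)))) by (rewrite Hy; auto).
    assert (v = w) by (rewrite <- Hy, e0; symmetry; apply cat_source; auto). subst v.
    destruct (cat_prefix _ _ _ _ _ _ P0 P1 (L _)) as (t & et & Pt & _).
    { rewrite <- e0. apply I; auto. }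
    apply cyl_cat. exists (cat t y').
    assert (Pt' : path_from_to (source y0) (source y') t) by (rewrite Hy', <- Hy; auto).
    split; [rewrite (cat_source _ _ _ Pt'); auto|]. rewrite <- cat_app, <- et. apply I; auto. }
  apply cyl_separate. intros v l; split; apply half; auto.
Qed.

(** With [a] the shorter word, [a' = a s] and [z = s z], so [z] is the periodic path with period
    [s]. This is the uniqueness that lets a germ determine its lag. *)
Lemma coincide_unique (v v' w : vert E) a a' (z z' : BP E) :
  path_from_to v w a -> path_from_to v' w a' -> length a <> length a' ->
  source z = w -> source z' = w -> cat a z = cat a' z -> cat a z' = cat a' z' -> z = z'.
Proof.
  assert (H : forall v v' a a', path_from_to v w a -> path_from_to v' w a' -> length a < length a' ->
    source z = w -> source z' = w -> cat a z = cat a' z -> cat a z' = cat a' z' -> z = z').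
  { clear. intros v v' a a' H H' L Hz Hz' e e'.
    assert (H1 := H). assert (H1' := H'). rewrite <- Hz in H1, H1'.
    destruct (cat_prefix _ _ _ _ _ _ H1 H1' ltac:(lia) e) as (s & -> & Hs & es).
    assert (H2 := H). assert (H2' := H'). rewrite <- Hz' in H2, H2'.
    destruct (cat_prefix _ _ _ _ _ _ H2 H2' ltac:(lia) e') as (s' & e1 & _ & es').
    apply app_inv_head in e1. subst s'. rewrite Hz in Hs.
    apply (cat_cycle_unique w s); auto. intros ->. rewrite app_nil_r in L; lia. }
  intros P P' n Hz Hz' e e'. destruct (Nat.lt_gt_cases (length a) (length a')) as [C _].
  destruct (C n) as [L|L]; [apply (H v v' a a')|apply (H v' v a' a)]; auto.
Qed.

Record chart (f : BP E -> BP E) (k : Z) (y : BP E) (v u w : vert E) (a b : list (edge E))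
  (W : BP E -> Prop) (z : BP E) : Prop := {
  ch_a : path_from_to v w a;
  ch_b : path_from_to u w b;
  ch_open : bd_open W;
  ch_in : W z;
  ch_src : source z = w;
  ch_pt : y = cat b z;
  ch_k : k = (Z.of_nat (length a) - Z.of_nat (length b))%Z;
  ch_map : forall z', source z' = w -> W z' -> f (cat b z') = cat a z' }.

(* [acts f k y]: near [y], [f] replaces a finite prefix [b] by a prefix [a] with the
   same range, where [k = |a| - |b|]; this is the germ of an open bisection at [y]. *)
Definition acts (f : BP E -> BP E) (k : Z) (y : BP E) : Prop :=
  exists v u w a b W z, chart f k y v u w a b W z.

Lemma chart_refine f k y v u w a b W t z :
  path_from_to w (source z) t -> chart f k y v u w a b W (cat t z) ->
  chart f k y v u (source z) (a ++ t) (b ++ t) (fun z' => source z' = source z /\ W (cat t z')) z.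
Proof.
  intros Ht [Ha Hb oW Wz Hz Hp Hk Hm]. constructor; auto.
  - eapply pft_trans; eauto.
  - eapply pft_trans; eauto.
  - eapply open_pull; eauto.
  - rewrite cat_app; auto.
  - rewrite !length_app. lia.
  - intros z' Hz' [_ Wz']. rewrite !cat_app. apply Hm; auto. apply cat_source. rewrite Hz'; auto.
Qed.

Lemma chart_shrink f k y v u w a b W W' z :
  chart f k y v u w a b W z -> bd_open W' -> W' z ->
  chart f k y v u w a b (fun z => W z /\ W' z) z.
Proof.
  intros [] oW' W'z. constructor; auto.
  - apply open_inter; auto.
  - intros z' Hz' []; auto.
Qed.

Lemma chart_image f k y v u w a b W z : chart f k y v u w a b W z -> f y = cat a z.
Proof. intros []. subst y. auto. Qed.

Lemma acts_id y : acts (fun x => x) 0 y.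
Proof.
  exists (source y), (source y), (source y), [], [], (fun _ => True), y.
  constructor; auto using open_full; apply pft_nil; auto.
Qed.

Lemma acts_local_id (f : BP E -> BP E) W y : bd_open W -> W y -> (forall x, W x -> f x = x) ->
  acts f 0 y.
Proof.
  intros oW Wy H. exists (source y), (source y), (source y), [], [], W, y.
  constructor; auto; [apply pft_nil; auto|apply pft_nil; auto].
Qed.

Lemma acts_ext f f' W k y : bd_open W -> W y -> (forall x, W x -> f x = f' x) ->
  acts f k y -> acts f' k y.
Proof.
  intros oW Wy H (v & u & w & a & b & U & z & C).
  destruct C as [Ha Hb oU Uz Hz Hp Hk Hm].
  exists v, u, w, a, b, (fun z => U z /\ (source z = w /\ W (cat b z))), z. constructor; auto.
  - apply open_inter; auto. eapply open_pull; eauto.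
  - subst y; auto.
  - intros z' Hz' (Uz' & _ & Wz'). rewrite <- H; auto.
Qed.

(** The image word of the chart of [g] and the domain word of the chart of [f] are prefixes of one
    point; refining the chart with the shorter word makes them equal, and the lags add. *)
Lemma acts_comp f g k k' y : acts g k y -> acts f k' (g y) -> acts (fun x => f (g x)) (k' + k) y.
Proof.
  intros (v & u & w & a & b & W & z & C) (v' & u' & w' & a' & b' & W' & z' & C').
  assert (P := ch_a _ _ _ _ _ _ _ _ _ _ C). assert (P' := ch_b _ _ _ _ _ _ _ _ _ _ C').
  rewrite <- (ch_src _ _ _ _ _ _ _ _ _ _ C) in P. rewrite <- (ch_src _ _ _ _ _ _ _ _ _ _ C') in P'.
  assert (e : cat a z = cat b' z').
  { rewrite <- (chart_image _ _ _ _ _ _ _ _ _ _ C). apply C'. }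
  assert (H : forall w a b W z w' a' W', chart g k y v u w a b W z ->
     chart f k' (g y) v' u' w' a' a W' z -> acts (fun x => f (g x)) (k' + k) y).
  { clear. intros w a b W z w' a' W' [] [].
    exists v', u, w, a', b, (fun z => W z /\ W' z), z. constructor; auto.
    - subst; auto.
    - apply open_inter; auto.
    - lia.
    - intros z' Hz' []. rewrite ch_map0; auto. apply ch_map1; auto. congruence. }
  destruct (Nat.le_ge_cases (length a) (length b')) as [L|L].
  - destruct (cat_prefix _ _ _ _ _ _ P P' L e) as (t & -> & Ht & ->).
    rewrite (ch_src _ _ _ _ _ _ _ _ _ _ C) in Ht.
    eapply H; [|exact C']. eapply chart_refine; eauto.
  - destruct (cat_prefix _ _ _ _ _ _ P' P L (eq_sym e)) as (t & -> & Ht & ->).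
    rewrite (ch_src _ _ _ _ _ _ _ _ _ _ C') in Ht.
    eapply H; [exact C|]. eapply chart_refine; eauto.
Qed.

Lemma acts_inv f g k y : (forall x, g (f x) = x) -> acts f k y -> acts g (- k) (f y).
Proof.
  intros H (v & u & w & a & b & W & z & C). pose proof (chart_image _ _ _ _ _ _ _ _ _ _ C) as e.
  destruct C. exists u, v, w, b, a, W, z. constructor; auto.
  - lia.
  - intros z' Hz' Wz'. rewrite <- ch_map0; auto.
Qed.

Lemma acts_continuous f (W : BP E -> Prop) : (forall y, exists k, acts f k y) ->
  bd_open W -> bd_open (fun y => W (f y)).
Proof.
  intros H oW. apply open_local. intros y Wy. destruct (H y) as (k & v & u & w & a & b & U & z & C).
  rewrite (chart_image _ _ _ _ _ _ _ _ _ _ C) in Wy.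
  destruct C as [Ha Hb oU Uz Hz Hp Hk Hm].
  exists (fun p => exists z, source z = w /\ (U z /\ (source z = w /\ W (cat a z))) /\ p = cat b z).
  split; [|split].
  - eapply open_push; eauto. apply open_inter; auto. eapply open_pull; eauto.
  - exists z. subst y; auto.
  - intros p (z' & Hz' & (Uz' & _ & Wz') & ->). rewrite Hm; auto.
Qed.

(** The full group without bisections, as [full_group_iff] shows. Finitely many source vertices for
    moved points replace compactness of the support, since each vertex cylinder is compact. *)
Record local_homeo (f : BP E -> BP E) : Prop := {
  lh_inv : exists g, (forall x, g (f x) = x) /\ (forall x, f (g x) = x);
  lh_acts : forall y, exists k, acts f k y;
  lh_fin : exists vs, forall x, f x <> x -> In (source x) vs }.

Lemma local_homeo_id : local_homeo (fun x => x).
Proof.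
  constructor.
  - exists (fun x => x); auto.
  - intro y; exists 0%Z; apply acts_id.
  - exists []. congruence.
Qed.

Lemma local_homeo_comp f g : local_homeo f -> local_homeo g -> local_homeo (fun x => f (g x)).
Proof.
  intros [(f' & f1 & f2) af (vs & Hf)] [(g' & g1 & g2) ag (us & Hg)]. constructor.
  - exists (fun x => g' (f' x)). split; intro x; [rewrite f1|rewrite g2]; auto.
  - intro y. destruct (ag y) as (k & Hk). destruct (af (g y)) as (k' & Hk').
    exists (k' + k)%Z. apply acts_comp; auto.
  - exists (vs ++ us). intros x n. apply in_or_app.
    destruct (classic (g x = x)) as [e|]; auto. left. apply Hf. congruence.
Qed.

Lemma local_homeo_inv f g : local_homeo f -> (forall x, g (f x) = x) -> (forall x, f (g x) = x) ->
  local_homeo g.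
Proof.
  intros [_ af (vs & Hf)] gf fg. constructor.
  - exists f; auto.
  - intro y. destruct (af (g y)) as (k & Hk). exists (- k)%Z.
    rewrite <- (fg y). apply acts_inv; auto.
  - exists vs. intros x n. apply Hf. intro e. apply n. rewrite <- e at 1. apply gf.
Qed.

(** * Involutions exchanging two disjoint strands *)

Section Swap.
Variables (v u w : vert E) (F s t : list (edge E)).
Hypothesis Hs : path_from_to v w s.
Hypothesis Ht : path_from_to u w t.
Hypothesis D : strand_disjoint w F s t.

Definition in_strand (s : list (edge E)) (p : BP E) : Prop :=
  exists z, source z = w /\ avoids F z /\ p = cat s z.

(** The chosen tail is unique by [cat_inj], and disjointness of the strands keeps the two branches
    from competing. *)
Definition swap (p : BP E) : BP E :=
  match excluded_middle_informative (in_strand s p) with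
  | left H => cat t (proj1_sig (constructive_indefinite_description _ H))
  | right _ =>
    match excluded_middle_informative (in_strand t p) with
    | left H => cat s (proj1_sig (constructive_indefinite_description _ H))
    | right _ => p
    end
  end.

Lemma swap_l z : source z = w -> avoids F z -> swap (cat s z) = cat t z.
Proof.
  intros Hz Ha. unfold swap. destruct (excluded_middle_informative _) as [H|n].
  - destruct (constructive_indefinite_description _ H) as (z' & Hz' & Ha' & e); simpl.
    f_equal. symmetry. apply (cat_inj v v s s); auto; [rewrite Hz|rewrite Hz']; auto.
  - exfalso; apply n. exists z; auto.
Qed.

Lemma swap_r z : source z = w -> avoids F z -> swap (cat t z) = cat s z.
Proof.
  intros Hz Ha. unfold swap. destruct (excluded_middle_informative _) as [H|_].
  - exfalso. destruct H as (z' & Hz' & Ha' & e). apply (D z' z); auto.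
  - destruct (excluded_middle_informative _) as [H|n].
    + destruct (constructive_indefinite_description _ H) as (z' & Hz' & Ha' & e); simpl.
      f_equal. symmetry. apply (cat_inj u u t t); auto; [rewrite Hz|rewrite Hz']; auto.
    + exfalso; apply n. exists z; auto.
Qed.

Lemma swap_out p : ~ in_strand s p -> ~ in_strand t p -> swap p = p.
Proof.
  intros n n'. unfold swap. destruct (excluded_middle_informative _); [tauto|].
  destruct (excluded_middle_informative _); tauto.
Qed.

Lemma swap_involutive p : swap (swap p) = p.
Proof.
  destruct (classic (in_strand s p)) as [(z & Hz & Ha & ->)|n].
  - rewrite swap_l, swap_r; auto.
  - destruct (classic (in_strand t p)) as [(z & Hz & Ha & ->)|n'].
    + rewrite swap_r, swap_l; auto.
    + rewrite (swap_out p n n'). apply swap_out; auto.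
Qed.

Lemma in_strand_bas x l p : path_from_to x w l -> (in_strand l p <-> bas x l F p).
Proof.
  intro H. split; intros (z & Hz & Ha & e); exists z; split; auto.
  - rewrite Hz; auto.
  - eapply pft_end; eauto.
Qed.

Lemma avoids_chart f a b x y z : path_from_to x w a -> path_from_to y w b ->
  source z = w -> avoids F z ->
  (forall z, source z = w -> avoids F z -> f (cat b z) = cat a z) ->
  acts f (Z.of_nat (length a) - Z.of_nat (length b)) (cat b z).
Proof.
  intros Ha Hb Hz Az H. exists x, y, w, a, b, (bas w [] F), z. constructor; auto.
  - apply open_bas; simpl; auto.
  - exists z. rewrite pft_nil; auto.
  - intros z' _ (z2 & Hz2 & Az2 & ->). rewrite pft_nil in Hz2. apply H; auto.
Qed.

(** Off the strands the map is the identity on a neighbourhood, because strands are basic sets and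
    these are closed. *)
Lemma swap_local_homeo : local_homeo swap.
Proof.
  constructor.
  - exists swap. split; apply swap_involutive.
  - intro p. destruct (classic (in_strand s p)) as [(z & Hz & Ha & ->)|n].
    + eexists. apply (avoids_chart swap t s u v z); auto. apply swap_l.
    + destruct (classic (in_strand t p)) as [(z & Hz & Ha & ->)|n'].
      * eexists. apply (avoids_chart swap s t v u z); auto. apply swap_r.
      * exists 0%Z.
        apply (acts_local_id swap (fun p => ~ bas v s F p /\ ~ bas u t F p)).
        -- apply open_inter; apply bas_compl_open; [apply Hs|apply Ht].
        -- rewrite <- !in_strand_bas; auto.
        -- intros x. rewrite <- !in_strand_bas; auto. intros []. apply swap_out; auto.
  - exists [v; u]. intros x n. simpl.
    destruct (classic (in_strand s x)) as [(z & Hz & Ha & ->)|n1].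
    + left. symmetry. apply cat_source. rewrite Hz; auto.
    + destruct (classic (in_strand t x)) as [(z & Hz & Ha & ->)|n2].
      * right; left. symmetry. apply cat_source. rewrite Hz; auto.
      * exfalso. apply n, swap_out; auto.
Qed.

End Swap.

Hypothesis HS : no_sinks E.
Hypothesis HK : condK E.
Hypothesis HW : condW E.
Hypothesis HI : condInf E.

(** The tail of [x] is carried to a second strand. The common source is recorded because
    [acts_unique] compares tails inside one vertex cylinder. *)
Lemma no_isolated_points (W : BP E -> Prop) x : bd_open W -> W x ->
  exists y, W y /\ y <> x /\ source y = source x.
Proof.
  intros oW Wx.
  destruct (three_strands_exist HK HW HI HS W x oW Wx) as (w & F & s0 & s1 & s2 & z & T & Hz & Ha & e).
  exists (cat s1 z). split; [apply T; auto|]. split.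
  - rewrite e. intro q. apply (ts_disj01 _ _ _ _ _ _ _ T z z); auto.
  - apply cat_source. rewrite Hz. apply T.
Qed.

(** Charts are aligned to a common domain word. If the lags differed, two image words of different
    lengths would agree on an open set of tails, which [coincide_unique] reduces to one point. This
    is where effectiveness of the groupoid enters. *)
Lemma acts_unique f k k' y : acts f k y -> acts f k' y -> k = k'.
Proof.
  assert (H : forall k k' v u w a b W z v' u' w' a' b' W' z',
    chart f k y v u w a b W z -> chart f k' y v' u' w' a' b' W' z' ->
    length b <= length b' -> k = k').
  { clear k k'. intros k k' v u w a b W z v' u' w' a' b' W' z' C C' L.
    assert (P := ch_b _ _ _ _ _ _ _ _ _ _ C). assert (P' := ch_b _ _ _ _ _ _ _ _ _ _ C').
    rewrite <- (ch_src _ _ _ _ _ _ _ _ _ _ C) in P. rewrite <- (ch_src _ _ _ _ _ _ _ _ _ _ C') in P'.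
    assert (e : cat b z = cat b' z').
    { rewrite <- (ch_pt _ _ _ _ _ _ _ _ _ _ C). apply C'. }
    destruct (cat_prefix _ _ _ _ _ _ P P' L e) as (t & -> & Ht & ->).
    rewrite (ch_src _ _ _ _ _ _ _ _ _ _ C) in Ht.
    apply (chart_refine _ _ _ _ _ w) in C; auto.
    destruct C as [Ca Cb Co Cin Cs Cp Ck Cm], C' as [Ca' Cb' Co' Cin' Cs' Cp' Ck' Cm'].
    destruct (Nat.eq_dec (length (a ++ t)) (length a')) as [l|n]; [lia|exfalso].
    destruct (no_isolated_points _ z' (open_inter _ _ Co Co')) as (z2 & [W2 W2'] & n2 & S2); auto.
    apply n2. rewrite <- Cs' in Ca'. apply (coincide_unique v v' (source z') (a ++ t) a'); auto.
    - rewrite <- Cm, <- Cm'; auto. congruence.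
    - rewrite <- Cm, <- Cm'; auto. }
  intros (v & u & w & a & b & W & z & C) (v' & u' & w' & a' & b' & W' & z' & C').
  destruct (Nat.le_ge_cases (length b) (length b')) as [L|L].
  - eapply H; eauto.
  - symmetry. eapply H; eauto.
Qed.

(* Two points of a chart with [|a| <> |b|] cannot both be fixed, so every point of the
   chart is a limit of moved points. *)
Lemma acts_supp_open f : (forall y, exists k, acts f k y) -> bd_open (closure_moved bd_open f).
Proof.
  intro H. apply open_local. intros y Hy.
  destruct (H y) as (k & v & u & w & a & b & W & z & [Ca Cb Co Cin Cs Cp Ck Cm]).
  set (N := fun p => exists z, source z = w /\ W z /\ p = cat b z).
  assert (oN : bd_open N) by (eapply open_push; eauto).
  assert (Ny : N y) by (exists z; auto).
  exists N. split; [auto|split; [auto|]].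
  destruct (Nat.eq_dec (length a) (length b)) as [l|n].
  - destruct (classic (a = b)) as [e|ne].
    + exfalso. destruct (Hy N oN Ny) as (x & (z' & Hz' & Wz' & ->) & n).
      apply n. rewrite Cm; auto. congruence.
    + intros x (z' & Hz' & Wz' & ->) U oU Ux. exists (cat b z'). split; auto.
      rewrite Cm; auto. intro e. apply ne. rewrite <- Hz' in Ca, Cb.
      apply (cat_inj v u a b z' z'); auto.
  - intros x Nx U oU Ux.
    destruct (no_isolated_points _ x (open_inter _ _ oU oN)) as (x' & [Ux' Nx'] & nx & _); auto.
    destruct (classic (f x = x)) as [e|m]; [|eauto].
    destruct (classic (f x' = x')) as [e'|m]; [|eauto]. exfalso.
    destruct Nx as (z1 & Hz1 & W1 & ->), Nx' as (z2 & Hz2 & W2 & ->).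
    apply nx. f_equal. rewrite Cm in e, e'; auto. apply (coincide_unique v u w a b); auto.
Qed.

Lemma local_homeo_supp_compact f : local_homeo f -> compact_set bd_open (closure_moved bd_open f).
Proof.
  intros [_ _ (vs & H)]. apply (closed_compact vs).
  - apply open_local. intros x n. apply NNPP; intro n'. apply n. intros U oU Ux.
    apply NNPP; intro n2. apply n'. exists U. split; [auto|split; [auto|]].
    intros y Uy Hy. destruct (Hy U oU Uy) as (z & Uz & nz). eauto.
  - intros x Hx. destruct (Hx (fun y => source y = source x) (open_source (fun u => u = source x)) eq_refl)
      as (y & Hy & n). rewrite <- Hy. auto.
Qed.

End Local.

(** * Germs *)

Section Groupoid.
Context {E : graph}.

(** Splitting off the [m] and [n] shifted edges turns the equality of shifts into two words with a
    common tail. *)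
Lemma in_groupoid_strands (x y : BP E) k : in_groupoid (x, k, y) <->
  exists v u w a b z, path_from_to v w a /\ path_from_to u w b /\ source z = w /\
    x = cat a z /\ y = cat b z /\ k = (Z.of_nat (length a) - Z.of_nat (length b))%Z.
Proof.
  split.
  - intros (m & n & Lm & Ln & e & ->).
    destruct (len_split _ _ Lm) as (a & z & <- & Ha & ->).
    destruct (len_split _ _ Ln) as (b & z' & <- & Hb & ->).
    rewrite (shift_cat_full _ _ _ Ha), (shift_cat_full _ _ _ Hb) in e.
    apply BP_ext in e. subst z'.
    exists (source (cat a z)), (source (cat b z)), (source z), a, b, z. auto 10.
  - intros (v & u & w & a & b & z & Ha & Hb & Hz & -> & -> & ->). rewrite <- Hz in Ha, Hb.
    exists (length a), (length b). split; [|split; [|split]]; auto.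
    + eapply len_cat_full; eauto.
    + eapply len_cat_full; eauto.
    + rewrite (shift_cat_full _ _ _ Ha), (shift_cat_full _ _ _ Hb); auto.
Qed.

Lemma groupoid_mul (x y w : BP E) k k' :
  in_groupoid (x, k, y) -> in_groupoid (y, k', w) -> in_groupoid (x, (k + k')%Z, w).
Proof.
  rewrite !in_groupoid_strands.
  intros (v1 & v2 & v3 & a & b & z & Ha & Hb & Hz & -> & -> & ->)
    (v4 & v5 & v6 & b' & c & z' & Hb' & Hc & Hz' & e & -> & ->).
  rewrite <- Hz in *. rewrite <- Hz' in *.
  destruct (Nat.le_ge_cases (length b) (length b')) as [L|L].
  - destruct (cat_prefix _ _ _ _ _ _ Hb Hb' L e) as (t & -> & Ht & ->).
    exists v1, v5, (source z'), (a ++ t), c, z'. rewrite cat_app, !length_app.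
    repeat split; auto; try lia; try apply Hc; eapply pft_trans; eauto.
  - destruct (cat_prefix _ _ _ _ _ _ Hb' Hb L (eq_sym e)) as (t & -> & Ht & ->).
    exists v1, v5, (source z), a, (c ++ t), z. rewrite cat_app, !length_app.
    repeat split; auto; try lia; try apply Ha; eapply pft_trans; eauto.
Qed.

Lemma GE_ext (g h : GE E) : g_r g = g_r h -> g_k g = g_k h -> g_s g = g_s h -> g = h.
Proof.
  destruct g as [[[x k] y] Hg], h as [[[x' k'] y'] Hh]. unfold g_r, g_k, g_s; simpl.
  intros; subst. f_equal. apply proof_irrelevance.
Qed.

Lemma GE_make (x y : BP E) k : in_groupoid (x, k, y) ->
  exists g : GE E, g_r g = x /\ g_k g = k /\ g_s g = y.
Proof. intro H. exists (exist _ (x, k, y) H). auto. Qed.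

Lemma GE_in (g : GE E) : in_groupoid (g_r g, g_k g, g_s g).
Proof. destruct g as [[[x k] y] Hg]. exact Hg. Qed.

(** The basic bisection usually written Z(a,O,b), parametrised by the common tail in [O]. *)
Definition gstrand (w : vert E) (a b : list (edge E)) (O : BP E -> Prop) (g : GE E) : Prop :=
  exists z, source z = w /\ O z /\ g_r g = cat a z /\ g_s g = cat b z /\
    g_k g = (Z.of_nat (length a) - Z.of_nat (length b))%Z.

Lemma push_shift_inj v w a (O : BP E -> Prop) : path_from_to v w a ->
  shift_inj_on E (fun p => exists z, source z = w /\ O z /\ p = cat a z) (length a).
Proof.
  intro Ha. split.
  - intros x (z & Hz & _ & ->). apply (len_cat_full v). rewrite Hz; auto.
  - intros x y (z & Hz & _ & ->) (z' & Hz' & _ & ->) e.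
    rewrite !(shift_cat_full v) in e; try (rewrite ?Hz, ?Hz'; auto; fail).
    f_equal. apply BP_ext; auto.
Qed.

Lemma gstrand_basic v u w a b (O : BP E -> Prop) : path_from_to v w a -> path_from_to u w b ->
  bd_open O -> g_basic E (gstrand w a b O).
Proof.
  intros Ha Hb oO.
  assert (sa : forall z, source z = w -> shift (length a) (proj1_sig (cat a z)) = proj1_sig z)
    by (intros z Hz; apply (shift_cat_full v); rewrite Hz; auto).
  assert (sb : forall z, source z = w -> shift (length b) (proj1_sig (cat b z)) = proj1_sig z)
    by (intros z Hz; apply (shift_cat_full u); rewrite Hz; auto).
  exists (fun p => exists z, source z = w /\ O z /\ p = cat a z),
    (fun p => exists z, source z = w /\ O z /\ p = cat b z), (length a), (length b).
  split; [eapply open_push; eauto|]. split; [eapply open_push; eauto|].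
  split; [eapply push_shift_inj; eauto|]. split; [eapply push_shift_inj; eauto|]. split.
  - intro q. split; intros (x & (z & Hz & Oz & ->) & <-).
    + exists (cat b z). rewrite sa, sb; eauto 6.
    + exists (cat a z). rewrite sa, sb; eauto 6.
  - intro g. split.
    + intros (z & Hz & Oz & er & es & ek). rewrite er, es, sa, sb; eauto 10.
    + intros ((z & Hz & Oz & er) & (z' & Hz' & Oz' & es) & ek & e).
      rewrite er, es, sa, sb in e; auto. apply BP_ext in e. subst z'. exists z; auto.
Qed.

Lemma g_open_intro (W : GE E -> Prop) :
  (forall g, W g -> exists v u w a b O, path_from_to v w a /\ path_from_to u w b /\ bd_open O /\
     gstrand w a b O g /\ forall g', gstrand w a b O g' -> W g') -> g_open E W.
Proof.
  intros H g Wg. destruct (H g Wg) as (v & u & w & a & b & O & Ha & Hb & oO & Sg & I).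
  exists [gstrand w a b O]. split.
  - intros A [<-|[]]. split; auto. eapply gstrand_basic; eauto.
  - intros g' Hg'. apply I, Hg'; simpl; auto.
Qed.

(** The words are lengthened by [t] until they reach past positions [m] and [n]; the equation
    between the lags makes both happen at once. The equality of shifts then becomes an equality of
    the words [skipn m a1] and [skipn n b1], which no longer depends on the tail. *)
Lemma gstrand_refine v u w a b (O : BP E -> Prop) (U V : BP E -> Prop) m n g :
  path_from_to v w a -> path_from_to u w b -> bd_open O -> gstrand w a b O g ->
  bd_open U -> bd_open V -> shift_inj_on E U m -> shift_inj_on E V n ->
  U (g_r g) -> V (g_s g) -> g_k g = (Z.of_nat m - Z.of_nat n)%Z ->
  shift m (proj1_sig (g_r g)) = shift n (proj1_sig (g_s g)) ->
  exists w' a' b' O', path_from_to v w' a' /\ path_from_to u w' b' /\ bd_open O' /\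
    gstrand w' a' b' O' g /\
    forall g', gstrand w' a' b' O' g' -> gstrand w a b O g' /\ U (g_r g') /\ V (g_s g') /\
      g_k g' = (Z.of_nat m - Z.of_nat n)%Z /\
      shift m (proj1_sig (g_r g')) = shift n (proj1_sig (g_s g')).
Proof.
  intros Ha Hb oO (z & Hz & Oz & er & es & ek) oU oV [lU _] _ Ur Vs ek' e.
  assert (Ht : exists t z1, path_from_to w (source z1) t /\ z = cat t z1 /\ m <= length (a ++ t)).
  { destruct (Nat.le_gt_cases m (length a)) as [L|L].
    - exists [], z. rewrite pft_nil, app_nil_r; auto.
    - specialize (lU _ Ur). rewrite er in lU.
      replace m with (length a + (m - length a)) in lU by lia.
      rewrite (len_cat v) in lU by (rewrite Hz; auto).
      destruct (len_split _ _ lU) as (t & z1 & Lt & Ht & ->). exists t, z1.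
      rewrite Hz in Ht. rewrite length_app. split; [auto|split; [auto|lia]]. }
  destruct Ht as (t & z1 & Ht & -> & L).
  remember (source z1) as w1 eqn:Hz1. symmetry in Hz1.
  assert (Ha1 : path_from_to v w1 (a ++ t)) by (eapply pft_trans; eauto).
  assert (Hb1 : path_from_to u w1 (b ++ t)) by (eapply pft_trans; eauto).
  rewrite <- cat_app in er, es.
  assert (Lk : length (a ++ t) + n = length (b ++ t) + m) by (rewrite !length_app in *; lia).
  set (a1 := a ++ t) in *. set (b1 := b ++ t) in *.
  (* Both points agree beyond positions m and n, hence so do the two prefixes. *)
  assert (split_at : forall v l j, path_from_to v w1 l -> j <= length l ->
    exists v', path_from_to v' w1 (skipn j l) /\ forall y, source y = w1 ->
      shift j (proj1_sig (cat l y)) = proj1_sig (cat (skipn j l) y)).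
  { intros v0 l j Hl Lj. rewrite <- (firstn_skipn j l) in Hl. apply pft_app in Hl.
    destruct Hl as (v' & H1 & H2). exists v'. split; auto. intros y Hy.
    rewrite <- (firstn_skipn j l) at 1. rewrite cat_app.
    rewrite <- Hy in H2. rewrite <- (cat_source _ _ _ H2) in H1.
    pose proof (shift_cat_full _ _ _ H1) as q. rewrite length_firstn, Nat.min_l in q; auto. }
  destruct (split_at v a1 m Ha1 L) as (va & Hva & Sa).
  destruct (split_at u b1 n Hb1 ltac:(lia)) as (vb & Hvb & Sb).
  assert (es1 : skipn m a1 = skipn n b1).
  { rewrite er, es, Sa, Sb in e; auto. apply BP_ext in e.
    rewrite <- Hz1 in Hva, Hvb.
    destruct (cat_inj _ _ _ _ _ _ Hva Hvb) with (2 := e) as [q _]; auto.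
    rewrite !length_skipn. lia. }
  exists w1, a1, b1, (fun y => (source y = w1 /\ O (cat t y)) /\
    ((source y = w1 /\ U (cat a1 y)) /\ (source y = w1 /\ V (cat b1 y)))).
  split; auto. split; auto. split; [|split].
  - apply open_inter; [eapply open_pull; eauto|].
    apply open_inter; eapply open_pull; eauto.
  - exists z1. rewrite <- er, <- es. repeat split; auto. rewrite ek.
    unfold a1, b1. rewrite !length_app. lia.
  - intros g' (y & Hy & ((_ & Oy) & (_ & Uy) & (_ & Vy)) & er' & es' & ek1).
    rewrite er', es', Sa, Sb, es1; auto.
    assert (kk : g_k g' = g_k g).
    { rewrite ek1, ek. unfold a1, b1. rewrite !length_app. lia. }
    split; [|rewrite kk; auto].
    exists (cat t y). split; [apply cat_source; rewrite Hy; auto|]. split; auto.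
    rewrite <- !cat_app. rewrite kk. auto.
Qed.

Lemma g_open_nbhd (W : GE E -> Prop) g : g_open E W -> W g ->
  exists v u w a b O, path_from_to v w a /\ path_from_to u w b /\ bd_open O /\
     gstrand w a b O g /\ forall g', gstrand w a b O g' -> W g'.
Proof.
  intros oW Wg. destruct (oW g Wg) as (Bs & HB & HI).
  assert (H : exists v u w a b O, path_from_to v w a /\ path_from_to u w b /\ bd_open O /\
     gstrand w a b O g /\ forall g', gstrand w a b O g' -> forall A, In A Bs -> A g').
  { clear HI. induction Bs as [|A Bs IH].
    - destruct (proj1 (in_groupoid_strands _ _ _) (GE_in g))
        as (v & u & w & a & b & z & Ha & Hb & Hz & er & es & ek).
      exists v, u, w, a, b, (fun _ => True). split; auto. split; auto.
      split; [apply open_full|]. split; [exists z; auto|]. intros ? ? ? [].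
    - destruct IH as (v & u & w & a & b & O & Ha & Hb & oO & Sg & I); [intros; apply HB; simpl; auto|].
      destruct (HB A (or_introl eq_refl)) as [(U & V & m & n & oU & oV & iU & iV & _ & HA) Ag].
      apply HA in Ag. destruct Ag as (Ur & Vs & ek & e).
      destruct (gstrand_refine v u w a b O U V m n g Ha Hb oO Sg oU oV iU iV Ur Vs ek e)
        as (w' & a' & b' & O' & Ha' & Hb' & oO' & Sg' & I').
      exists v, u, w', a', b', O'. split; auto. split; auto. split; auto. split; auto.
      intros g' Hg' A' [<-|i].
      + apply HA. apply I'; auto.
      + apply (I g'); auto. apply I'; auto. }
  destruct H as (v & u & w & a & b & O & Ha & Hb & oO & Sg & I).
  exists v, u, w, a, b, O. split; auto. split; auto. split; auto. split; auto.
  intros g' Hg'. apply HI. exact (I g' Hg').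
Qed.

Definition germ (f : BP E -> BP E) (g : GE E) : Prop :=
  f (g_s g) = g_r g /\ acts f (g_k g) (g_s g).

Lemma germ_exists f k y : acts f k y -> exists g, g_s g = y /\ g_k g = k /\ germ f g.
Proof.
  intros Hf. assert (A := Hf). destruct A as (v & u & w & a & b & W & z & C).
  pose proof (chart_image _ _ _ _ _ _ _ _ _ _ C) as e. destruct C.
  destruct (GE_make (f y) y k) as (g & er & ek & es).
  { apply in_groupoid_strands. exists v, u, w, a, b, z. auto 10. }
  exists g. unfold germ. rewrite er, ek, es. auto.
Qed.

Lemma gstrand_acts f v u w a b (O : BP E -> Prop) g : path_from_to v w a -> path_from_to u w b ->
  bd_open O -> gstrand w a b O g -> (forall g', gstrand w a b O g' -> f (g_s g') = g_r g') ->
  acts f (g_k g) (g_s g).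
Proof.
  intros Ha Hb oO (z & Hz & Oz & er & es & ek) H.
  exists v, u, w, a, b, O, z. constructor; auto.
  intros z' Hz' Oz'.
  destruct (GE_make (cat a z') (cat b z') (Z.of_nat (length a) - Z.of_nat (length b))) as (g' & er' & ek' & es').
  { apply in_groupoid_strands. exists v, u, w, a, b, z'. auto 10. }
  rewrite <- er', <- es'. apply H. exists z'. auto.
Qed.

Lemma chart_gstrand f k y v u w a b W z : chart f k y v u w a b W z ->
  forall g, gstrand w a b W g -> germ f g.
Proof.
  intros [] g (z' & Hz' & Wz' & er & es & ek). unfold germ. rewrite er, es, ek. split; auto.
  exists v, u, w, a, b, W, z'. constructor; auto.
Qed.

(** Injectivity of the range on the bisection inverts [f], and a basic set inside the bisection is a
    chart. The finite list of vertices comes from covering the compact support by vertex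
    cylinders. *)
Lemma full_group_local_homeo f : full_group E f -> local_homeo f.
Proof.
  intros (U & ((oU & ir & is) & fr & fs) & Hf & K). constructor.
  - assert (H : forall x, exists y, exists g, U g /\ g_r g = x /\ g_s g = y).
    { intro x. destruct (fr x) as (g & Ug & e). exists (g_s g), g. auto. }
    destruct (choice _ H) as (h & Hh). exists h. split; intro x.
    + destruct (fs x) as (g & Ug & <-). rewrite (Hf g Ug).
      destruct (Hh (g_r g)) as (g' & Ug' & er & <-). rewrite (ir g' g); auto.
    + destruct (Hh x) as (g & Ug & er & es). rewrite <- es, (Hf g Ug); auto.
  - intro y. destruct (fs y) as (g & Ug & <-). exists (g_k g).
    destruct (g_open_nbhd U g oU Ug) as (v & u & w & a & b & O & Ha & Hb & oO & Sg & I).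
    apply (gstrand_acts f v u w a b O); auto.
  - destruct (K (fun V => exists v, V = (fun p => source p = v))) as (Us & HUs & cov).
    + intros V (v & ->). apply (open_source (fun u => u = v)).
    + intros x _. exists (fun p => source p = source x). eauto.
    + assert (H : exists vs, forall p, (exists V, In V Us /\ V p) -> In (source p) vs).
      { clear cov. induction Us as [|V Us IH].
        - exists []. intros p (V & [] & _).
        - destruct IH as (vs & IH); [intros; apply HUs; simpl; auto|].
          destruct (HUs V (or_introl eq_refl)) as (v & ->).
          exists (v :: vs). intros p (V & [<-|i] & Vp); [left; auto|right; eauto]. }
      destruct H as (vs & Hvs). exists vs. intros x n. apply Hvs, cov.
      intros V oV Vx. eauto.
Qed.

Hypothesis HS : no_sinks E.
Hypothesis HK : condK E.
Hypothesis HW : condW E.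
Hypothesis HI : condInf E.

(** The bisection is the set of all germs of [f]; [acts_unique] makes range and source injective on
    it. *)
Lemma local_homeo_full_group f : local_homeo f -> full_group E f.
Proof.
  intros L. pose proof L as [(h & hf & fh) af _]. exists (germ f). split; [|split].
  - split; [split; [|split]|split].
    + apply g_open_intro. intros g [e (v & u & w & a & b & W & z & C)].
      exists v, u, w, a, b, W. pose proof C as C'. destruct C.
      split; auto. split; auto. split; auto. split.
      * exists z. rewrite <- e. rewrite (chart_image _ _ _ _ _ _ _ _ _ _ C'). auto.
      * eapply chart_gstrand; eauto.
    + intros g g' [e A] [e' A'] er. assert (es : g_s g = g_s g').
      { rewrite <- (hf (g_s g)), <- (hf (g_s g')). congruence. }
      apply GE_ext; auto. rewrite es in A. eapply (acts_unique HS HK HW HI); eauto.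
    + intros g g' [e A] [e' A'] es. apply GE_ext; auto; [congruence|].
      rewrite es in A. eapply (acts_unique HS HK HW HI); eauto.
    + intro x. destruct (af (h x)) as (k & Hk). destruct (germ_exists f k _ Hk) as (g & es & _ & G).
      exists g. split; auto. destruct G as [<- _]. rewrite es; auto.
    + intro x. destruct (af x) as (k & Hk). destruct (germ_exists f k _ Hk) as (g & es & _ & G).
      eauto.
  - intros g [e _]; auto.
  - apply (local_homeo_supp_compact f L).
Qed.

Lemma full_group_iff f : full_group E f <-> local_homeo f.
Proof. split; auto using full_group_local_homeo, local_homeo_full_group. Qed.

Lemma full_subgroup : subgroup_of (full_group E) (full_group E).
Proof.
  split; [auto|]. split; [|split].
  - apply full_group_iff, local_homeo_id.
  - intros f g. rewrite !full_group_iff. apply local_homeo_comp.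
  - intros f Hf. apply full_group_iff in Hf. pose proof Hf as [(g & gf & fg) _ _].
    exists g. split; auto. apply full_group_iff. eapply local_homeo_inv; eauto.
Qed.

(* With [a = (0 1)] and [b = (0 2)], the commutator [a b a^-1 b^-1 = (a b)^2] is the
   three-cycle [(0 1 2)]. *)
Lemma three_cycle v0 v1 v2 w F s0 s1 s2 :
  path_from_to v0 w s0 -> path_from_to v1 w s1 -> path_from_to v2 w s2 ->
  strand_disjoint w F s0 s1 -> strand_disjoint w F s0 s2 -> strand_disjoint w F s1 s2 ->
  exists c, comm_sub (full_group E) c /\
    (forall z, source z = w -> avoids F z -> c (cat s0 z) = cat s1 z) /\
    (forall z, source z = w -> avoids F z -> c (cat s1 z) = cat s2 z) /\
    (forall z, source z = w -> avoids F z -> c (cat s2 z) = cat s0 z) /\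
    (forall p, ~ in_strand w F s0 p -> ~ in_strand w F s1 p -> ~ in_strand w F s2 p -> c p = p).
Proof.
  intros H0 H1 H2 D01 D02 D12.
  set (a := swap w F s0 s1). set (b := swap w F s0 s2).
  assert (na : forall z, source z = w -> avoids F z -> a (cat s2 z) = cat s2 z).
  { intros z Hz Ha. apply swap_out; intros (z' & Hz' & Ha' & e).
    - apply (D02 z' z); auto.
    - apply (D12 z' z); auto. }
  assert (nb : forall z, source z = w -> avoids F z -> b (cat s1 z) = cat s1 z).
  { intros z Hz Ha. apply swap_out; intros (z' & Hz' & Ha' & e).
    - apply (D01 z' z); auto.
    - apply (D12 z z'); auto. }
  assert (a0 : forall z, source z = w -> avoids F z -> a (cat s0 z) = cat s1 z)
    by (intros; eapply swap_l; eauto).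
  assert (a1 : forall z, source z = w -> avoids F z -> a (cat s1 z) = cat s0 z)
    by (intros; eapply swap_r; eauto).
  assert (b0 : forall z, source z = w -> avoids F z -> b (cat s0 z) = cat s2 z)
    by (intros; eapply swap_l; eauto).
  assert (b2 : forall z, source z = w -> avoids F z -> b (cat s2 z) = cat s0 z)
    by (intros; eapply swap_r; eauto).
  assert (aa : forall p, a (a p) = p) by (intro; eapply swap_involutive; eauto).
  assert (bb : forall p, b (b p) = p) by (intro; eapply swap_involutive; eauto).
  exists (fun p => a (b (a (b p)))). split; [|split; [|split; [|split]]].
  - apply (cs_mul (full_group E) (fun p => a (b (a (b p)))) (fun p => p) a b).
    + apply local_homeo_full_group. eapply swap_local_homeo; eauto.
    + apply local_homeo_full_group. eapply swap_local_homeo; eauto.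
    + intro x. rewrite bb, aa; auto.
    + apply cs_id.
  - intros z Hz Ha. rewrite b0, na, b2, a0; auto.
  - intros z Hz Ha. rewrite nb, a1, b0, na; auto.
  - intros z Hz Ha. rewrite b2, a0, nb, a1; auto.
  - intros p n0 n1 n2. assert (ap : a p = p) by (apply swap_out; auto).
    assert (bp : b p = p) by (apply swap_out; auto). rewrite bp, ap, bp, ap; auto.
Qed.

Lemma comm_sub_comp {T : Type} (H : (T -> T) -> Prop) f g :
  comm_sub H f -> comm_sub H g -> comm_sub H (fun x => f (g x)).
Proof.
  intros Hf Hg. induction Hf as [|c f a b Ha Hb e Hf IH]; auto.
  apply (cs_mul H c (fun x => f (g x)) a b); auto.
Qed.

(** Distinct range and source have disjoint neighbourhoods, and tails are restricted to [O] so that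
    both words land in them. With strands [s0], [s1] inside [O], the words [b s0], [a s0], [a s1]
    are disjoint, and the three-cycle takes [b s0] to [a s0]. *)
Lemma comm_germ_off_diagonal g : g_r g <> g_s g ->
  exists c, comm_sub (full_group E) c /\ germ c g.
Proof.
  intro n. destruct (proj1 (in_groupoid_strands _ _ _) (GE_in g))
    as (v & u & w & a & b & z & Ha & Hb & Hz & er & es & ek).
  destruct (BP_hausdorff _ _ n) as (P & Q & oP & oQ & Px & Qy & D).
  rewrite er in Px. rewrite es in Qy.
  set (O := fun z => (source z = w /\ P (cat a z)) /\ (source z = w /\ Q (cat b z))).
  assert (oO : bd_open O) by (apply open_inter; eapply open_pull; eauto).
  destruct (three_strands_exist HK HW HI HS O z oO) as (w1 & F & s0 & s1 & s2 & z0 & T & Hz0 & Az0 & e).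
  { repeat split; auto. }
  rewrite Hz in T. destruct T as [T0 T1 _ I0 I1 _ D01 _ _].
  destruct (three_cycle u v v w1 F (b ++ s0) (a ++ s0) (a ++ s1)) as (c & Hc & c0 & _).
  - eapply pft_trans; eauto.
  - eapply pft_trans; eauto.
  - eapply pft_trans; eauto.
  - intros y y' Hy Hay Hy' Hay' q. rewrite !cat_app in q. apply (D (cat a (cat s0 y'))).
    + apply I0; auto.
    + rewrite <- q. apply I0; auto.
  - intros y y' Hy Hay Hy' Hay' q. rewrite !cat_app in q. apply (D (cat a (cat s1 y'))).
    + apply I1; auto.
    + rewrite <- q. apply I0; auto.
  - intros y y' Hy Hay Hy' Hay' q. rewrite !cat_app in q. apply (D01 y y'); auto.
    apply (cat_inj v v a a); auto.
    + rewrite (cat_source w); auto. rewrite Hy; auto.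
    + rewrite (cat_source w); auto. rewrite Hy'; auto.
  - exists c. split; auto. split.
    + rewrite er, es, e, <- !cat_app. auto.
    + rewrite ek, es, e, <- cat_app.
      replace (Z.of_nat (length a) - Z.of_nat (length b))%Z
        with (Z.of_nat (length (a ++ s0)) - Z.of_nat (length (b ++ s0)))%Z
        by (rewrite !length_app; lia).
      apply (avoids_chart w1 F c (a ++ s0) (b ++ s0) v u z0); auto; eapply pft_trans; eauto.
Qed.

(** The three-cycle on strands inside [W] is the identity on the complement of the strands, which is
    open, so even the closure of its moved points stays in [W]. *)
Lemma comm_moves (W : BP E -> Prop) x : bd_open W -> W x ->
  exists c, comm_sub (full_group E) c /\ c x <> x /\
    (forall y, closure_moved bd_open c y -> W y) /\ (forall y, c (c (c y)) = y).
Proof.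
  intros oW Wx.
  destruct (three_strands_exist HK HW HI HS W x oW Wx) as (w & F & s0 & s1 & s2 & z & T & Hz & Az & e).
  destruct T as [T0 T1 T2 I0 I1 I2 D01 D02 D12].
  destruct (three_cycle _ _ _ w F s0 s1 s2 T0 T1 T2 D01 D02 D12) as (c & Hc & c0 & c1 & c2 & cn).
  exists c. split; auto. split; [|split].
  - rewrite e, c0; auto. intro q. apply (D01 z z); auto.
  - intros y Hy.
    destruct (classic (in_strand w F s0 y)) as [(y' & Hy' & Ay & ->)|n0]; [auto|].
    destruct (classic (in_strand w F s1 y)) as [(y' & Hy' & Ay & ->)|n1]; [auto|].
    destruct (classic (in_strand w F s2 y)) as [(y' & Hy' & Ay & ->)|n2]; [auto|].
    exfalso.
    destruct (Hy (fun p => ~ bas (source x) s0 F p /\ (~ bas (source x) s1 F p /\ ~ bas (source x) s2 F p)))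
      as (p & (m0 & m1 & m2) & m).
    + apply open_inter; [|apply open_inter]; apply bas_compl_open; [apply T0|apply T1|apply T2].
    + rewrite <- !(in_strand_bas w); auto.
    + apply m, cn; rewrite (in_strand_bas w); eauto.
  - intro y.
    destruct (classic (in_strand w F s0 y)) as [(y' & Hy' & Ay & ->)|n0]; [rewrite c0, c1, c2; auto|].
    destruct (classic (in_strand w F s1 y)) as [(y' & Hy' & Ay & ->)|n1]; [rewrite c1, c2, c0; auto|].
    destruct (classic (in_strand w F s2 y)) as [(y' & Hy' & Ay & ->)|n2]; [rewrite c2, c0, c1; auto|].
    assert (cy : c y = y) by auto. rewrite !cy; auto.
Qed.

Lemma comm_sub_full f : comm_sub (full_group E) f -> full_group E f.
Proof.
  destruct full_subgroup as (_ & Hid & Hcomp & Hinv).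
  intro H. induction H as [|c f a b Ha Hb e Hf IH]; auto.
  apply (Hcomp c f); auto.
  destruct (Hinv a Ha) as (a' & Ha' & a'a & aa').
  destruct (Hinv b Hb) as (b' & Hb' & b'b & bb').
  assert (ec : c = (fun x => a (b (a' (b' x))))).
  { apply functional_extensionality; intro x. rewrite <- e, aa', bb'; auto. }
  rewrite ec. apply (Hcomp a (fun x => b (a' (b' x)))); auto.
Qed.

(* An isotropy element is a product of two elements with distinct range and source. *)
Lemma comm_germ g : exists c, comm_sub (full_group E) c /\ germ c g.
Proof.
  destruct (classic (g_r g = g_s g)) as [er|n]; [|apply comm_germ_off_diagonal; auto].
  destruct (comm_moves (fun _ => True) (g_s g) open_full I) as (c0 & H0 & m & _).
  pose proof (full_group_local_homeo _ (comm_sub_full _ H0)) as [_ A _].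
  destruct (A (g_s g)) as (k0 & Hk0).
  destruct (germ_exists _ _ _ Hk0) as (g0 & es0 & ek0 & [e0 _]).
  pose proof (GE_in g0) as i0. rewrite es0, ek0, <- e0, es0 in i0.
  assert (inv : in_groupoid (g_s g, (- k0)%Z, c0 (g_s g))).
  { apply in_groupoid_strands in i0.
    destruct i0 as (v & u & w & a & b & z & Ha & Hb & Hz & e1 & e2 & ek).
    apply in_groupoid_strands. exists u, v, w, b, a, z. repeat (split; auto). lia. }
  (* [g1] is [g] times the inverse of [g0]. Its source is [c0 (g_s g)], which differs from its range
     [g_s g]. *)
  destruct (GE_make _ _ _ (groupoid_mul _ _ _ _ _ (GE_in g) inv)) as (g1 & er1 & ek1 & es1).
  destruct (comm_germ_off_diagonal g1) as (c1 & H1 & [e1 A1]).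
  { rewrite er1, es1, er. auto. }
  rewrite es1, er1 in e1. rewrite es1, ek1 in A1.
  exists (fun x => c1 (c0 x)). split; [apply comm_sub_comp; auto|]. split; auto.
  replace (g_k g) with (g_k g + - k0 + k0)%Z by lia. apply acts_comp; auto.
Qed.

(** The upper bound supplies continuity and the properties of supports, the lower bound the small
    elements, so every group between the two qualifies. *)
Lemma graph_rubin_action (Gam : (BP E -> BP E) -> Prop) :
  subgroup_of Gam (full_group E) -> (forall f, comm_sub (full_group E) f -> Gam f) ->
  rubin_action bd_open Gam.
Proof.
  intros (S1 & S2 & S3 & S4) C.
  assert (L : forall f, Gam f -> local_homeo f) by (intros; apply full_group_local_homeo; auto).
  constructor; auto.
  - apply open_full.
  - apply open_inter.
  - apply open_local.
  - apply BP_hausdorff.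
  - intros f U Gf. apply acts_continuous. apply L; auto.
  - intros f Gf. apply (acts_supp_open HS HK HW HI). apply L; auto.
  - intros f Gf. apply local_homeo_supp_compact; auto.
  - intros U x oU Ux. destruct (comm_moves U x oU Ux) as (c & Hc & R). exists c. auto.
Qed.

End Groupoid.

(** * Transport of germs *)

Lemma gen_open_iff {T : Type} (B : (T -> Prop) -> Prop) (W W' : T -> Prop) :
  (forall t, W t <-> W' t) -> gen_open B W -> gen_open B W'.
Proof.
  intros e H t Wt. apply e in Wt. destruct (H t Wt) as (Bs & HB & I).
  exists Bs. split; auto. intros s Hs. apply e, I, Hs.
Qed.

Section Germs.
Context {E : graph}.
Hypothesis HS : no_sinks E.
Hypothesis HK : condK E.
Hypothesis HW : condW E.
Hypothesis HI : condInf E.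

(** Charts may be based on any words with the right point, image and lag: domain words of the same
    point are comparable, and the lag then forces the image words to match. *)
Lemma chart_rebase f k v u w a b (z : BP E) : path_from_to v w a -> path_from_to u w b ->
  source z = w -> acts f k (cat b z) -> f (cat b z) = cat a z ->
  k = (Z.of_nat (length a) - Z.of_nat (length b))%Z ->
  exists O, chart f k (cat b z) v u w a b O z.
Proof.
  intros Ha Hb Hz (v' & u' & w' & a' & b' & W & z' & C) ef ek.
  assert (e := ch_pt _ _ _ _ _ _ _ _ _ _ C). assert (P' := ch_b _ _ _ _ _ _ _ _ _ _ C).
  rewrite (chart_image _ _ _ _ _ _ _ _ _ _ C) in ef.
  assert (Pb := Hb). assert (Pa := Ha). rewrite <- Hz in Pb, Pa.
  assert (sz' := ch_src _ _ _ _ _ _ _ _ _ _ C).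
  rewrite <- sz' in P'.
  destruct (Nat.le_ge_cases (length b) (length b')) as [L|L].
  - destruct (cat_prefix _ _ _ _ _ _ Pb P' L e) as (t & -> & Ht & ->).
    destruct C as [Ca Cb Co Cin Cs Cp Ck Cm].
    assert (Pat : path_from_to v (source z') (a ++ t)).
    { eapply pft_trans; [|exact Ht]. rewrite Hz; auto. }
    rewrite <- sz' in Ca. rewrite <- cat_app in ef.
    rewrite length_app in Ck.
    destruct (cat_inj _ _ _ _ _ _ Ca Pat ltac:(rewrite length_app; lia) ef) as [-> _].
    rewrite Hz, sz' in Ht.
    exists (fun y => exists y', source y' = w' /\ W y' /\ y = cat t y'). constructor; auto.
    + eapply open_push; eauto.
    + eauto.
    + intros y _ (y' & Hy' & Wy' & ->). rewrite <- !cat_app. auto.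
  - destruct (cat_prefix _ _ _ _ _ _ P' Pb L (eq_sym e)) as (t & -> & Ht & ->).
    rewrite sz' in Ht.
    apply (chart_refine _ _ _ _ _ w') in C; auto.
    destruct C as [Ca Cb Co Cin Cs Cp Ck Cm].
    rewrite <- cat_app in ef.
    assert (ea : a' ++ t = a).
    { apply (cat_inj _ _ _ _ _ _ Ca Pa); auto. lia. }
    subst a.
    exists (fun y => source y = source z /\ W (cat t y)). subst w. constructor; auto.
Qed.

Lemma germ_agree f f' (g : GE E) : germ f g -> germ f' g ->
  exists O, bd_open O /\ O (g_s g) /\ forall y, O y -> f y = f' y.
Proof.
  intros [e (v & u & w & a & b & W & z & C)] [e' A'].
  pose proof (chart_image _ _ _ _ _ _ _ _ _ _ C) as ea. destruct C as [Ca Cb Co Cin Cs Cp Ck Cm].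
  rewrite Cp in A'.
  destruct (chart_rebase f' _ v u w a b z Ca Cb Cs A') as (O & [_ _ oO Oz _ _ _ M]); auto.
  { rewrite <- Cp; congruence. }
  exists (fun y => exists z, source z = w /\ (W z /\ O z) /\ y = cat b z). split; [|split].
  - eapply open_push; eauto. apply open_inter; auto.
  - exists z; auto.
  - intros y (z' & Hz' & [W' O'] & ->). rewrite Cm, M; auto.
Qed.

(** Near its source a germ of [f] varies inside a given basic bisection: rebasing fixes the words,
    and [acts_unique] fixes the lag. [transfer_open] needs this to turn closeness of sources into
    closeness of germs. *)
Lemma germ_gstrand f v u w a b (O : BP E -> Prop) g : path_from_to v w a -> path_from_to u w b ->
  bd_open O -> gstrand w a b O g -> germ f g ->
  exists N, bd_open N /\ N (g_s g) /\ forall g', N (g_s g') -> germ f g' -> gstrand w a b O g'.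
Proof.
  intros Ha Hb oO (z & Hz & Oz & er & es & ek) [e A].
  rewrite es in A.
  destruct (chart_rebase f _ v u w a b z Ha Hb Hz A) as (O' & [_ _ oO' Oz' _ _ _ M]); auto.
  { rewrite <- es; congruence. }
  exists (fun y => exists z, source z = w /\ (O z /\ O' z) /\ y = cat b z). split; [|split].
  - eapply open_push; eauto. apply open_inter; auto.
  - exists z; auto.
  - intros g' (z' & Hz' & [O1 O1'] & es') [e' A']. exists z'. split; auto. split; auto.
    rewrite es' in e', A'. rewrite <- e', M; auto. split; auto. split; auto.
    apply (acts_unique HS HK HW HI f _ _ _ A').
    exists v, u, w, a, b, O', z'. constructor; auto.
Qed.

End Germs.

Section Transfer.
Context {E F : graph}.
Context {Gam : (BP E -> BP E) -> Prop} {Lam : (BP F -> BP F) -> Prop}.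
Context {R : (BP E -> BP E) -> (BP F -> BP F) -> Prop}.
Context {phi : BP E -> BP F} {psi : BP F -> BP E}.
Hypothesis ES : no_sinks E.
Hypothesis EK : condK E.
Hypothesis EW : condW E.
Hypothesis EI : condInf E.
Hypothesis FS : no_sinks F.
Hypothesis FK : condK F.
Hypothesis FW : condW F.
Hypothesis FI : condInf F.
Hypothesis EG : forall f, comm_sub (full_group E) f -> Gam f.
Hypothesis LF : forall f, Lam f -> full_group F f.
Hypothesis GC : group_corr Gam Lam R.
Hypothesis psiphi : forall x, psi (phi x) = x.
Hypothesis phipsi : forall y, phi (psi y) = y.
Hypothesis phi_cont : forall V, bd_open V -> bd_open (fun x => V (phi x)).
Hypothesis psi_cont : forall U, bd_open U -> bd_open (fun y => U (psi y)).
Hypothesis equiv : forall f f', R f f' -> forall x, phi (f x) = f' (phi x).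

(** The graph of the isomorphism sought: a germ of [f] at a point goes to the germ of the partner of
    [f] at the image point. *)
Definition transfer (g : GE E) (h : GE F) : Prop :=
  exists f f', R f f' /\ germ f g /\ germ f' h /\ g_s h = phi (g_s g).

Lemma transfer_source g h : transfer g h -> g_s h = phi (g_s g).
Proof. intros (f & f' & _ & _ & _ & e); auto. Qed.

Lemma transfer_range g h : transfer g h -> g_r h = phi (g_r g).
Proof.
  intros (f & f' & r & [e _] & [e' _] & es). rewrite <- e', <- e, es. symmetry; auto.
Qed.

Lemma transfer_germ f f' g : R f f' -> germ f g -> exists h, transfer g h /\ germ f' h.
Proof.
  intros r G. assert (L : local_homeo f').
  { apply full_group_local_homeo, LF. eapply gc_r; eauto. }
  destruct L as [_ A _]. destruct (A (phi (g_s g))) as (k & Hk).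
  destruct (germ_exists _ _ _ Hk) as (h & es & _ & G').
  exists h. split; auto. exists f, f'; auto.
Qed.

Lemma transfer_total g : exists h, transfer g h.
Proof.
  destruct (comm_germ ES EK EW EI g) as (c & Hc & G).
  destruct (gc_tot _ _ _ GC c (EG c Hc)) as (c' & r).
  destruct (transfer_germ c c' g r G) as (h & T & _). eauto.
Qed.

(** Two elements with germ [g] agree near its source, so their partners, being conjugates by [phi],
    agree near the image point. They then have equal lags there. *)
Lemma transfer_unique g h h' : transfer g h -> transfer g h' -> h = h'.
Proof.
  intros T T'. pose proof (transfer_source _ _ T) as es. pose proof (transfer_source _ _ T') as es'.
  pose proof (transfer_range _ _ T) as er. pose proof (transfer_range _ _ T') as er'.
  apply GE_ext; try congruence.
  destruct T as (f1 & f1' & r1 & G1 & [_ A1] & _), T' as (f2 & f2' & r2 & G2 & [_ A2] & _).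
  destruct (germ_agree f1 f2 g G1 G2) as (O & oO & Og & HO).
  apply (acts_unique FS FK FW FI f2' _ _ (g_s h')); auto.
  rewrite es', <- es. apply (acts_ext f1' f2' (fun y => O (psi y))); auto.
  - rewrite es, psiphi; auto.
  - intros y Oy. rewrite <- (phipsi y), <- (equiv _ _ r1), <- (equiv _ _ r2). f_equal; auto.
Qed.

Lemma transfer_mul g h k g' h' k' : transfer g g' -> transfer h h' -> transfer k k' ->
  g_mul_rel E g h k -> g_mul_rel F g' h' k'.
Proof.
  intros Tg Th Tk (e1 & e2 & e3 & e4).
  split; [|split; [|split]].
  - rewrite (transfer_source _ _ Tg), (transfer_range _ _ Th); congruence.
  - rewrite (transfer_range _ _ Tg), (transfer_range _ _ Tk); congruence.
  - rewrite (transfer_source _ _ Th), (transfer_source _ _ Tk); congruence.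
  - pose proof (transfer_source _ _ Tg) as esg. pose proof (transfer_range _ _ Th) as erh.
    destruct Tg as (f1 & f1' & r1 & [q1 A1] & [q1' A1'] & _).
    destruct Th as (f2 & f2' & r2 & [q2 A2] & [q2' A2'] & s2).
    assert (B : acts (comp f1' f2') (g_k g' + g_k h') (g_s h')).
    { apply (acts_comp f1' f2'); auto. rewrite q2', erh, <- e1, <- esg; auto. }
    destruct (germ_exists _ _ _ B) as (k2 & s & ek & G).
    rewrite <- ek. f_equal. apply (transfer_unique k); auto.
    exists (comp f1 f2), (comp f1' f2'). split; [eapply gc_comp; eauto|]. split; [|split; auto].
    + split; unfold comp; rewrite e3.
      * rewrite q2, <- e1, q1; auto.
      * rewrite e4. apply (acts_comp f1 f2); auto. rewrite q2, <- e1; auto.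
    + congruence.
Qed.

(** A single [f] represents all germs near [g], and its partner represents their transfers. By
    continuity of [phi] the sources of the transfers stay close to that of [h], which suffices by
    [germ_gstrand]. *)
Lemma transfer_open W : g_open F W -> g_open E (fun g => exists h, transfer g h /\ W h).
Proof.
  intro oW. apply g_open_intro. intros g (h & T & Wh).
  pose proof (transfer_source _ _ T) as es.
  destruct T as (f & f' & r & G & G' & _).
  destruct (g_open_nbhd W h oW Wh) as (v & u & w & a & b & O & Ha & Hb & oO & Sh & I).
  destruct (germ_gstrand FS FK FW FI f' v u w a b O h Ha Hb oO Sh G') as (N & oN & Nh & HN).
  pose proof G as [e (v1 & u1 & w1 & a1 & b1 & W1 & z1 & C)].
  pose proof (ch_pt _ _ _ _ _ _ _ _ _ _ C) as ep.
  assert (C' := chart_shrink _ _ _ _ _ _ _ _ _ (fun z => source z = w1 /\ N (phi (cat b1 z))) _ C).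
  pose proof (chart_image _ _ _ _ _ _ _ _ _ _ C) as ei.
  destruct C as [Ca Cb Co Cin Cs Cp Ck Cm].
  exists v1, u1, w1, a1, b1, (fun z => W1 z /\ (source z = w1 /\ N (phi (cat b1 z)))).
  assert (o2 : bd_open (fun z => source z = w1 /\ N (phi (cat b1 z)))).
  { apply (open_pull u1 w1 b1 (fun x => N (phi x))); auto. }
  assert (N1 : source z1 = w1 /\ N (phi (cat b1 z1))).
  { split; auto. rewrite <- ep, <- es; auto. }
  specialize (C' o2 N1).
  split; auto. split; auto. split; [apply open_inter; auto|]. split.
  - exists z1. split; auto. split; auto. rewrite <- ei, e. auto.
  - intros g' Sg'. assert (Gg' := chart_gstrand _ _ _ _ _ _ _ _ _ _ C' _ Sg').
    destruct (transfer_germ f f' g' r Gg') as (h' & T' & Gh').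
    exists h'. split; auto. apply I, HN; auto.
    rewrite (transfer_source _ _ T'). destruct Sg' as (z' & _ & (_ & _ & Nz') & _ & -> & _). auto.
Qed.

End Transfer.

Lemma transfer_sym {E F : graph} {R : (BP E -> BP E) -> (BP F -> BP F) -> Prop}
  {phi : BP E -> BP F} {psi : BP F -> BP E} g h :
  (forall x, psi (phi x) = x) ->
  transfer (R := R) (phi := phi) g h -> transfer (R := fun f' f => R f f') (phi := psi) h g.
Proof.
  intros H (f & f' & r & G & G' & e). exists f', f. split; auto. split; auto. split; auto.
  rewrite e, H; auto.
Qed.

(** * Groupoid isomorphisms *)

(** Carrying the inverse explicitly makes the notion symmetric, so facts about the induced map of
    unit spaces hold for both directions. *)
Record groupoid_iso_pair {E F : graph} (Phi : GE E -> GE F) (Psi : GE F -> GE E) : Prop := {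
  gi_PsiPhi : forall g, Psi (Phi g) = g;
  gi_PhiPsi : forall h, Phi (Psi h) = h;
  gi_cont : forall W, g_open F W -> g_open E (fun g => W (Phi g));
  gi_open : forall W, g_open E W -> g_open F (fun h => W (Psi h));
  gi_mul : forall g h k, g_mul_rel E g h k -> g_mul_rel F (Phi g) (Phi h) (Phi k);
  gi_mul' : forall g h k, g_mul_rel F g h k -> g_mul_rel E (Psi g) (Psi h) (Psi k) }.

Lemma groupoid_iso_pair_sym {E F : graph} (Phi : GE E -> GE F) Psi :
  groupoid_iso_pair Phi Psi -> groupoid_iso_pair Psi Phi.
Proof. intros []. constructor; auto. Qed.

Lemma groupoid_iso_of_pair {E F : graph} (Phi : GE E -> GE F) Psi :
  groupoid_iso_pair Phi Psi -> groupoid_iso E F.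
Proof.
  intros []. exists Phi. split; [|split; [|split; [|split]]]; auto.
  - intros g g' e. rewrite <- (gi_PsiPhi0 g), e; auto.
  - intro h; exists (Psi h); auto.
  - intros W oW. apply (gen_open_iff _ (fun h => W (Psi h))); [|apply gi_open0; auto].
    intro h. split.
    + intro Wh. exists (Psi h); auto.
    + intros (g & Wg & <-). rewrite gi_PsiPhi0; auto.
  - intros g h k. split; auto. intro H. apply gi_mul'0 in H. rewrite !gi_PsiPhi0 in H; auto.
Qed.

Lemma groupoid_iso_pair_exists (E F : graph) : groupoid_iso E F ->
  exists (Phi : GE E -> GE F) Psi, groupoid_iso_pair Phi Psi.
Proof.
  intros (Phi & inj & sur & cont & opn & mul).
  destruct (choice _ sur) as (Psi & HP). exists Phi, Psi.
  constructor; auto.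
  - intros W oW. apply (gen_open_iff _ (fun h => exists g, W g /\ Phi g = h)); [|apply opn; auto].
    intro h. split.
    + intros (g & Wg & <-). assert (e : Psi (Phi g) = g) by (apply inj; auto). rewrite e; auto.
    + intro Wh. exists (Psi h); auto.
  - intros g h k. apply mul.
  - intros g h k. rewrite mul, !HP; auto.
Qed.

Section Units.
Context {E F : graph} {Phi : GE E -> GE F} {Psi : GE F -> GE E}.
Hypothesis P : groupoid_iso_pair Phi Psi.

Lemma unit_in_groupoid {G : graph} (x : BP G) : in_groupoid (x, 0%Z, x).
Proof. exists 0, 0. repeat split; auto using len_0. Qed.

Definition unit_at {G : graph} (x : BP G) : GE G := exist _ (x, 0%Z, x) (unit_in_groupoid x).

Definition base_map {G H : graph} (T : GE G -> GE H) (x : BP G) : BP H := g_r (T (unit_at x)).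

(** A unit is idempotent, hence so is its image, whose lag satisfies [k = k + k] and whose range and
    source agree. *)
Lemma base_unit x : Phi (unit_at x) = unit_at (base_map Phi x).
Proof.
  assert (M : g_mul_rel E (unit_at x) (unit_at x) (unit_at x)) by (repeat split).
  apply (gi_mul _ _ P) in M. destruct M as (e1 & _ & _ & e2). apply GE_ext.
  - reflexivity.
  - simpl. unfold g_k at 2; simpl. lia.
  - rewrite e1. reflexivity.
Qed.

Lemma base_range g : g_r (Phi g) = base_map Phi (g_r g).
Proof.
  assert (M : g_mul_rel E (unit_at (g_r g)) g g) by (repeat split).
  apply (gi_mul _ _ P) in M. destruct M as (e1 & _). rewrite <- e1, base_unit. reflexivity.
Qed.

Lemma base_source g : g_s (Phi g) = base_map Phi (g_s g).
Proof.
  assert (M : g_mul_rel E g (unit_at (g_s g)) g).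
  { repeat split. unfold g_k at 3; simpl. lia. }
  apply (gi_mul _ _ P) in M. destruct M as (e1 & _). exact e1.
Qed.

(** The range map is continuous, and so is its composite with [Phi]; a neighbourhood of a unit
    contains the units at all nearby points. *)
Lemma base_continuous V : bd_open V -> bd_open (fun x => V (base_map Phi x)).
Proof.
  intro oV.
  assert (oW : g_open F (fun h => V (g_r h))).
  { apply g_open_intro. intros h Vh.
    destruct (proj1 (in_groupoid_strands _ _ _) (GE_in h))
      as (v & u & w & a & b & z & Ha & Hb & Hz & er & es & ek).
    exists v, u, w, a, b, (fun z => source z = w /\ V (cat a z)). rewrite er in Vh.
    split; auto. split; auto. split; [eapply open_pull; eauto|]. split; [exists z; auto|].
    intros h' (z' & _ & (_ & Vz') & -> & _). auto. }
  apply (gi_cont _ _ P) in oW. apply open_local. intros x Vx.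
  destruct (g_open_nbhd _ (unit_at x) oW Vx) as (v & u & w & a & b & O & Ha & Hb & oO & S & I).
  destruct S as (z & Hz & Oz & er & es & ek). unfold g_r, g_k, g_s in er, es, ek; simpl in *.
  exists (fun p => exists z, source z = w /\ O z /\ p = cat a z). split; [|split].
  - eapply open_push; eauto.
  - eauto.
  - assert (e : cat a z = cat b z) by congruence. assert (Pa := Ha). assert (Pb := Hb).
    rewrite <- Hz in Pa, Pb.
    (* Lag zero gives the two words equal length, so they coincide and the basic bisection consists
       of units. *)
    destruct (cat_inj _ _ _ _ _ _ Pa Pb ltac:(lia) e) as [<- _].
    intros p (z' & Hz' & Oz' & ->). apply (I (unit_at (cat a z'))).
    exists z'. repeat split; auto.
Qed.

End Units.

Lemma base_inverse {E F : graph} {Phi : GE E -> GE F} {Psi : GE F -> GE E} :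
  groupoid_iso_pair Phi Psi -> forall x, base_map Psi (base_map Phi x) = x.
Proof.
  intros P x. unfold base_map at 1. rewrite <- (base_unit P), (gi_PsiPhi _ _ P). reflexivity.
Qed.

Lemma full_group_transport {E F : graph} {Phi : GE E -> GE F} {Psi : GE F -> GE E} f :
  groupoid_iso_pair Phi Psi -> full_group E f ->
  full_group F (fun y => base_map Phi (f (base_map Psi y))).
Proof.
  intros P (U & ((oU & ir & is) & fr & fs) & Hf & K).
  pose proof (groupoid_iso_pair_sym _ _ P) as P'.
  pose proof (base_inverse P) as I. pose proof (base_inverse P') as I'.
  exists (fun h => U (Psi h)). split; [|split].
  - split; [split; [|split]|split].
    + apply (gi_open _ _ P); auto.
    + intros h h' Uh Uh' e. rewrite <- (gi_PhiPsi _ _ P h), <- (gi_PhiPsi _ _ P h'). f_equal.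
      apply ir; auto. rewrite !(base_range P'). congruence.
    + intros h h' Uh Uh' e. rewrite <- (gi_PhiPsi _ _ P h), <- (gi_PhiPsi _ _ P h'). f_equal.
      apply is; auto. rewrite !(base_source P'). congruence.
    + intro y. destruct (fr (base_map Psi y)) as (g & Ug & e). exists (Phi g).
      rewrite (gi_PsiPhi _ _ P), (base_range P), e. auto.
    + intro y. destruct (fs (base_map Psi y)) as (g & Ug & e). exists (Phi g).
      rewrite (gi_PsiPhi _ _ P), (base_source P), e. auto.
  - intros h Uh. rewrite <- (base_source P'), (Hf _ Uh), (base_range P'), I'. auto.
  - intros C oC cov.
    destruct (K (fun U => exists V, C V /\ U = (fun x => V (base_map Phi x)))) as (Us & HUs & cov').
    + intros V (V' & CV & ->). apply (base_continuous P); auto.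
    + intros x Hx. destruct (cov (base_map Phi x)) as (V & CV & Vx).
      * intros V oV Vx. destruct (Hx _ (base_continuous P V oV) Vx) as (y & Vy & n).
        exists (base_map Phi y). split; auto. rewrite I. intro e. apply n.
        rewrite <- (I (f y)), e. auto.
      * exists (fun x => V (base_map Phi x)). eauto.
    + exists (map (fun U => fun y => U (base_map Psi y)) Us). split.
      * intros V iV. apply in_map_iff in iV. destruct iV as (U0 & <- & i).
        destruct (HUs U0 i) as (V & CV & ->).
        replace (fun y => V (base_map Phi (base_map Psi y))) with V; auto.
        apply functional_extensionality; intro y. rewrite I'; auto.
      * intros y Hy. destruct (cov' (base_map Psi y)) as (U0 & i & U0y).
        -- intros V oV Vx. destruct (Hy _ (base_continuous P' V oV) Vx) as (y' & Vy & n).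
           exists (base_map Psi y'). split; auto. intro e. apply n. rewrite e; auto.
        -- exists (fun y => U0 (base_map Psi y)). split; auto.
           apply in_map_iff. exists U0; auto.
Qed.

(** * Isomorphisms of groups of homeomorphisms *)

Lemma group_corr_of_iso {X Y : Type} (G : (X -> X) -> Prop) (H : (Y -> Y) -> Prop) :
  (forall f g, G f -> G g -> G (fun x => f (g x))) ->
  group_iso G H -> exists R, group_corr G H R.
Proof.
  intros clG (ph & Hm & Hi & Hs & Hc). exists (fun f g => G f /\ ph f = g). constructor.
  - tauto.
  - intros f g [Gf <-]; auto.
  - eauto.
  - intros g Hg. destruct (Hs g Hg) as (f & Gf & e); eauto.
  - intros f g g' [_ <-] [_ <-]; auto.
  - intros f f' g [Gf <-] [Gf' e]. auto.
  - intros f g f' g' [Gf <-] [Gf' <-]. split; [apply (clG f f'); auto|apply (Hc f f'); auto].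
Qed.

Lemma group_iso_of_corr {X Y : Type} (G : (X -> X) -> Prop) (H : (Y -> Y) -> Prop) R :
  group_corr G H R -> group_iso G H.
Proof.
  intros [cl cr ct cs cf ci cc].
  (* Off [G] the value is arbitrary; [group_iso] asks for a total map but constrains it on [G]
     alone. *)
  set (ph := fun f => epsilon (inhabits (fun y : Y => y)) (fun g => R f g)).
  assert (Rp : forall f, G f -> R f (ph f)).
  { intros f Gf. apply epsilon_spec. auto. }
  exists ph. split; [|split; [|split]].
  - eauto.
  - intros f g Gf Gg e. apply (ci f g (ph f)); [auto|rewrite e; auto].
  - intros h Hh. destruct (cs h Hh) as (f & r). exists f. split; [eauto|]. eapply cf; [|exact r]. eauto.
  - intros f g Gf Gg. assert (r := cc _ _ _ _ (Rp f Gf) (Rp g Gg)).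
    eapply cf; [|exact r]. apply Rp. eauto.
Qed.

Lemma corr_comm_sub {X Y : Type} {op : (X -> Prop) -> Prop} {op' : (Y -> Prop) -> Prop}
  {G : (X -> X) -> Prop} {H : (Y -> Y) -> Prop} {R : (X -> X) -> (Y -> Y) -> Prop} :
  rubin_action op G -> rubin_action op' H -> group_corr G H R ->
  (forall f, comm_sub G f -> G f) ->
  forall f g, R f g -> comm_sub G f -> comm_sub H g.
Proof.
  intros RX RY GC CG f g r Hf. revert g r.
  induction Hf as [|c f a b Ga Gb e Hf IH]; intros g r.
  - rewrite (gc_fun _ _ _ GC _ _ _ r (corr_id RX RY GC)). apply cs_id.
  - assert (Gc : G c) by (apply CG; exact (cs_mul G c (fun x => x) a b Ga Gb e (cs_id G))).
    destruct (gc_tot _ _ _ GC _ Ga) as (a' & ra). destruct (gc_tot _ _ _ GC _ Gb) as (b' & rb).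
    destruct (gc_tot _ _ _ GC _ Gc) as (c' & rc). destruct (gc_tot _ _ _ GC _ (CG f Hf)) as (f' & rf).
    rewrite (gc_fun _ _ _ GC _ _ _ r (gc_comp _ _ _ GC _ _ _ _ rc rf)).
    apply (cs_mul H c' f' a' b'); auto; try (eapply gc_r; eauto; fail).
    assert (q : comp c' (comp b' a') = comp a' b').
    { apply (corr_comp_eq GC c c' (comp b a) _ a _ b); auto.
      - eapply gc_comp; eauto.
      - apply functional_extensionality; exact e. }
    intro x. exact (f_equal (fun k => k x) q).
Qed.

(** * Reconstruction of the groupoid and the implications between the three isomorphisms *)

Section Graphs.
Variables E F : graph.
Hypothesis ES : no_sinks E.
Hypothesis EK : condK E.
Hypothesis EW : condW E.
Hypothesis EI : condInf E.
Hypothesis FS : no_sinks F.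
Hypothesis FK : condK F.
Hypothesis FW : condW F.
Hypothesis FI : condInf F.

(** The transfer relation of the inverse correspondence is the converse relation, so totality and
    uniqueness on both sides make it the graph of a bijection, and continuity and multiplicativity
    for each direction follow from one argument. *)
Lemma isomorphism_theorem (Gam : (BP E -> BP E) -> Prop) (Lam : (BP F -> BP F) -> Prop) :
  subgroup_of Gam (full_group E) -> (forall f, comm_sub (full_group E) f -> Gam f) ->
  subgroup_of Lam (full_group F) -> (forall f, comm_sub (full_group F) f -> Lam f) ->
  group_iso Gam Lam -> groupoid_iso E F.
Proof.
  intros SG CG SL CL iso.
  destruct (group_corr_of_iso Gam Lam) as (R & GC); auto; [apply SG|].
  pose proof (group_corr_sym _ _ _ GC) as GC'.
  destruct (spatial_realization (graph_rubin_action ES EK EW EI Gam SG CG)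
    (graph_rubin_action FS FK FW FI Lam SL CL) GC) as (phi & psi & i1 & i2 & c1 & c2 & eqv).
  assert (eqv' : forall f' f, R f f' -> forall y, psi (f' y) = f (psi y)).
  { intros f' f r y. rewrite <- (i2 y) at 1. rewrite <- (eqv _ _ r), i1; auto. }
  assert (LE : forall f, Gam f -> full_group E f) by apply SG.
  assert (LF : forall f, Lam f -> full_group F f) by apply SL.
  set (T := transfer (R := R) (phi := phi)).
  set (T' := transfer (R := fun f' f => R f f') (phi := psi)).
  assert (TT' : forall g h, T g h <-> T' h g).
  { intros g h. split; apply transfer_sym; auto. }
  assert (U : forall g h h', T g h -> T g h' -> h = h')
    by (apply (transfer_unique FS FK FW FI i1 i2 c2 eqv)).
  assert (U' : forall h g g', T' h g -> T' h g' -> g = g')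
    by (apply (transfer_unique ES EK EW EI i2 i1 c1 eqv')).
  destruct (choice T (transfer_total ES EK EW EI CG LF GC)) as (Phi & HPhi).
  destruct (choice T' (transfer_total FS FK FW FI CL LE GC')) as (Psi & HPsi).
  apply (groupoid_iso_of_pair Phi Psi). constructor.
  - intro g. apply (U' (Phi g)); auto. apply TT'; auto.
  - intro h. apply (U (Psi h)); auto. apply TT'; auto.
  - intros W oW.
    apply (gen_open_iff _ (fun g => exists h, T g h /\ W h)).
    + intro g. split; [|eauto]. intros (h & Th & Wh). rewrite (U g (Phi g) h); auto.
    + apply (transfer_open FS FK FW FI LF GC c1); auto.
  - intros W oW.
    apply (gen_open_iff _ (fun h => exists g, T' h g /\ W g)).
    + intro h. split; [|eauto]. intros (g & Tg & Wg). rewrite (U' h (Psi h) g); auto.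
    + apply (transfer_open ES EK EW EI LE GC' c2); auto.
  - intros g h k. apply (transfer_mul FS FK FW FI GC i1 i2 c2 eqv); apply HPhi.
  - intros g h k. apply (transfer_mul ES EK EW EI GC' i2 i1 c1 eqv'); apply HPsi.
Qed.

(** The isomorphism is conjugation by the induced homeomorphism of unit spaces. *)
Lemma groupoid_iso_full_groups : groupoid_iso E F -> group_iso (full_group E) (full_group F).
Proof.
  intro iso. destruct (groupoid_iso_pair_exists E F iso) as (Phi & Psi & P).
  pose proof (groupoid_iso_pair_sym _ _ P) as P'.
  pose proof (base_inverse P) as I. pose proof (base_inverse P') as I'.
  apply (group_iso_of_corr _ _ (fun f g => full_group E f /\ full_group F g /\
    forall x, base_map Phi (f x) = g (base_map Phi x))).
  destruct (full_subgroup ES EK EW EI) as (_ & _ & compE & _).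
  destruct (full_subgroup FS FK FW FI) as (_ & _ & compF & _).
  constructor.
  - tauto.
  - tauto.
  - intros f Hf. eexists. split; auto. split; [apply (full_group_transport f P Hf)|].
    intro x. simpl. rewrite I; auto.
  - intros g Hg. eexists. split; [apply (full_group_transport g P' Hg)|]. split; auto.
  - intros f g g' (_ & _ & e) (_ & _ & e'). apply functional_extensionality; intro y.
    rewrite <- (I' y), <- e, <- e'; auto.
  - intros f f' g (_ & _ & e) (_ & _ & e'). apply functional_extensionality; intro x.
    rewrite <- (I (f x)), <- (I (f' x)), e, e'; auto.
  - intros f g f' g' (Hf & Hg & e) (Hf' & Hg' & e'). split; [apply (compE f f'); auto|].
    split; [apply (compF g g'); auto|]. intro x. unfold comp. rewrite e, e'; auto.
Qed.

(** Membership in the commutator subgroup is expressed by equations between compositions, so the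
    correspondence of the full groups restricts in both directions. *)
Lemma full_groups_commutators : group_iso (full_group E) (full_group F) ->
  group_iso (comm_sub (full_group E)) (comm_sub (full_group F)).
Proof.
  intro iso. pose proof (full_subgroup ES EK EW EI) as SE. pose proof (full_subgroup FS FK FW FI) as SF.
  pose proof (comm_sub_full ES EK EW EI) as CE. pose proof (comm_sub_full FS FK FW FI) as CF.
  pose proof (graph_rubin_action ES EK EW EI _ SE CE) as RE.
  pose proof (graph_rubin_action FS FK FW FI _ SF CF) as RF.
  destruct (group_corr_of_iso (full_group E) (full_group F)) as (R & GC); auto; [apply SE|].
  pose proof (group_corr_sym _ _ _ GC) as GC'.
  pose proof (corr_comm_sub RE RF GC CE) as H. pose proof (corr_comm_sub RF RE GC' CF) as H'.
  apply (group_iso_of_corr _ _ (fun f g => R f g /\ comm_sub (full_group E) f /\ comm_sub (full_group F) g)).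
  constructor.
  - tauto.
  - tauto.
  - intros f Hf. destruct (gc_tot _ _ _ GC f (CE f Hf)) as (g & r). exists g. eauto.
  - intros g Hg. destruct (gc_sur _ _ _ GC g (CF g Hg)) as (f & r). exists f. eauto.
  - intros f g g' (r & _) (r' & _). eapply gc_fun; eauto.
  - intros f f' g (r & _) (r' & _). eapply gc_inj; eauto.
  - intros f g f' g' (r & Hf & Hg) (r' & Hf' & Hg'). split; [eapply gc_comp; eauto|].
    split; [apply (comm_sub_comp _ f f')|apply (comm_sub_comp _ g g')]; auto.
Qed.

End Graphs.

Lemma comm_subgroup (E : graph) : no_sinks E -> condK E -> condW E -> condInf E ->
  subgroup_of (comm_sub (full_group E)) (full_group E).
Proof.
  intros ES EK EW EI. destruct (full_subgroup ES EK EW EI) as (_ & Hid & Hcomp & Hinv).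
  pose proof (comm_sub_full ES EK EW EI) as C.
  split; [auto|]. split; [apply cs_id|]. split; [apply comm_sub_comp|].
  intros f Hf. induction Hf as [|c f a b Ha Hb e Hf IH].
  - exists (fun x => x). split; [apply cs_id|auto].
  - destruct IH as (f' & Hf' & f'f & ff').
    destruct (Hinv a Ha) as (a' & Ha' & a'a & aa').
    destruct (Hinv b Hb) as (b' & Hb' & b'b & bb').
    assert (ec : forall x, c x = a (b (a' (b' x)))) by (intro x; rewrite <- e, aa', bb'; auto).
    (* The inverse of [[a,b]] is [[b,a]]. *)
    set (c' := fun x => b (a (b' (a' x)))).
    exists (fun x => f' (c' x)). split; [|split].
    + apply (comm_sub_comp _ f' c'); auto.
      apply (cs_mul (full_group E) c' (fun x => x) b a); auto; [|apply cs_id].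
      intro x. unfold c'. rewrite a'a, b'b; auto.
    + intro x. unfold c'. rewrite ec, a'a, b'b, aa', bb'; auto.
    + intro x. rewrite ff', ec. unfold c'. rewrite b'b, a'a, bb', aa'; auto.
Qed.

Theorem theorem10p10 (E F : graph) :
  no_sinks E -> condK E -> condW E -> condInf E ->
  no_sinks F -> condK F -> condW F -> condInf F ->
  (forall (Gam : (BP E -> BP E) -> Prop) (Lam : (BP F -> BP F) -> Prop),
     subgroup_of Gam (full_group E) ->
     (forall f, comm_sub (full_group E) f -> Gam f) ->
     subgroup_of Lam (full_group F) ->
     (forall f, comm_sub (full_group F) f -> Lam f) ->
     group_iso Gam Lam -> groupoid_iso E F) /\
  (groupoid_iso E F <-> group_iso (full_group E) (full_group F)) /\
  (group_iso (full_group E) (full_group F) <->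
   group_iso (comm_sub (full_group E)) (comm_sub (full_group F))).
Proof.
  intros ES EK EW EI FS FK FW FI.
  pose proof (isomorphism_theorem E F ES EK EW EI FS FK FW FI) as main.
  pose proof (groupoid_iso_full_groups E F ES EK EW EI FS FK FW FI) as i12.
  pose proof (full_groups_commutators E F ES EK EW EI FS FK FW FI) as i23.
  assert (i21 : group_iso (full_group E) (full_group F) -> groupoid_iso E F).
  { apply main; auto using full_subgroup, comm_sub_full. }
  (* The commutator subgroups are themselves admissible choices of [Gam] and [Lam]; condition (3)
     thus gives (1), and (2) is reached from there. *)
  assert (i31 : group_iso (comm_sub (full_group E)) (comm_sub (full_group F)) -> groupoid_iso E F).
  { apply main; auto using comm_subgroup. }
  split; [exact main|]. split; split; auto.
Qed.
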